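(* Let $H$, $h$, $g$ be as in the context and suppose that (h-regularity), (g-structure), (g-compactness), (H-growth), (H-smoothness), (monotonicity) and (degenerate structure with drift growth), all formulated in the context, hold. Let $(m^\epsilon,u^\epsilon)\in D(A^\epsilon)$ be solutions of the regularized system (given in the context). Let $(m,u)\in L^1(\mathbb{T}^d)\times W^{1,\gamma}(\mathbb{T}^d)$, with $m\ge0$ and $\int_{\mathbb{T}^d}m\,dx=1$, be a weak solution of the mean-field game system (given in the context) obtained as a weak sublimit of $(m^\epsilon,u^\epsilon)_\epsilon$ in $L^1(\mathbb{T}^d)\times W^{1,\gamma}(\mathbb{T}^d)$ as $\epsilon\to(0,0)$, i.e. as the weak limit along some sequence of parameters $\epsilon$ tending to $(0,0)$. Let $q=\frac{(\alpha+1)\gamma}{(\alpha+1)\gamma-\alpha}$ and set $J^\epsilon=m^\epsilon D_pH(x,Du^\epsilon,m^\epsilon,h(m^\epsilon))$. Then there exists $J\in L^q(\mathbb{T}^d;\mathbb{R}^d)$ such that, up to extracting a further subsequence, $J^\epsilon\rightharpoonup J$ weakly in $L^q(\mathbb{T}^d;\mathbb{R}^d)$. Moreover, $$m-\operatorname{div}(J)-(a_{ij}(x)m)_{x_ix_j}=1\quad\text{in }\mathcal{D}'(\mathbb{T}^d).$$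
   Context: Setting. $\mathbb{T}^d=\mathbb{R}^d/\mathbb{Z}^d$, $d\ge1$; $\mathbb{E}$ is a fixed set, either $(0,\infty)$ or $[0,\infty)$. $\mathcal{M}_{ac}(\mathbb{T}^d)$ is the space of positive measures on $\mathbb{T}^d$ absolutely continuous with respect to Lebesgue measure; such a measure is identified with its density $m\in L^1(\mathbb{T}^d)$, $m\ge0$ a.e. Given are $H:\mathbb{T}^d\times\mathbb{R}^d\times\mathbb{R}^{d\times d}\times\mathbb{E}\times\mathbb{R}\to\mathbb{R}$, $(x,p,M,m,\theta)\mapsto H(x,p,M,m,\theta)$, a (possibly nonlinear) operator $h:\mathcal{M}_{ac}(\mathbb{T}^d)\to C(\mathbb{T}^d)$ ($h(m)$ is its value at the measure with density $m$), and a continuous function $g:\mathbb{T}^d\times\mathbb{E}\times\mathbb{R}\to\mathbb{R}$. $H(x,Du,D^2u,m,h(m))$ denotes $x\mapsto H(x,Du(x),D^2u(x),m(x),h(m)(x))$, and similarly for derivatives of $H$, for $H_0$ and for $g,g_1,g_2$. Repeated indices $i,j\in\{1,\dots,d\}$ are summed; $M_1:M_2=\operatorname{tr}(M_1M_2)$ for symmetric matrices. Conditions over $m\in\mathcal{M}_{ac}(\mathbb{T}^d)$ involving $g$ or $H$ are understood for densities with values in $\mathbb{E}$ a.e. Mean-field game system: $-u-H(x,Du,D^2u,m,h(m))=0$ and $m-\operatorname{div}(mD_pH(x,Du,D^2u,m,h(m)))+(mD_{M_{ij}}H(x,Du,D^2u,m,h(m)))_{x_ix_j}=1$ on $\mathbb{T}^d$.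 Operator $A$ and weak solutions. For $(\eta,v)\in C^\infty(\mathbb{T}^d;\mathbb{E})\times C^\infty(\mathbb{T}^d)$, $A(\eta,v)$ is the pair with components $-v-H(x,Dv,D^2v,\eta,h(\eta))$ and $\eta-\operatorname{div}(\eta D_pH(x,Dv,D^2v,\eta,h(\eta)))+(\eta D_{M_{ij}}H(x,Dv,D^2v,\eta,h(\eta)))_{x_ix_j}-1$. A pair $(m,u)\in\mathcal{D}'(\mathbb{T}^d)\times\mathcal{D}'(\mathbb{T}^d)$ with $m\ge0$ is a weak solution of the mean-field game system if $\langle(\eta,v)-(m,u),A(\eta,v)\rangle\ge0$ for all $(\eta,v)\in C^\infty(\mathbb{T}^d;\mathbb{E})\times C^\infty(\mathbb{T}^d)$ (distributional duality). Regularized system. Fix $N\in\mathbb{N}$ with $2N-4>\frac d2+1$ and $q_0>d$; for each $\epsilon_1\in(0,1)$, $\beta_{\epsilon_1}:(0,\infty)\to(-\infty,0]$ is a fixed non-decreasing $C^\infty$ function with $\beta_{\epsilon_1}(s)=0$ for $s\ge\epsilon_1$ and $\beta_{\epsilon_1}(s)=-s^{-q_0}$ for $0<s\le\epsilon_1/2$. For $\epsilon=(\epsilon_1,\epsilon_2)\in(0,1)^2$, $D(A^\epsilon)=\{(m,u)\in W^{4N,2}(\mathbb{T}^d)\times W^{4N,2}(\mathbb{T}^d):\inf_{\mathbb{T}^d}m>0\}$ and the regularized system is $$\begin{cases}-u-H+\epsilon_1(m+\Delta^{2N}m)+\epsilon_2(m-\Delta m)+\beta_{\epsilon_1}(m)=0,\\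 m-\operatorname{div}(mD_pH)+(mD_{M_{ij}}H)_{x_ix_j}-1+\epsilon_1(u+\Delta^{2N}u)+\epsilon_2(u-\Delta u)=0,\end{cases}$$ with $H$ and derivatives evaluated at $(x,Du,D^2u,m,h(m))$. (h-regularity) For all $\kappa>\frac d2+1$: $h(m)\in W^{\kappa,2}(\mathbb{T}^d)$ for every $m\in W^{\kappa,2}(\mathbb{T}^d)$ ($m\geq 0$), and $m\mapsto h(m)$ is a Fréchet differentiable map from (nonnegative elements of) $W^{\kappa,2}(\mathbb{T}^d)$ to $W^{\kappa,2}(\mathbb{T}^d)$. (g-structure) (1) There are functions $g_1,g_2$ with $g=g_1+g_2$ on $\mathbb{T}^d\times\mathbb{E}\times\mathbb{R}$ and $g_2(x,m(x),h(m)(x))\ge0$ for all $m\in\mathcal{M}_{ac}(\mathbb{T}^d)$. (2) There is $c>0$ with $\int_{\mathbb{T}^d} g_2(x,m,h(m))\,dx\le c\,(1+\int_{\mathbb{T}^d} m\,dx)$ for all $m\in\mathcal{M}_{ac}(\mathbb{T}^d)$. (3) For all $\delta>0$ there is $C_\delta>0$ with $\max\{\int_{\mathbb{T}^d} g_1(x,m,h(m))\,dx,\int_{\mathbb{T}^d} m\,dx\}\le\delta\int_{\mathbb{T}^d} m g_1(x,m,h(m))\,dx+C_\delta$ for all $m\in\mathcal{M}_{ac}(\mathbb{T}^d)$. (4) There is $R\ge0$ with $\int_{\mathbb{T}^d} mg_1(x,m,h(m))\,dx\ge-R$ for all $m\in\mathcal{M}_{ac}(\mathbb{T}^d)$. (g-compactness)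 If $(m_j)\subset\mathcal{M}_{ac}(\mathbb{T}^d)$ and $\sup_j\int_{\mathbb{T}^d} m_jg_1(x,m_j,h(m_j))\,dx<+\infty$, then a subsequence of $(m_j)$ converges weakly in $L^1(\mathbb{T}^d)$. (H-growth) There are constants $\gamma>1$, $0\le\tau<1$, $C_1,C_2,C_3,C_4>0$ such that, with the given continuous function $g:\mathbb{T}^d\times\mathbb{E}\times\mathbb{R}\to\mathbb{R}$ (the same $g=g_1+g_2$ as in (g-structure)): (a) for all $(x,p,M,m,\theta)$, $-H+D_pH\cdot p+D_MH:M\ge\frac1{C_1}m^{-\tau}|p|^\gamma+C_2g(x,m,\theta)-C_1$, with $H$ and derivatives evaluated at $(x,p,M,m,\theta)$; (b) for all $(m,u)\in\mathcal{M}_{ac}(\mathbb{T}^d)\times W^{1,\gamma}(\mathbb{T}^d)$ with $D^2u$ a measurable function, $$-C_3\int_{\mathbb{T}^d} g(x,m,h(m))dx+\frac1{C_1}\int_{\mathbb{T}^d}|Du|^\gamma m^{-\tau}dx-C_1\le\int_{\mathbb{T}^d} H(x,Du,D^2u,m,h(m))dx\le-C_4\int_{\mathbb{T}^d} g(x,m,h(m))dx+C_1\Big(1+\int_{\mathbb{T}^d}|Du|^\gamma m^{-\tau}dx\Big).$$ (H-smoothness) $H$ is of class $C^\infty$ on $\mathbb{T}^d\times\mathbb{R}^d\times\mathbb{R}^{d\times d}\times\mathbb{E}\times\mathbb{R}$. (monotonicity) For all $(\eta,v),(\bar\eta,\bar v)\in C^\infty(\mathbb{T}^d;\mathbb{E})\times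 C^\infty(\mathbb{T}^d)$, $\big(A(\eta,v)-A(\bar\eta,\bar v),(\eta,v)-(\bar\eta,\bar v)\big)_{L^2(\mathbb{T}^d)\times L^2(\mathbb{T}^d)}\ge0$. (degenerate structure with drift growth) $H(x,p,M,m,\theta)=H_0(x,p,m,\theta)-\sum_{i,j=1}^da_{ij}(x)M_{ij}$, where $H_0$ is a real-valued $C^\infty$ function and $(a_{ij})_{1\le i,j\le d}$ is a $C^\infty$ matrix-valued function on $\mathbb{T}^d$ (so $D_pH=D_pH_0$ does not depend on $M$); (H-growth) holds with $\tau=0$; and there are constants $C_5>0$ and $\alpha>0$ such that, for all $(x,p,m,\theta)\in\mathbb{T}^d\times\mathbb{R}^d\times\mathbb{E}\times\mathbb{R}$, $|D_pH_0(x,p,m,\theta)|\le C_5(1+|p|^{\gamma-1})$ and $g_1(x,m,\theta)\ge\frac1{C_5}m^\alpha-C_5$. *)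

(* Defs.v *)
From HB Require Import structures.
From mathcomp Require Import all_boot all_order all_algebra.
From mathcomp Require Import all_classical all_reals all_analysis.

Set Implicit Arguments.
Unset Strict Implicit.
Unset Printing Implicit Defensive.

Import Order.TTheory GRing.Theory Num.Theory.
Import numFieldNormedType.Exports.

Local Open Scope classical_set_scope.
Local Open Scope ring_scope.

(* Conventions.
   - A function on the torus T^d = R^d / Z^d is a Z^d-periodic function on
     R^d = 'rV[R]_d. Integrals over T^d are integrals with respect to [cube d],
     Lebesgue measure on the unit cube [0, 1]^d.
   - Elements of L^p and Sobolev spaces are measurable periodic functions; they
     are only meaningful up to equality almost everywhere.
   - Functions of m in E are total in m; apart from periodicity in x they are
     constrained for m in E only.
   - Integrals of functions such as g(x, m, h(m)) take values in the extended
     reals. If both the positive and the negative part have infinite integral,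
     the value is -oo. *)

Definition row_display : measure_display.
Proof. by constructor. Qed.

Section measurable_row.
Context {R : realType} (n : nat).

Definition row_coord (i : 'I_n) (x : 'rV[R]_n) : measurableTypeR R := x 0 i.

Let row_set0 : g_sigma_preimage row_coord set0.
Proof. exact: sigma_algebra0. Qed.

Let row_setC A :
  g_sigma_preimage row_coord A -> g_sigma_preimage row_coord (~` A).
Proof. exact: sigma_algebraC. Qed.

Let row_bigcup (F : _^nat) : (forall i, g_sigma_preimage row_coord (F i)) ->
  g_sigma_preimage row_coord (\bigcup_i (F i)).
Proof. exact: sigma_algebra_bigcup. Qed.

HB.instance Definition _ := @isMeasurable.Build row_display
  'rV[R]_n (g_sigma_preimage row_coord) row_set0 row_setC row_bigcup.

Lemma measurable_row_coord (i : 'I_n) : measurable_fun setT (row_coord i).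
Proof.
move=> _ Y mY; rewrite setTI; apply: sub_sigma_algebra => /=.
rewrite -bigcup_seq/=; exists i => /=; first by rewrite mem_index_enum.
by exists Y => //; rewrite setTI.
Qed.

Lemma measurable_fun_row d (T : measurableType d) (f : T -> 'rV[R]_n) :
  (forall i, measurable_fun setT (row_coord i \o f)) -> measurable_fun setT f.
Proof.
move=> mf.
suff: g_sigma_preimage (fun i => row_coord i \o f) `<=` measurable.
  rewrite g_sigma_preimage_comp => prefS _ A mA; apply: prefS.
  by exists A.
apply: smallest_sub; first exact: sigma_algebra_measurable.
move: (@row_coord) mf => c mf.
rewrite -bigcup_seq; apply: bigcup_sub => i _.
by move=> A [B mB <-]; exact: mf.
Qed.

End measurable_row.

Section unit_cube.
Context {R : realType}.

Definition row_cons n (p : measurableTypeR R * 'rV[R]_n) : 'rV[R]_n.+1 :=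
  \row_i if unlift ord0 i is Some j then p.2 0 j else p.1.

Lemma measurable_row_cons n : measurable_fun setT (@row_cons n).
Proof.
apply: measurable_fun_row => i; case: (unliftP ord0 i) => [j ij|i0].
  rewrite (_ : _ \o _ = row_coord j \o snd).
    exact: (measurableT_comp (measurable_row_coord j) measurable_snd).
  by apply/funext => p; rewrite /row_coord /row_cons /= mxE ij liftK.
rewrite (_ : _ \o _ = fst); first exact: measurable_fst.
by apply/funext => p; rewrite /row_coord /row_cons /= mxE i0 unlift_none.
Qed.

HB.instance Definition _ n :=
  isMeasurableFun.Build _ _ _ _ (@row_cons n) (@measurable_row_cons n).

(* The n-fold product of Lebesgue measure on [0, 1], on row vectors. *)
Fixpoint cube n : probability 'rV[R]_n R :=
  if n is n'.+1 then
    distribution (uniform_prob (@ltr01 R) \x cube n')%E (@row_cons n')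
  else \d_(0 : 'rV[R]_0).

End unit_cube.

Section general_notions.
Context {R : realType}.

Fixpoint Ck_on (V : normedModType R) (k : nat) (U : set V) (f : V -> R) : Prop :=
  (forall x, U x -> {for x, continuous f}) /\
  if k is k'.+1 then
    forall v, (forall x, U x -> derivable f x v) /\ Ck_on k' U ('D_v f)
  else True.

(* S need not be open: smooth on S means locally the restriction of a smooth
   function. This is the meaning of C^oo up to the boundary when the values of
   m range over [0, +oo[. *)
Definition smooth_on (V : normedModType R) (S : set V) (f : V -> R) : Prop :=
  forall x, S x -> exists (U : set V) (F : V -> R),
    [/\ open U, U x, forall k, Ck_on k U F & forall y, U y -> S y -> F y = f y].

Section seminormed_space.
Variables (F : lmodType R) (W : set F) (N : F -> R).

Definition bounded_functional (l : F -> R) : Prop :=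
  (forall c f g, W f -> W g -> l (c *: f + g) = c * l f + l g) /\
  exists C, forall f, W f -> `|l f| <= C * N f.

Definition weak_cvg (f_ : nat -> F) (f : F) : Prop :=
  [/\ W f, forall n, W (f_ n) &
      forall l, bounded_functional l -> l (f_ n) @[n --> \oo] --> l f].

Definition bounded_operator (L : F -> F) : Prop :=
  (forall c f g, W f -> W g -> N (L (c *: f + g) - (c *: L f + L g)) = 0) /\
  exists C, forall f, W f -> W (L f) /\ N (L f) <= C * N f.

Definition frechet_differentiable_on (D : set F) (Phi : F -> F) : Prop :=
  forall f, D f -> exists2 L, bounded_operator L &
    forall e, 0 < e -> exists2 r, 0 < r &
      forall f', D f' -> N (f' - f) < r ->
        N (Phi f' - Phi f - L (f' - f)) <= e * N (f' - f).

End seminormed_space.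
End general_notions.

Section torus.
Context {R : realType} {d : nat}.
Local Notation X := 'rV[R]_d.
Local Notation mu := (@cube R d).
Implicit Types (i j : 'I_d) (s t : seq 'I_d) (f g phi u v m eta : X -> R).

Definition basis_vec i : X := delta_mx 0 i.

Definition Zd_periodic (Y : Type) (f : X -> Y) : Prop :=
  forall x i, f (x + basis_vec i) = f x.

(* The norm of the library on row vectors is the sup norm. *)
Definition enorm (p : X) : R := Num.sqrt (\sum_i p 0 i ^+ 2).

Definition pderiv i f : X -> R := 'D_(basis_vec i) f.
Definition pderivs s f : X -> R := foldr pderiv f s.
Definition grad f (x : X) : X := \row_i pderiv i f x.
Definition hess f (x : X) : 'M[R]_d := \matrix_(i, j) pderiv j (pderiv i f) x.

Definition Cinf f : Prop := Zd_periodic f /\ smooth_on setT f.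
Definition Cinf_in (E : set R) f : Prop := Cinf f /\ forall x, E (f x).

Definition Lp (p : R) : set (X -> R) :=
  [set f | Zd_periodic f /\ f \in Lfun mu p%:E].
Definition Lp_norm (p : R) f : R := fine ('N[mu]_p%:E [EFin \o f])%E.

Definition Lp_vec (p : R) : set (X -> X) :=
  [set J | forall i, Lp p (fun x => J x 0 i)].
Definition Lp_vec_norm (p : R) (J : X -> X) : R := Lp_norm p (enorm \o J).

(* Only the values at test functions, i.e. at elements of Cinf, matter. *)
Definition distr : Type := (X -> R) -> R.
Implicit Types T : distr.

Definition is_distr T : Prop :=
  (forall c phi psi, Cinf phi -> Cinf psi ->
    T (c *: phi + psi) = c * T phi + T psi) /\
  exists (C : R) (k : nat), forall phi (B : R), Cinf phi ->
    (forall s x, (size s <= k)%N -> `|pderivs s phi x| <= B) ->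
    `|T phi| <= C * B.

Definition dist f : (X -> R) -> R := fun phi => \int[mu]_x (f x * phi x).
Definition dD i T : (X -> R) -> R := fun phi => - T (pderiv i phi).
Definition dDs s T : (X -> R) -> R := foldr dD T s.
Definition eq_distr T1 T2 : Prop := forall phi, Cinf phi -> T1 phi = T2 phi.

Definition weak_deriv s f g : Prop :=
  [/\ Lp 1 f, Lp 1 g & eq_distr (dDs s (dist f)) (dist g)].
Definition wD s f : X -> R := xget (cst 0) [set g | weak_deriv s f g].
Definition wgrad u (x : X) : X := \row_i wD [:: i] u x.
Definition whess u (x : X) : 'M[R]_d := \matrix_(i, j) wD [:: j; i] u x.
Definition wlap u (x : X) : R := \sum_i wD [:: i; i] u x.

(* Integral over (x, y) in T^d x T^d of |f(y) - f(x)|^p / |y - x|^(d + sg p),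
   where |y - x| is the distance on the torus: y = x + z - c where c is the
   centre of the cube, so that the coordinates of z - c are in [-1/2, 1/2]. *)
Definition gagliardo (sg p : R) f : \bar R :=
  let c : X := const_mx 2^-1 in
  (\int[mu]_x \int[mu]_z
     (`|f (x + z - c) - f x| `^ p / enorm (z - c) `^ (d%:R + sg * p))%:E)%E.

(* W^{r,p}(T^d), for real r >= 0: weak derivatives in L^p up to the integer part
   of r, and, when r is not an integer, the Sobolev-Slobodeckij condition. *)
Definition sobolev (r p : R) : set (X -> R) :=
  let k := Num.truncn r in let sg := r - k%:R in
  [set u | (forall s, (size s <= k)%N -> exists2 g, weak_deriv s u g & Lp p g) /\
    (0 < sg -> forall s, size s = k -> (gagliardo sg p (wD s u) < +oo)%E)].

Definition sobolev_norm (r p : R) u : R :=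
  let k := Num.truncn r in let sg := r - k%:R in
  (\sum_(l < k.+1) \sum_(s : l.-tuple 'I_d) Lp_norm p (wD s u) `^ p
   + (if 0 < sg then \sum_(s : k.-tuple 'I_d) fine (gagliardo sg p (wD s u))
      else 0)) `^ p^-1.

Definition Mac m : Prop := Lp 1 m /\ {ae mu, forall x, 0 <= m x}.
Definition Mac_in (E : set R) m : Prop := Mac m /\ {ae mu, forall x, E (m x)}.

Definition hamiltonian : Type := X -> X -> 'M[R]_d -> R -> R -> R.
Definition coupling : Type := X -> R -> R -> R.
Implicit Types (H : hamiltonian) (h : (X -> R) -> (X -> R)).

(* h acts on measures, hence respects equality a.e. of the densities. *)
Definition operator_into_C h : Prop :=
  (forall m, Mac m -> Zd_periodic (h m) /\ continuous (h m)) /\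
  (forall m m', Mac m -> Mac m' -> {ae mu, forall x, m x = m' x} -> h m = h m').

Definition coupling_at (G : coupling) h m (x : X) : R := G x (m x) (h m x).

Definition hamiltonian_at H h m (p : X -> X) (M : X -> 'M[R]_d) (x : X) : R :=
  H x (p x) (M x) (m x) (h m x).

Definition DpH H i : X -> X -> 'M[R]_d -> R -> R -> R := fun x p M r th =>
  'D_(basis_vec i) (fun p' : X => H x p' M r th) p.
Definition DMH H i j : X -> X -> 'M[R]_d -> R -> R -> R := fun x p M r th =>
  'D_(delta_mx i j) (fun M' : 'M[R]_d => H x p M' r th) M.

Definition A1 H h eta v (x : X) : R :=
  - v x - hamiltonian_at H h eta (grad v) (hess v) x.

Definition A2 H h eta v (x : X) : R :=
  eta x
  - \sum_i pderiv i (fun y =>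
      eta y * hamiltonian_at (DpH H i) h eta (grad v) (hess v) y) x
  + \sum_i \sum_j pderiv j (pderiv i (fun y =>
      eta y * hamiltonian_at (DMH H i j) h eta (grad v) (hess v) y)) x
  - 1.

Definition weak_solution (E : set R) H h (m u : distr) : Prop :=
  [/\ is_distr m, is_distr u,
      forall phi, Cinf phi -> (forall x, 0 <= phi x) -> 0 <= m phi &
      forall eta v, Cinf_in E eta -> Cinf v ->
        0 <= (dist eta - m) (A1 H h eta v) + (dist v - u) (A2 H h eta v)].

Definition penalty_family (q0 : R) (beta : R -> R -> R) : Prop :=
  forall e1 : R, 0 < e1 < 1 ->
  [/\ @smooth_on R R `]0, +oo[ (beta e1),
      forall y z : R, 0 < y -> y <= z -> beta e1 y <= beta e1 z,
      forall y : R, 0 < y -> beta e1 y <= 0,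
      forall y : R, e1 <= y -> beta e1 y = 0 &
      forall y : R, 0 < y <= e1 / 2 -> beta e1 y = - y `^ (- q0)].

(* inf m > 0 is pointwise, so that m has its values in E everywhere; functions
   of m may be arbitrary off E. *)
Definition reg_domain (N : nat) m u : Prop :=
  [/\ sobolev (4 * N)%:R 2 m, sobolev (4 * N)%:R 2 u &
      exists2 c, 0 < c & forall x, c <= m x].

(* The equations hold between functions for the first one, hence a.e., and in
   the sense of distributions for the second one, which is in divergence form. *)
Definition reg_solution (N : nat) (beta : R -> R -> R) H h (e1 e2 : R) m u
    : Prop :=
  let at_mu G := hamiltonian_at G h m (wgrad u) (whess u) in
  {ae mu, forall x,
    - u x - at_mu H x + e1 * (m x + iter (2 * N) wlap m x)
    + e2 * (m x - wlap m x) + beta e1 (m x) = 0} /\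
  eq_distr
    (dist m
     - \sum_i dD i (dist (fun x => m x * at_mu (DpH H i) x))
     + \sum_i \sum_j dD j (dD i (dist (fun x => m x * at_mu (DMH H i j) x)))
     - dist (cst 1)
     + e1 *: (dist u + dist (iter (2 * N) wlap u))
     + e2 *: (dist u - dist (wlap u)))
    0.

Definition h_regularity h : Prop :=
  forall kappa : R, d%:R / 2 + 1 < kappa ->
  let Wpos :=
    [set m | sobolev kappa 2 m /\ {ae mu, forall x, 0 <= m x}] in
  (forall m, Wpos m -> sobolev kappa 2 (h m)) /\
  frechet_differentiable_on (sobolev kappa 2) (sobolev_norm kappa 2) Wpos h.

Definition continuous_coupling (E : set R) (g : coupling) : Prop :=
  Zd_periodic g /\
  {within [set z : X * R * R | E z.1.2],
    continuous (fun z : X * R * R => g z.1.1 z.1.2 z.2)}.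

(* The measurability of g1 along densities is what gives a meaning to the
   integrals of g1. *)
Definition g_structure (E : set R) h (g g1 g2 : coupling) : Prop :=
  [/\ [/\ Zd_periodic g1, Zd_periodic g2,
          forall m, Mac m -> (forall x, E (m x)) ->
            measurable_fun setT (coupling_at g1 h m),
          forall x r th, E r -> g x r th = g1 x r th + g2 x r th &
          forall m, Mac_in E m -> {ae mu, forall x, 0 <= coupling_at g2 h m x}],
      exists2 c : R, 0 < c & forall m, Mac_in E m ->
        (\int[mu]_x (coupling_at g2 h m x)%:E
           <= c%:E * (1 + \int[mu]_x (m x)%:E))%E,
      forall delta : R, 0 < delta -> exists2 C : R, 0 < C &
        forall m, Mac_in E m ->
        (maxe (\int[mu]_x (coupling_at g1 h m x)%:E) (\int[mu]_x (m x)%:E)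
           <= delta%:E * \int[mu]_x (m x * coupling_at g1 h m x)%:E + C%:E)%E &
      exists2 C : R, 0 <= C & forall m, Mac_in E m ->
        ((- C)%:E <= \int[mu]_x (m x * coupling_at g1 h m x)%:E)%E].

Definition g_compactness (E : set R) h (g1 : coupling) : Prop :=
  forall m_ : nat -> X -> R, (forall n, Mac_in E (m_ n)) ->
  (ereal_sup (range (fun n =>
     \int[mu]_x (m_ n x * coupling_at g1 h (m_ n) x)%:E)) < +oo)%E ->
  exists (k : nat -> nat) m, {homo k : a b / (a < b)%N} /\
    weak_cvg (Lp 1) (Lp_norm 1) (m_ \o k) m.

(* Only used with tau = 0, where r `^ (- tau) = 1 also for r = 0, and where all
   the integrals of |Du|^gamma are finite. *)
Definition H_growth (E : set R) H h (g : coupling) (gamma tau : R) : Prop :=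
  [/\ 1 < gamma, 0 <= tau < 1 &
  exists C1 C2 C3 C4 : R, [/\ 0 < C1, 0 < C2, 0 < C3 & 0 < C4] /\
    (forall x p M r th, E r ->
      C1^-1 * (r `^ (- tau) * enorm p `^ gamma) + C2 * g x r th - C1
      <= - H x p M r th + \sum_i DpH H i x p M r th * p 0 i
         + \sum_i \sum_j DMH H i j x p M r th * M i j) /\
    (forall m u, Mac_in E m -> sobolev 1 gamma u ->
      (forall i j, exists f, weak_deriv [:: j; i] u f) ->
      let Ig := (\int[mu]_x (coupling_at g h m x)%:E)%E in
      let Iu := (\int[mu]_x (enorm (wgrad u x) `^ gamma * m x `^ (- tau))%:E)%E in
      let IH := (\int[mu]_x (hamiltonian_at H h m (wgrad u) (whess u) x)%:E)%E in
      (- (C3%:E * Ig) + (C1^-1)%:E * Iu - C1%:E <= IH)%E /\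
      (IH <= - (C4%:E * Ig) + C1%:E * (1 + Iu))%E)].

Definition H_smooth (E : set R) H : Prop :=
  Zd_periodic H /\
  smooth_on [set z : X * X * 'M[R]_d * R * R | E z.1.2]
    (fun z => H z.1.1.1.1 z.1.1.1.2 z.1.1.2 z.1.2 z.2).

Definition monotone_operator (E : set R) H h : Prop :=
  forall eta v eta' v', Cinf_in E eta -> Cinf v -> Cinf_in E eta' -> Cinf v' ->
  0 <= \int[mu]_x ((A1 H h eta v x - A1 H h eta' v' x) * (eta x - eta' x)
                 + (A2 H h eta v x - A2 H h eta' v' x) * (v x - v' x)).

Definition degenerate_structure (E : set R) H h (g g1 : coupling)
    (H0 : X -> X -> R -> R -> R) (a : X -> 'M[R]_d) (gamma alpha : R) : Prop :=
  [/\ Zd_periodic H0 /\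
      smooth_on [set z : X * X * R * R | E z.1.2]
        (fun z => H0 z.1.1.1 z.1.1.2 z.1.2 z.2),
      forall i j, Cinf (fun x => a x i j),
      forall x p M r th, E r ->
        H x p M r th = H0 x p r th - \sum_i \sum_j a x i j * M i j,
      H_growth E H h g gamma 0 &
      0 < alpha /\ exists2 C5 : R, 0 < C5 & forall x p r th, E r ->
        enorm (\row_i 'D_(basis_vec i) (fun p' : X => H0 x p' r th) p)
          <= C5 * (1 + enorm p `^ (gamma - 1)) /\
        C5^-1 * r `^ alpha - C5 <= g1 x r th].

End torus.

Arguments hamiltonian : clear implicits.
Arguments coupling : clear implicits.

(* Main.v *)
(* Multiplying the first regularized equation by [m - 1] and testing the second one
   with [u], the terms in [e1], [e2] and the penalty have a sign, up to [2 int m]: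
     int m (- H + DpH . Du + DMH : D^2 u) + int H <= 2 int m.
   By (H-growth) and (g-structure) this bounds [int m |Du| ^ gamma] and, through
   [g1 >= m ^ alpha / C - C], [int m ^ (alpha + 1)], uniformly in the parameters. Since
   [|J| <= C m (1 + |Du| ^ (gamma - 1))] and
   [1 / q = 1 / (gamma (alpha + 1)) + (gamma - 1) / gamma], the fluxes are bounded in
   L^q, hence weakly compact, and the second equation passes to the limit because it is
   linear in [m], [J] and [e u].

   The analysis on the torus rests on the kernels [\prod_i c_n cos (pi (x_i - z_i)) ^ (2 n)].
   Averaging against them is a finite-rank operator onto smooth functions, which gives
   density, uniqueness of weak derivatives and the countable family of test functions of
   the diagonal argument. The one-dimensional kernel is [1] plus the derivative of an
   explicit periodic function bounded by [1]; integrating by parts in each coordinate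
   turns [d] integrable derivatives into a sup bound, so that the regularized solutions
   and their derivatives up to order two are bounded. Bounded functionals on L^p are
   represented by means of the Radon-Nikodym theorem. *)

(* The hypotheses on [g] and [H] compare extended real integrals, so they say something only once
   every term is known to be finite. For fixed parameters this is a separate, non-uniform argument:
   the first equation puts [H] in L^2 because all its other terms are there, and [g] is squeezed
   between a constant, by the growth of [g1], and the Legendre term of (H-growth). Uniformity enters
   only afterwards, when a small multiple of [int m g1] is absorbed. Since [u] is not smooth, the
   second equation is tested with averages of [u], and the limit is taken in L^2 pairings.
   Trigonometric kernels are chosen because periodicity gives them mass one in each variable on a
   fixed cube: Fubini on the product of two cubes then replaces translations, and the addition
   formulas spare any differentiation under an integral. Convergence of the averages is proved
   without topology: the sets whose indicators have vanishing mean oscillation form a sigma-algebra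
   containing the half-spaces. *)
Require Import Defs.
From HB Require Import structures.
From mathcomp Require Import all_boot all_order all_algebra.
From mathcomp Require Import all_classical all_reals all_analysis.
From mathcomp Require Import measurable_realfun zify ring lra.
Set Implicit Arguments.
Unset Strict Implicit.
Unset Printing Implicit Defensive.
Import Order.TTheory GRing.Theory Num.Theory.
Import numFieldNormedType.Exports.
Local Open Scope classical_set_scope.
Local Open Scope ring_scope.

(** * Integrals and L^p functions *)

Section real_integrals.
Context {dd : measure_display} {T : measurableType dd} {R : realType}.
Variable mu : {measure set T -> \bar R}.
Implicit Types (f g : T -> R) (p q c C e : R).
Local Notation intb f := (mu.-integrable setT (EFin \o f)).

Lemma intb_meas f : intb f -> measurable_fun setT f.
Proof. by move=> /integrableP[/measurable_EFinP]. Qed.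

Lemma intb_ext f g : f =1 g -> intb f -> intb g.
Proof. by move=> fg; apply: eq_integrable => // x _ /=; rewrite fg. Qed.

Lemma intbD f g : intb f -> intb g -> intb (fun x => f x + g x).
Proof. by move=> hf hg; apply: eq_integrable (integrableD measurableT hf hg). Qed.

Lemma intbZ c f : intb f -> intb (fun x => c * f x).
Proof. by move=> hf; apply: eq_integrable (integrableZl measurableT c hf). Qed.

Lemma intbN f : intb f -> intb (fun x => - f x).
Proof. by move=> /(intbZ (-1)); apply: intb_ext => x; rewrite mulN1r. Qed.

Lemma intbB f g : intb f -> intb g -> intb (fun x => f x - g x).
Proof. by move=> hf hg; exact: intbD hf (intbN hg). Qed.

Lemma intb_sum I (s : seq I) (F : I -> T -> R) :
  (forall i, intb (F i)) -> intb (fun x => \sum_(i <- s) F i x).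
Proof.
move=> hF; elim: s => [|i s IH].
  apply: (@intb_ext (cst 0)) => [x|]; first by rewrite big_nil.
  exact: integrable0.
by apply: (intb_ext _ (intbD (hF i) IH)) => x; rewrite big_cons.
Qed.

Lemma intb_norm f : intb f -> intb (fun x => `|f x|).
Proof. exact: integrable_norm. Qed.

Lemma intb_ae_le f g : measurable_fun setT f ->
  {ae mu, forall x, `|f x| <= g x} -> intb g -> intb f.
Proof.
move=> mf fg ig; apply/integrableP; split; first exact/measurable_EFinP.
have /integrableP[mg] := ig; apply: le_lt_trans.
apply: ae_ge0_le_integral => //.
- by apply: measurableT_comp => //; exact/measurable_EFinP.
- exact: measurableT_comp.
- apply: filterS fg => x fgx _ /=.
  by rewrite lee_fin (le_trans fgx)// ler_norm.
Qed.

Lemma intb_le f g : measurable_fun setT f ->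
  (forall x, `|f x| <= g x) -> intb g -> intb f.
Proof. by move=> mf fg; apply: intb_ae_le => //; exact: aeW. Qed.

Lemma intb_bddM f g C : intb f -> measurable_fun setT g ->
  {ae mu, forall x, `|g x| <= C} -> intb (fun x => f x * g x).
Proof.
move=> hf mg gC; apply: (@intb_ae_le _ (fun x => C * `|f x|)).
- by apply: measurable_funM => //; exact: intb_meas.
- by apply: filterS gC => x gC; rewrite normrM mulrC ler_wpM2r.
- exact/intbZ/intb_norm.
Qed.

Lemma Rint_ae f g : measurable_fun setT f -> measurable_fun setT g ->
  {ae mu, forall x, f x = g x} -> \int[mu]_x f x = \int[mu]_x g x.
Proof.
move=> mf mg fg; congr fine; apply: ae_eq_integral => //.
- exact/measurable_EFinP.
- exact/measurable_EFinP.
- by apply: filterS fg => x -> _.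
Qed.

Lemma Rint_aele f g : intb f -> intb g -> {ae mu, forall x, f x <= g x} ->
  \int[mu]_x f x <= \int[mu]_x g x.
Proof.
move=> hf hg fg.
have mf := intb_meas hf; have mg := intb_meas hg.
(* The inequality holds only almost everywhere; replacing [g] by the maximum, which agrees with it
   a.e., makes it pointwise. *)
have mm : measurable_fun setT (fun x => Num.max (f x) (g x)).
  exact: measurable_maxr.
have -> : \int[mu]_x g x = \int[mu]_x (Num.max (f x) (g x)).
  by apply: Rint_ae => //; apply: filterS fg => x fg; rewrite max_r.
apply: le_Rintegral => //; last by move=> x _; rewrite le_max lexx.
apply: (intb_le mm _ (intbD (intb_norm hf) (intb_norm hg))) => x.
by case: (leP (f x) (g x)) => _; rewrite ?lerDl ?lerDr.
Qed.

Lemma Rint_le f g : intb f -> intb g -> (forall x, f x <= g x) ->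
  \int[mu]_x f x <= \int[mu]_x g x.
Proof. by move=> hf hg fg; apply: Rint_aele => //; exact: aeW. Qed.

Lemma RintD f g : intb f -> intb g ->
  \int[mu]_x (f x + g x) = \int[mu]_x f x + \int[mu]_x g x.
Proof. exact: RintegralD. Qed.

Lemma RintZ c f : intb f -> \int[mu]_x (c * f x) = c * \int[mu]_x f x.
Proof. exact: RintegralZl. Qed.

Lemma RintN f : intb f -> \int[mu]_x (- f x) = - \int[mu]_x f x.
Proof.
move=> hf; rewrite -mulN1r -RintZ//.
by apply: eq_Rintegral => x _; rewrite mulN1r.
Qed.

Lemma RintB f g : intb f -> intb g ->
  \int[mu]_x (f x - g x) = \int[mu]_x f x - \int[mu]_x g x.
Proof. by move=> hf hg; rewrite RintD ?RintN//; exact: intbN. Qed.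

Lemma Rint_zero : \int[mu]_x (0 : R) = 0.
Proof. by rewrite /Rintegral integral0. Qed.

Lemma Rint_sum I (s : seq I) (F : I -> T -> R) : (forall i, intb (F i)) ->
  \int[mu]_x (\sum_(i <- s) F i x) = \sum_(i <- s) \int[mu]_x F i x.
Proof.
move=> hF; elim: s => [|i s IH].
  by rewrite big_nil -[RHS]Rint_zero; apply: eq_Rintegral => x _; rewrite big_nil.
rewrite big_cons -IH -RintD//; last exact: intb_sum.
by apply: eq_Rintegral => x _; rewrite big_cons.
Qed.

Lemma Rint_norm f : intb f -> `|\int[mu]_x f x| <= \int[mu]_x `|f x|.
Proof. exact: le_normr_Rintegral. Qed.

Lemma Rint_EFin f : intb f -> (\int[mu]_x (f x)%:E)%E = (\int[mu]_x f x)%:E.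
Proof. by move=> hf; rewrite fineK//; exact: integrable_fin_num. Qed.

Lemma Rint_ge0 f : (forall x, 0 <= f x) -> 0 <= \int[mu]_x f x.
Proof. by move=> f0; exact: Rintegral_ge0. Qed.

Lemma Rint_aege0 f : intb f -> {ae mu, forall x, 0 <= f x} ->
  0 <= \int[mu]_x f x.
Proof.
move=> hf f0; by rewrite -[leLHS]Rint_zero; apply: Rint_aele => //; exact: integrable0.
Qed.

Lemma integral_abs_ge0 f : (forall x, 0 <= f x) ->
  (\int[mu]_x `|(EFin \o f) x| = \int[mu]_x (f x)%:E)%E.
Proof.
by move=> f0; apply: eq_integral => x _; rewrite gee0_abs ?lee_fin.
Qed.

Lemma Rint_eq0_ae f : intb f -> (forall x, 0 <= f x) -> \int[mu]_x f x = 0 ->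
  {ae mu, forall x, f x = 0}.
Proof.
move=> hf f0 If.
have : (\int[mu]_x `|(f x)%:E| = 0)%E.
  by rewrite integral_abs_ge0// Rint_EFin// If.
move=> /(ae_eq_integral_abs _ measurableT (measurable_int _ hf)).
move=> H; apply: filterS H => x H; have := H Logic.I; by case.
Qed.

Lemma measurable_powR_abs f p : measurable_fun setT f ->
  measurable_fun setT (fun x => `|f x| `^ p).
Proof.
move=> mf; apply: (measurableT_comp (measurable_powR p)).
exact: measurableT_comp.
Qed.

(** Both terms are at most the larger one; the crude constant [2 ^ p] then serves every exponent
    [p >= 0], without convexity. *)
Lemma powR_normD_le (p a b : R) : 0 <= p ->
  `|a + b| `^ p <= 2 `^ p * (`|a| `^ p + `|b| `^ p).
Proof.
move=> p0; apply: (@le_trans _ _ ((2 * Num.max `|a| `|b|) `^ p)).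
  apply: ge0_ler_powR; rewrite ?nnegrE ?mulr_ge0 ?le_max ?normr_ge0//.
  apply: (le_trans (ler_normD _ _)); rewrite mulr2n mulrDl mul1r.
  by apply: lerD; rewrite le_max lexx ?orbT.
rewrite powRM ?le_max ?normr_ge0// ler_wpM2l ?powR_ge0//.
by case: (leP `|a| `|b|) => _; rewrite ?lerDl ?lerDr powR_ge0.
Qed.

(** Real-valued form of membership in L^p, for functions that need not be periodic; [LpowP]
    identifies it with [Lfun]. *)
Definition Lpow (p : R) f :=
  measurable_fun setT f /\ intb (fun x => `|f x| `^ p).

Lemma LpowP p f : 0 < p -> f \in Lfun mu p%:E <-> Lpow p f.
Proof.
move=> p0; have pn0 : p != 0 by rewrite gt_eqF.
have Nf : ('N[mu]_p%:E[EFin \o f] `^ p = \int[mu]_x (`|f x| `^ p)%:E)%E.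
  by rewrite powR_Lnorm//; apply: eq_integral => x _.
have mp : measurable_fun setT f ->
    measurable_fun setT (EFin \o (fun x => `|f x| `^ p)).
  by move=> mf; apply/measurable_EFinP; exact: measurable_powR_abs.
split.
- rewrite inE => /andP[/[!inE]/= mf lf]; split => //.
  apply/integrableP; split; first exact: mp.
  rewrite integral_abs_ge0; last by move=> x; exact: powR_ge0.
  by rewrite -Nf; exact: poweR_lty.
- move=> [mf /integrableP[_]].
  rewrite integral_abs_ge0; last by move=> x; exact: powR_ge0.
  rewrite -Nf => lf; rewrite inE; apply/andP; split; rewrite inE//=.
  exact: (lty_poweRy pn0 lf).
Qed.

Lemma Lp_norm_pow p f : 0 < p -> Lpow p f ->
  fine ('N[mu]_p%:E[EFin \o f])%E = (\int[mu]_x (`|f x| `^ p)) `^ p^-1.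
Proof.
move=> p0 [mf lf]; rewrite unlock /Lnorm/= fine_poweR//.
Qed.

Lemma LpowZ p c f : Lpow p f -> Lpow p (fun x => c * f x).
Proof.
move=> [mf lf]; split; first exact: measurable_funM.
apply: (intb_ext _ (intbZ (`|c| `^ p) lf)) => x.
by rewrite normrM powRM.
Qed.

Lemma LpowD p f g : 0 <= p -> Lpow p f -> Lpow p g ->
  Lpow p (fun x => f x + g x).
Proof.
move=> p0 [mf lf] [mg lg].
have mfg : measurable_fun setT (fun x => f x + g x) by exact: measurable_funD.
split => //; apply: (intb_le _ _ (intbZ (2 `^ p) (intbD lf lg))).
- exact: measurable_powR_abs.
- by move=> x; rewrite ger0_norm ?powR_ge0//; exact: powR_normD_le.
Qed.

Lemma LpowN p f : Lpow p f -> Lpow p (fun x => - f x).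
Proof.
move=> /(LpowZ (-1)) [m1 m2]; split.
  by apply: eq_measurable_fun m1 => x _; rewrite mulN1r.
by apply: intb_ext m2 => x; rewrite mulN1r.
Qed.

Lemma LpowB p f g : 0 <= p -> Lpow p f -> Lpow p g ->
  Lpow p (fun x => f x - g x).
Proof. by move=> p0 hf /LpowN; exact: LpowD. Qed.

Lemma Lpow_ae p f g : measurable_fun setT g -> {ae mu, forall x, f x = g x} ->
  Lpow p f -> Lpow p g.
Proof.
move=> mg fg [mf lf]; split => //.
apply: (intb_ae_le _ _ lf); first exact: measurable_powR_abs.
by apply: filterS fg => x ->; rewrite ger0_norm// powR_ge0.
Qed.

(** Young's inequality for [lam * f] and [lam^-1 * g]; the factors [p^-1] and [q^-1] are at most 1
    and are dropped. The same pointwise bound gives integrability of the product. *)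
Lemma Lpow_young p q f g lam : 0 < p -> 0 < q -> p^-1 + q^-1 = 1 -> 0 < lam ->
  Lpow p f -> Lpow q g ->
  intb (fun x => f x * g x) /\
  \int[mu]_x `|f x * g x| <=
    lam `^ p * \int[mu]_x (`|f x| `^ p)
    + lam^-1 `^ q * \int[mu]_x (`|g x| `^ q).
Proof.
move=> p0 q0 pq lam0 [mf lf] [mg lg].
have pt x : `|f x * g x| <=
    lam `^ p * `|f x| `^ p + lam^-1 `^ q * `|g x| `^ q.
  have -> : f x * g x = (lam * f x) * (lam^-1 * g x).
    by rewrite mulrACA divff ?gt_eqF// mul1r.
  rewrite normrM.
  apply: (le_trans (conjugate_powR (normr_ge0 _) (normr_ge0 _) p0 q0 pq)).
  have p1 : p^-1 <= 1 by rewrite -pq lerDl invr_ge0 ltW.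
  have q1 : q^-1 <= 1 by rewrite -pq lerDr invr_ge0 ltW.
  have l0 := ltW lam0.
  apply: lerD; rewrite normrM powRM// ger0_norm ?invr_ge0//.
    by rewrite ler_piMr ?mulr_ge0 ?powR_ge0.
  by rewrite ler_piMr ?mulr_ge0 ?powR_ge0.
have ir := intbD (intbZ (lam `^ p) lf) (intbZ (lam^-1 `^ q) lg).
have ifg : intb (fun x => f x * g x).
  by apply: (intb_le _ pt ir); exact: measurable_funM.
split => //; rewrite -!RintZ// -RintD//; try exact: intbZ.
by apply: Rint_le => //; exact: intb_norm.
Qed.

Lemma Lpow_intbM p q f g : 0 < p -> 0 < q -> p^-1 + q^-1 = 1 ->
  Lpow p f -> Lpow q g -> intb (fun x => f x * g x).
Proof. by move=> p0 q0 pq lf lg; have [] := Lpow_young p0 q0 pq ltr01 lf lg. Qed.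

Lemma Lpow1 f : intb f <-> Lpow 1 f.
Proof.
split=> [hf|[mf]].
  split; first exact: intb_meas.
  by apply: intb_ext (intb_norm hf) => x; rewrite powRr1.
apply: intb_le => // x; by rewrite powRr1.
Qed.

Lemma Lpow2M f g : Lpow 2 f -> Lpow 2 g -> intb (fun x => f x * g x).
Proof. by apply: Lpow_intbM => //; rewrite [RHS]splitr !div1r. Qed.

End real_integrals.

Lemma cvg_powR0 (R : realType) (a_ : nat -> R) (r : R) : 0 < r ->
  (forall n, 0 <= a_ n) -> a_ n @[n --> \oo] --> 0 ->
  a_ n `^ r @[n --> \oo] --> 0.
Proof.
move=> r0 a0 H; apply/cvgrPdist_le => eps eps0.
have : 0 < eps `^ r^-1 by rewrite powR_gt0.
move=> /(@cvgr_distC_le _ _ _ _ _ _ _ H); apply: filterS => n /=.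
rewrite subr0 ger0_norm// => Hn.
rewrite sub0r normrN ger0_norm ?powR_ge0//.
rewrite (_ : eps = (eps `^ r^-1) `^ r).
  by apply: ge0_ler_powR; rewrite ?nnegrE ?powR_ge0// ltW.
by rewrite -powRrM mulVf ?gt_eqF// powRr1// ltW.
Qed.

(** * Density of simple functions in L^p *)

Section lp_density.
Context {dd : measure_display} {T : measurableType dd} {R : realType}.
Variable mu : {measure set T -> \bar R}.
Implicit Types (f g : T -> R) (p q c C e : R).
Local Notation intb f := (mu.-integrable setT (EFin \o f)).

Lemma Rint_dct (f_ : nat -> T -> R) f g :
  (forall n, measurable_fun setT (f_ n)) -> measurable_fun setT f ->
  {ae mu, forall x, f_ n x @[n --> \oo] --> f x} -> intb g ->
  (forall n x, `|f_ n x| <= g x) ->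
  intb f /\ \int[mu]_x f_ n x @[n --> \oo] --> \int[mu]_x f x.
Proof.
move=> mf_ mf f_f ig fg.
have [|||||i1 _ i3] := @dominated_convergence _ _ _ mu setT measurableT
  (fun n => EFin \o f_ n) (EFin \o f) (EFin \o g) => //.
- by move=> n; exact/measurable_EFinP.
- exact/measurable_EFinP.
- by apply: filterS f_f => x f_f _; apply: cvg_EFin f_f; exact: nearW.
- by apply: aeW => x n _ /=; rewrite lee_fin.
split => //.
by apply: fine_cvg; rewrite -Rint_EFin.
Qed.

Import HBSimple HBNNSimple.

(** Nonnegative functions are L^p limits of the simple functions below them, by dominated
    convergence with majorant [|f| ^ p]; the signed case is a difference of two such functions.
    Serves for mean oscillations and for uniqueness of bounded functionals. *)
Lemma Lpow_ind (p : R) (Q : (T -> R) -> Prop) : 1 <= p ->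
  (forall A, measurable A -> Lpow mu p \1_A) ->
  (forall A, measurable A -> Q \1_A) ->
  (forall c f g, Lpow mu p f -> Lpow mu p g -> Q f -> Q g ->
    Q (fun x => c * f x + g x)) ->
  (forall f, Lpow mu p f ->
    (forall e, 0 < e -> exists g, [/\ Lpow mu p g, Q g &
       \int[mu]_x (`|f x - g x| `^ p) <= e]) -> Q f) ->
  forall f, Lpow mu p f -> Q f.
Proof.
move=> p1 L1 Q1 QZD Qlim.
have p0 : 0 <= p by rewrite (le_trans _ p1).
have Q0 : Q (cst 0) by rewrite -(@indic0 T R); exact: Q1.
have L0 : Lpow mu p (cst 0) by rewrite -(@indic0 T R); exact: L1.
have Lsum n (c : 'I_n -> R) (A : 'I_n -> set T) :
    (forall i, measurable (A i)) ->
    Lpow mu p (fun x => \sum_(i < n) c i * \1_(A i) x) /\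
    Q (fun x => \sum_(i < n) c i * \1_(A i) x).
  elim: n c A => [|n IH] c A mA.
    by rewrite (_ : (fun _ => _) = cst 0)//; apply/funext => x; rewrite big_ord0.
  have [L2 Q2] := IH (fun i => c (lift ord0 i)) _ (fun i => mA (lift ord0 i)).
  rewrite (_ : (fun _ => _) = (fun x => c ord0 * \1_(A ord0) x +
    \sum_(i < n) c (lift ord0 i) * \1_(A (lift ord0 i)) x)).
    by split; [apply: LpowD => //; apply: LpowZ; exact: L1|
               apply: QZD => //; [exact: L1|exact: Q1]].
  by apply/funext => x; rewrite big_ord_recl.
have Lnn (s : {nnsfun T >-> R}) : Lpow mu p s /\ Q s.
  by rewrite (funext (fimfunEord s)); exact: Lsum.
have Qnn f : Lpow mu p f -> (forall x, 0 <= f x) -> Q f.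
  move=> Lf f0; have [mf lf] := Lf; apply: Qlim => // e e0.
  have mF : measurable_fun setT (EFin \o f) by exact/measurable_EFinP.
  pose g_ := nnsfun_approx measurableT mF.
  have gf n x : g_ n x <= f x.
    have F0 y : setT y -> (0 <= (EFin \o f) y)%E by move=> _; rewrite lee_fin.
    have := le_approx n F0 (I : setT x).
    by rewrite -(nnsfun_approxE measurableT mF) lee_fin.
  have [|||||_ H] := @Rint_dct (fun n x => `|f x - g_ n x| `^ p)
      (fun x => `|f x - f x| `^ p) (fun x => `|f x| `^ p) => //.
  - by move=> n; apply: measurable_powR_abs; apply: measurable_funB.
  - by apply: measurable_powR_abs; apply: measurable_funB.
  - apply: aeW => x.
    have gx : g_ n x @[n --> \oo] --> f x.
      have F0 y : setT y -> (0 <= (EFin \o f) y)%E by move=> _; rewrite lee_fin.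
      have := @cvg_nnsfun_approx _ _ _ _ measurableT _ mF F0 x I.
      by move=> /fine_cvgP[].
    rewrite subrr normr0 powR0; last by rewrite gt_eqF// (lt_le_trans _ p1).
    have H : `|f x - g_ n x| @[n --> \oo] --> 0.
      rewrite -(normr0 R) -(subrr (f x)); apply: cvg_norm.
      by apply: cvgB gx; exact: cvg_cst.
    by apply: cvg_powR0 => //; rewrite (lt_le_trans _ p1).
  - move=> n x; rewrite ger0_norm ?powR_ge0//; apply: ge0_ler_powR => //.
    by rewrite ger0_norm ?subr_ge0// ger0_norm// lerBlDr lerDl.
  rewrite (_ : \int[mu]_x _ = 0) in H; last first.
    rewrite -[RHS](Rint_zero mu); apply: eq_Rintegral => x _.
    by rewrite subrr normr0 powR0// gt_eqF// (lt_le_trans _ p1).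
  have [n _ /(_ n (leqnn n)) /= Hn] := @cvgr_distC_le _ _ _ _ _ _ _ H _ e0.
  exists (g_ n); have [? ?] := Lnn (g_ n); split => //.
  move: Hn; rewrite subr0; apply: le_trans; exact: ler_norm.
move=> f [mf lf].
pose fp x := Num.max (f x) 0; pose fn x := Num.max (- f x) 0.
have fE x : f x = -1 * fn x + fp x.
  rewrite /fn /fp; case: (leP 0 (f x)) => h.
    by rewrite max_r ?oppr_le0// mulr0 add0r.
  by rewrite max_l ?oppr_ge0 ?ltW// mulN1r opprK addr0.
have Lp_ g : measurable_fun setT g -> (forall x, `|g x| <= `|f x|) -> Lpow mu p g.
  move=> mg gf; split => //; apply: (intb_le _ _ lf).
    exact: measurable_powR_abs.
  move=> x; rewrite ger0_norm ?powR_ge0//.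
  by apply: ge0_ler_powR => //; rewrite nnegrE.
have fpL : Lpow mu p fp.
  apply: Lp_ => [|x]; first exact: measurable_maxr.
  by rewrite /fp; case: (leP (f x) 0) => // _; rewrite normr0.
have fnL : Lpow mu p fn.
  apply: Lp_ => [|x].
    by apply: measurable_maxr => //; exact: measurableT_comp.
  by rewrite /fn; case: (leP (- f x) 0) => // _; rewrite ?normr0// normrN.
rewrite (funext fE); apply: QZD => //; apply: Qnn => // x.
  by rewrite /fn le_max lexx orbT.
by rewrite /fp le_max lexx orbT.
Qed.

End lp_density.

(** * Bounded functionals over a probability measure *)

Section riesz.
Context {dd : measure_display} {T : measurableType dd} {R : realType}.
Variable mu : probability T R.
Implicit Types (f g : T -> R) (p q c C e : R).
Local Notation intb f := (mu.-integrable setT (EFin \o f)).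

Lemma intb_bdd f C : measurable_fun setT f -> (forall x, `|f x| <= C) -> intb f.
Proof.
move=> mf fC; apply: (intb_le mf fC).
exact: finite_measure_integrable_cst.
Qed.

Lemma intb_aebdd f C : measurable_fun setT f ->
  {ae mu, forall x, `|f x| <= C} -> intb f.
Proof.
move=> mf fC; apply: (intb_ae_le mf fC).
exact: finite_measure_integrable_cst.
Qed.

Lemma Rint_cst c : \int[mu]_x (c : R) = c.
Proof. by rewrite Rintegral_cst//= probability_setT mulr1. Qed.

Lemma Lpow_aebdd p f C : 0 <= p -> measurable_fun setT f ->
  {ae mu, forall x, `|f x| <= C} -> Lpow mu p f.
Proof.
move=> p0 mf fC; split=> //; apply: (@intb_aebdd _ (C `^ p)).
  exact: measurable_powR_abs.
apply: filterS fC => x fC; rewrite ger0_norm ?powR_ge0//.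
by apply: ge0_ler_powR => //; rewrite nnegrE ?(le_trans _ fC).
Qed.

Lemma Lpow_bdd p f C : 0 <= p -> measurable_fun setT f ->
  (forall x, `|f x| <= C) -> Lpow mu p f.
Proof. by move=> p0 mf fC; apply: (Lpow_aebdd p0 mf); exact: aeW fC. Qed.

Lemma indic_le1 (A : set T) x : `|\1_A x| <= 1 :> R.
Proof. by rewrite indicE; case: (_ \in _); rewrite ?normr1 ?normr0. Qed.

Lemma Lpow_indic p A : 0 <= p -> measurable A -> Lpow mu p \1_A.
Proof. by move=> p0 mA; apply: (@Lpow_bdd _ _ 1) => //; exact: indic_le1. Qed.

Lemma Lpow_le p q f : 0 <= p -> p <= q -> Lpow mu q f -> Lpow mu p f.
Proof.
move=> p0 pq [mf lf]; split => //.
apply: (intb_le _ _ (intbD (finite_measure_integrable_cst mu 1 measurableT) lf)).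
  exact: measurable_powR_abs.
move=> x /=; rewrite ger0_norm ?powR_ge0//.
case: (leP `|f x| 1) => h.
  apply: (@le_trans _ _ 1); last by rewrite lerDl powR_ge0.
  have [->|pn0] := eqVneq p 0; first by rewrite powRr0.
  have := ge0_ler_powR p0 _ _ h; rewrite powR1; apply; by rewrite nnegrE.
by apply: (@le_trans _ _ (`|f x| `^ q)); [rewrite ler_powR// ltW|rewrite lerDr].
Qed.

(** Monotone convergence turns a bound on truncations into integrability of the limit; this is how a
    Radon-Nikodym density is shown to lie in L^q. *)
Lemma Rint_mono_bound (g_ : nat -> T -> R) g C :
  (forall n, intb (g_ n)) -> (forall n x, 0 <= g_ n x) ->
  (forall x, {homo (fun n => g_ n x) : a b / (a <= b)%N >-> a <= b}) ->
  (forall x, g_ n x @[n --> \oo] --> g x) ->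
  (forall n, \int[mu]_x g_ n x <= C) -> intb g /\ \int[mu]_x g x <= C.
Proof.
move=> ig g0 gm gg gC.
have H : (\int[mu]_x (g x)%:E <= C%:E)%E.
  have -> : (\int[mu]_x (g x)%:E =
     \int[mu]_x limn (fun n => (g_ n x)%:E))%E.
    apply: eq_integral => x _; apply/esym/cvg_lim => //.
    by apply: cvg_EFin; [exact: nearW|exact: gg].
  rewrite monotone_convergence//.
  - apply: lime_le; last by apply: nearW => n; rewrite Rint_EFin// lee_fin.
    apply: ereal_nondecreasing_is_cvgn => a b ab.
    rewrite !Rint_EFin// lee_fin; apply: Rint_le => // x; exact: gm.
  - by move=> n; exact: measurable_int (ig n).
  - by move=> n x _; rewrite lee_fin.
  - by move=> x _ a b ab; rewrite lee_fin gm.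
have mg : measurable_fun setT g.
  apply: (measurable_fun_cvg (fun n => intb_meas (ig n))) => x _; exact: gg.
have g0' x : 0 <= g x.
  by apply: (cvgr_to_ge (gg x)); exact: nearW.
have i : intb g.
  apply/integrableP; split; first exact/measurable_EFinP.
  by rewrite integral_abs_ge0// (le_lt_trans H)// ltry.
by split => //; rewrite -lee_fin -Rint_EFin.
Qed.

Lemma hoelder_Rint p q f g : 0 < p -> 0 < q -> p^-1 + q^-1 = 1 ->
  Lpow mu p f -> Lpow mu q g ->
  `|\int[mu]_x (f x * g x)| <=
    (\int[mu]_x (`|f x| `^ p)) `^ p^-1 * (\int[mu]_x (`|g x| `^ q)) `^ q^-1.
Proof.
move=> p0 q0 pq Lf Lg; have [mf lf] := Lf; have [mg lg] := Lg.
have i := Lpow_intbM p0 q0 pq Lf Lg.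
apply: (le_trans (Rint_norm i)).
have := hoelder mu mf mg p0 q0 pq.
have -> : ('N[mu]_1[EFin \o (f \* g)%R] = (\int[mu]_x `|f x * g x|)%:E)%E.
  by rewrite Lnorm1 -Rint_EFin//; exact: intb_norm.
have FN (r : R) h : 0 < r -> Lpow mu r h ->
    ('N[mu]_r%:E[EFin \o h] = ((\int[mu]_x (`|h x| `^ r)) `^ r^-1)%:E)%E.
  move=> r0 Lh; rewrite -Lp_norm_pow// fineK// ge0_fin_numE ?Lnorm_ge0//.
  by move/(LpowP _ _ r0) : Lh; rewrite inE => /andP[_]; rewrite inE.
by rewrite !FN// -EFinM lee_fin.
Qed.

(** [L] is defined on all functions but constrained on L^p only, and no sign is imposed on [C];
    hence the absolute values [|C|] in the estimates below. *)
Definition lin_bdd p C (L : (T -> R) -> R) :=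
  (forall c f g, Lpow mu p f -> Lpow mu p g ->
     L (fun x => c * f x + g x) = c * L f + L g) /\
  forall f, Lpow mu p f -> `|L f| <= C * (\int[mu]_x (`|f x| `^ p)) `^ p^-1.

Lemma lin_bddB p C L f g : 1 <= p -> lin_bdd p C L -> Lpow mu p f ->
  Lpow mu p g -> L (fun x => f x - g x) = L f - L g.
Proof.
move=> p1 [lin _] Lf Lg.
rewrite (_ : (fun _ => _) = (fun x => -1 * g x + f x)).
  by rewrite lin// mulN1r addrC.
by apply/funext => x; rewrite mulN1r addrC.
Qed.

Lemma lin_bdd_cvg p C L (f_ : nat -> T -> R) f : 1 <= p -> lin_bdd p C L ->
  (forall n, Lpow mu p (f_ n)) -> Lpow mu p f ->
  \int[mu]_x (`|f_ n x - f x| `^ p) @[n --> \oo] --> 0 ->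
  L (f_ n) @[n --> \oo] --> L f.
Proof.
move=> p1 lL Lf_ Lf H; have [_ bdd] := lL.
have p0 : 0 < p by rewrite (lt_le_trans _ p1).
apply/subr_cvg0.
have H2 : C * (\int[mu]_x (`|f_ n x - f x| `^ p)) `^ p^-1 @[n --> \oo] --> 0.
  rewrite -(mulr0 C); apply: cvgMr; apply: cvg_powR0 H; rewrite ?invr_gt0//.
  by move=> n; apply: Rint_ge0 => x; exact: powR_ge0.
apply/norm_cvg0P.
apply: (squeeze_cvgr _ (cvg_cst 0) H2); apply: nearW => n.
by rewrite normr_ge0/= -(lin_bddB p1 lL)// bdd//; apply: LpowB => //; exact: ltW.
Qed.

Lemma lin_bdd_eq0 p C L : 1 <= p -> lin_bdd p C L ->
  (forall A, measurable A -> L \1_A = 0) -> forall f, Lpow mu p f -> L f = 0.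
Proof.
move=> p1 lL L1; have [lin bdd] := lL.
have p0 : 0 < p by rewrite (lt_le_trans _ p1).
apply: (Lpow_ind p1).
- by move=> A mA; apply: Lpow_indic => //; exact: ltW.
- exact: L1.
- by move=> c f g Lf Lg L_f L_g; rewrite lin// L_f L_g mulr0 addr0.
- move=> f Lf H.
  have C0 e : 0 < e -> `|L f| <= `|C| * e.
    move=> e0; have [g [Lg Lg0 fg]] := H _ (powR_gt0 p e0).
    rewrite -(subr0 (L f)) -Lg0 -(lin_bddB p1 lL)//.
    apply: (le_trans (bdd _ (LpowB (ltW p0) Lf Lg))).
    apply: (@le_trans _ _ (`|C| * (\int[mu]_x (`|f x - g x| `^ p)) `^ p^-1)).
      by rewrite ler_wpM2r ?powR_ge0// ler_norm.
    rewrite ler_wpM2l// (_ : e = (e `^ p) `^ p^-1); last first.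
      by rewrite -powRrM mulfV ?gt_eqF// powRr1// ltW.
    apply: ge0_ler_powR => //; rewrite ?nnegrE ?powR_ge0 ?invr_ge0 ?(ltW p0)//.
    by apply: Rint_ge0 => x; exact: powR_ge0.
  apply/eqP; rewrite -normr_le0; apply/ler_addgt0Pr => e e0; rewrite add0r.
  have C1 : 0 < `|C| + 1 by rewrite ltr_wpDl.
  apply: (le_trans (C0 _ (divr_gt0 e0 C1))).
  by rewrite mulrCA ler_piMr ?(ltW e0)// ler_pdivrMr// mul1r lerDl.
Qed.

Lemma lin_bddD p C C' L L' : lin_bdd p C L -> lin_bdd p C' L' ->
  lin_bdd p (C + C') (fun f => L f - L' f).
Proof.
move=> [l1 b1] [l2 b2]; split => [c f g Lf Lg|f Lf].
  by rewrite l1// l2//; ring.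
by rewrite (le_trans (ler_normB _ _))// mulrDl lerD// ?b1 ?b2.
Qed.

Lemma lin_bdd_int p q g : 0 < p -> 0 < q -> p^-1 + q^-1 = 1 -> Lpow mu q g ->
  lin_bdd p ((\int[mu]_x (`|g x| `^ q)) `^ q^-1)
    (fun f => \int[mu]_x (f x * g x)).
Proof.
move=> p0 q0 pq Lg.
have iM f : Lpow mu p f -> intb (fun x => f x * g x).
  by move=> Lf; exact: (Lpow_intbM p0 q0 pq).
split => [c f1 f2 L1 L2|f Lf].
  rewrite -RintZ ?iM// -RintD ?iM//; last exact/intbZ/iM.
  by apply: eq_Rintegral => x _; rewrite mulrDl mulrA.
by rewrite mulrC; exact: hoelder_Rint.
Qed.

Lemma lin_bdd_eq p C C' L L' : 1 <= p -> lin_bdd p C L -> lin_bdd p C' L' ->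
  (forall A, measurable A -> L \1_A = L' \1_A) ->
  forall f, Lpow mu p f -> L f = L' f.
Proof.
move=> p1 lL lL' LL' f Lf; apply/eqP; rewrite -subr_eq0; apply/eqP.
apply: (lin_bdd_eq0 p1 (lin_bddD lL lL')) => // A mA.
by rewrite LL'// subrr.
Qed.

End riesz.

(** * Bounded functionals on L^p *)

Section representation.
Context {dd : measure_display} {T : measurableType dd} {R : realType}.
Variable mu : probability T R.
Variables (p C : R) (L : (T -> R) -> R).
Hypotheses (p1 : 1 < p) (lL : lin_bdd mu p C L).
Implicit Types (f g : T -> R).
Local Notation intb f := (mu.-integrable setT (EFin \o f)).

Let p0 : 0 < p. Proof. exact: lt_trans p1. Qed.

(** Candidate charge for the Radon-Nikodym theorem. A set function is total, so nonmeasurable sets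
    receive the value 0. *)
Let nu (A : set T) : \bar R := if `[< measurable A >] then (L \1_A)%:E else 0%E.

Let nuE A : measurable A -> nu A = (L \1_A)%:E.
Proof. by move=> mA; rewrite /nu; case: asboolP. Qed.

Let L0 : L (cst 0) = 0.
Proof.
have [lin _] := lL.
have H : Lpow mu p (cst 0).
  by apply: (@Lpow_bdd _ _ _ _ _ _ 0) => // [|x]; [exact: ltW|rewrite /= normr0].
have := lin 1 _ _ H H.
rewrite (_ : (fun _ => _) = cst 0); last first.
  by apply/funext => x; rewrite mulr0 addr0.
by move/eqP; rewrite mul1r -subr_eq0 opprD addrA subrr sub0r oppr_eq0 => /eqP.
Qed.

Let nu0 : nu set0 = 0%E.
Proof. by rewrite nuE// indic0 L0. Qed.

Let nu_fin A : measurable A -> nu A \is a fin_num.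
Proof. by move=> mA; rewrite nuE. Qed.

(** The partial sums of the indicators of disjoint sets converge in L^p to the indicator of the
    union, by dominated convergence with bound 1, and [L] is continuous for this convergence. *)
Let nu_sigma : semi_sigma_additive nu.
Proof.
move=> F mF tF mUF; have [lin bdd] := lL.
pose s n x : R := \sum_(0 <= i < n) \1_(F i) x.
(* By disjointness the partial sum at a point of [F k] is 1 exactly when [k < n]; this yields both
   the bound and the pointwise limit. *)
have sE x n : (forall k, F k x -> s n x = (k < n)%:R) /\
    (~ (\bigcup_k F k) x -> s n x = 0).
  split=> [k Fkx|Fx].
    have Fi i : \1_(F i) x = (i == k)%:R :> R.
      rewrite indicE; case: eqP => [->|/eqP ik]; first by rewrite mem_set.
      rewrite memNset// => Fix; move/trivIsetP : tF => /(_ i k I I ik).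
      by apply/eqP/set0P; exists x.
    rewrite /s; elim: n => [|n IH]; first by rewrite big_nil.
    rewrite big_nat_recr//= IH Fi [in RHS]ltnS [in RHS]leq_eqVlt.
    have [->|nk] := eqVneq n k; first by rewrite ltnn add0r.
    by rewrite addr0 ?(eq_sym k) ?(negbTE nk).
  rewrite /s big1// => i _; rewrite indicE memNset// => Fix.
  by apply: Fx; exists i.
have s01 n x : 0 <= s n x <= 1.
  have [[k _ Fkx]|Fx] := pselect ((\bigcup_k F k) x).
    by rewrite ((sE x n).1 k Fkx) ler0n /=; case: ltnP => _; rewrite ?lexx ?ler01.
  by rewrite ((sE x n).2 Fx) lexx ler01.
have ms n : measurable_fun setT (s n).
  by apply: measurable_sum => i; exact: measurable_indic.
have Ls n : Lpow mu p (s n).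
  apply: (@Lpow_bdd _ _ _ _ _ _ 1) => //; first exact: ltW.
  by move=> x; have /andP[? ?] := s01 n x; rewrite ger0_norm.
have LU : Lpow mu p \1_(\bigcup_k F k) by apply: Lpow_indic => //; exact: ltW.
have sU : forall x, s n x @[n --> \oo] --> (\1_(\bigcup_k F k) x : R).
  move=> x; have [[k _ Fkx]|Fx] := pselect ((\bigcup_k F k) x).
    rewrite indicE mem_set; last by exists k.
    apply: cvg_near_cst; exists k.+1 => // n /= kn.
    by rewrite ((sE x n).1 k Fkx) kn.
  rewrite indicE memNset//.
  by apply: cvg_near_cst; apply: nearW => n; rewrite ((sE x n).2 Fx).
rewrite nuE// (_ : (fun _ => _) = EFin \o (fun n => L (s n))); last first.
  apply/funext => n /=; elim: n => [|n IH].
    rewrite big_nil (_ : s 0 = cst 0) ?L0//.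
    by apply/funext => x; rewrite /s big_nil.
  rewrite big_nat_recr//= IH nuE// -EFinD; congr EFin.
  rewrite -[L (s n)]mul1r [RHS](_ : _ = L (fun x => 1 * s n x + \1_(F n) x)).
    by rewrite lin//; apply: Lpow_indic => //; exact: ltW.
  by congr L; apply/funext => x; rewrite /s big_nat_recr//= mul1r.
apply: cvg_EFin; first exact: nearW.
apply: (lin_bdd_cvg (ltW p1) lL Ls LU).
have [|||||_ H] := @Rint_dct _ _ _ mu
    (fun n x => `|s n x - \1_(\bigcup_k F k) x| `^ p) (cst 0) (cst 1) => //.
- by move=> n; apply: measurable_powR_abs; apply: measurable_funB.
- apply: aeW => x; apply: cvg_powR0 => //.
  rewrite -(normr0 R) -(subrr (\1_(\bigcup_k F k) x : R)); apply: cvg_norm.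
  by apply: cvgB; [exact: sU|exact: cvg_cst].
- exact: finite_measure_integrable_cst.
- move=> n x; rewrite ger0_norm ?powR_ge0//.
  have := @ge0_ler_powR R p (ltW p0) `|s n x - \1_(\bigcup_k F k) x| 1.
  rewrite powR1; apply; rewrite ?nnegrE// ler_norml.
  have /andP[? ?] := s01 n x; rewrite indicE; case: (_ \in _) => /=; lra.
by move: H; rewrite Rint_cst.
Qed.

HB.instance Definition _ := isCharge.Build _ _ _ nu nu0 nu_fin nu_sigma.

(** [w] is the density of the charge. Its membership in L^q is obtained on the sets where
    [|w| <= K], by testing [L] with the dual power of the truncated density; the resulting bound
    [|C| ^ q] does not depend on [K]. *)
Lemma riesz q : p^-1 + q^-1 = 1 ->
  exists2 w, Lpow mu q w & forall f, Lpow mu p f -> L f = \int[mu]_x (f x * w x).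
Proof.
move=> pq.
have q0 : 0 < q.
  by rewrite -invr_gt0 -(ltrD2l p^-1) pq addr0 invf_lt1.
have dom : nu `<< mu.
  apply/null_content_dominatesP => A mA A0.
  rewrite /= nuE//; congr EFin; apply/eqP; rewrite -normr_le0.
  have [_ /(_ \1_A)] := lL; rewrite (_ : \int[mu]_x _ = 0).
    rewrite powR0 ?invr_eq0 ?gt_eqF// mulr0; apply.
    by apply: Lpow_indic => //; exact: ltW.
  rewrite -(Rint_zero mu); apply: Rint_ae => //.
    by apply: measurable_powR_abs.
  exists A; split => // x /= H; apply: contrapT => Ax; apply: H.
  by rewrite indicE memNset// normr0 powR0 ?gt_eqF.
have iw := Radon_Nikodym_integrable dom.
pose w x := fine (Radon_Nikodym nu mu x).
have wE x : (w x)%:E = Radon_Nikodym nu mu x.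
  by rewrite fineK// Radon_Nikodym_fin_num.
have ibw : intb w.
  by apply: eq_integrable iw => // x _; rewrite /= wE.
have mw := intb_meas ibw.
have LA A : measurable A -> L \1_A = \int[mu]_x (\1_A x * w x).
  move=> mA.
  have H : (L \1_A)%:E = (\int[mu]_(x in A) Radon_Nikodym nu mu x)%E.
    by rewrite -(nuE mA); exact: Radon_Nikodym_integral.
  apply: EFin_inj; rewrite H -Rint_EFin; last first.
    apply: (intb_ext _ (intb_bddM ibw _ (aeW _ (indic_le1 A)))) => // x.
    by rewrite mulrC.
  rewrite [LHS]integral_mkcond; apply: eq_integral => x _.
  by rewrite patchE -wE indicE; case: (_ \in _); rewrite ?mul1r ?mul0r.
pose B (K : nat) := [set x | `|w x| <= K%:R].
have mB K : measurable (B K).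
  have mn : measurable_fun setT (fun x => `|w x|) by exact: measurableT_comp.
  rewrite (_ : B K = (fun x => `|w x|) @^-1` [set` `]-oo, K%:R]]).
    by rewrite -[X in measurable X]setTI; exact: mn.
  by apply/seteqP; split => x /=; rewrite in_itv.
pose wK K x := w x * \1_(B K) x.
have wK_le K x : `|wK K x| <= K%:R.
  rewrite /wK indicE; have [|] := boolP (x \in B K).
    by rewrite inE mulr1.
  by rewrite mulr0 normr0.
have mwK K : measurable_fun setT (wK K) by exact: measurable_funM.
have LwK K r : 0 <= r -> Lpow mu r (wK K).
  by move=> r0; exact: (Lpow_bdd _ r0 (mwK K) (wK_le K)).
have ind_le f K r x : `|f x * \1_(B K) x| `^ r <= `|f x| `^ r.
  rewrite indicE; case: (_ \in _); rewrite ?mulr1// mulr0 normr0.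
  have [->|rn0] := eqVneq r 0; first by rewrite !powRr0.
  by rewrite powR0// powR_ge0.
have Lind f K r : Lpow mu r f -> Lpow mu r (fun x => f x * \1_(B K) x).
  move=> [mf lf].
  have mfB : measurable_fun setT (fun x => f x * \1_(B K) x).
    exact: measurable_funM.
  split=> //; apply: (intb_le (measurable_powR_abs _ mfB) _ lf) => x.
  by rewrite ger0_norm ?powR_ge0.
have boundC f K : Lpow mu p f -> `|L (fun x => f x * \1_(B K) x)| <=
    `|C| * (\int[mu]_x (`|f x| `^ p)) `^ p^-1.
  have [_ bdd] := lL => Lf; have LfK := Lind _ K _ Lf.
  apply: (le_trans (bdd _ LfK)).
  apply: (@le_trans _ _
      (`|C| * (\int[mu]_x (`|f x * \1_(B K) x| `^ p)) `^ p^-1)).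
    by rewrite ler_wpM2r ?powR_ge0// ler_norm.
  apply: ler_wpM2l; first exact: normr_ge0.
  apply: ge0_ler_powR; rewrite ?nnegrE.
  - by rewrite invr_ge0 ltW.
  - by apply: Rint_ge0 => x; exact: powR_ge0.
  - by apply: Rint_ge0 => x; exact: powR_ge0.
  - apply: Rint_le; [exact: LfK.2|exact: Lf.2|move=> x; exact: ind_le].
(* The truncation [wK K] is bounded, hence in L^q, so both sides are bounded functionals on L^p and
   agreement on indicators suffices. *)
have step K f : Lpow mu p f ->
    L (fun x => f x * \1_(B K) x) = \int[mu]_x (f x * wK K x).
  have [lin _] := lL.
  apply: (@lin_bdd_eq _ _ _ mu p `|C| _ (fun f => L (fun x => f x * \1_(B K) x))
    _ (ltW p1) _ (lin_bdd_int p0 q0 pq (LwK K q (ltW q0)))).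
    split => [c f1 f2 L1 L2|f1 L1]; last exact: boundC.
    rewrite -(lin c _ _ (Lind _ K _ L1) (Lind _ K _ L2)); congr L; apply/funext => x; ring.
  move=> A mA.
  rewrite (_ : (fun x => _) = \1_(A `&` B K)); last first.
    by apply/funext => x; rewrite indicI.
  rewrite LA; last exact: measurableI.
  by apply: eq_Rintegral => x _; rewrite indicI /wK/= mulrAC mulrA.
pose I_ K := \int[mu]_x (`|wK K x| `^ q).
have q1p : (q - 1) * p = q.
  have : p * q * (p^-1 + q^-1) = p + q by field; rewrite !gt_eqF.
  by rewrite pq mulr1 mulrBl mul1r mulrC => ->; ring.
have IC K : I_ K <= `|C| `^ q.
  (* Extremal function of the Hoelder inequality: as [(q - 1) * p = q], both [f * wK] and [|f| ^ p]
     equal [|wK| ^ q]. Where [wK] vanishes so does [f], whatever the sign of [q - 2]. *)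
  pose f x := wK K x * `|wK K x| `^ (q - 2).
  have fE x : f x * wK K x = `|wK K x| `^ q /\ `|f x| `^ p = `|wK K x| `^ q
      /\ f x * \1_(B K) x = f x.
    split; [|split].
    - have [w0|w0] := eqVneq (wK K x) 0.
        by rewrite /f w0 mulr0 normr0 powR0 ?gt_eqF.
      rewrite /f mulrAC -expr2 -real_normK ?num_real//.
      rewrite -powR_mulrn// -powRD ?normr_eq0 ?w0 ?implybT//.
      by congr (_ `^ _); rewrite addrC subrK.
    - have [w0|w0] := eqVneq (wK K x) 0.
        by rewrite /f w0 mul0r normr0 !powR0 ?gt_eqF.
      rewrite /f normrM (ger0_norm (powR_ge0 _ _)).
      rewrite -{1}(@powRr1 R `|wK K x|)// -powRD ?normr_eq0 ?w0 ?implybT//.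
      rewrite -powRrM (_ : 1 + (q - 2) = q - 1) ?q1p//; ring.
    - rewrite /f /wK indicE; case: (_ \in _); by rewrite ?mulr1// !mulr0 !mul0r.
  have mf : measurable_fun setT f.
    by apply: measurable_funM => //; exact: measurable_powR_abs.
  have Lf : Lpow mu p f.
    split => //; apply: intb_ext (LwK K q (ltW q0)).2 => x.
    by rewrite (fE x).2.1.
  have := boundC _ K Lf; rewrite step//.
  rewrite (_ : \int[mu]_x (f x * _) = I_ K); last first.
    by apply: eq_Rintegral => x _; rewrite (fE x).1.
  rewrite (_ : \int[mu]_x (`|f x| `^ p) = I_ K); last first.
    by apply: eq_Rintegral => x _; rewrite (fE x).2.1.
  have I0 : 0 <= I_ K by apply: Rint_ge0 => x; exact: powR_ge0.
  rewrite ger0_norm//.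
  (* The bound reads [I <= |C| * I ^ (1 / p)]; writing [I = I ^ (1 / p) * I ^ (1 / q)] allows a
     division unless [I = 0]. *)
  have [->|In0] := eqVneq (I_ K) 0; first by rewrite powR_ge0.
  have Igt : 0 < I_ K by rewrite lt0r In0.
  rewrite -{1}(powRr1 I0) -pq powRD ?In0 ?implybT// [X in X <= _]mulrC.
  rewrite ler_pM2r ?powR_gt0// => Iq.
  have := ge0_ler_powR (ltW q0) (powR_ge0 _ _ : _ \is Num.nneg) (normr_ge0 _ : _ \is Num.nneg) Iq.
  by rewrite -powRrM mulVf ?gt_eqF// powRr1.
have [|||||iwq _] := @Rint_mono_bound _ _ _ mu (fun K x => `|wK K x| `^ q)
    (fun x => `|w x| `^ q) (`|C| `^ q) => //.
- by move=> K; case: (LwK K q (ltW q0)).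
- move=> x a b ab; rewrite /wK !indicE; have [|] := boolP (x \in B a).
    rewrite inE /B /= => wa; rewrite mem_set//= (le_trans wa)// ler_nat//.
  by rewrite mulr0 normr0 powR0 ?gt_eqF// powR_ge0.
- move=> x; apply: cvg_near_cst.
  exists (Num.truncn `|w x|).+1 => // n /= wn; rewrite /wK indicE mem_set ?mulr1//.
  rewrite /B/=; apply: (le_trans (ltW (truncnS_gt _))).
  by rewrite ler_nat.
have Lw : Lpow mu q w by [].
exists w => //; apply: (lin_bdd_eq (ltW p1) lL (lin_bdd_int p0 q0 pq Lw)).
exact: LA.
Qed.

End representation.

(** * The unit cube and periodic functions *)

Section cube_facts.
Context {R : realType}.
Local Notation U := (uniform_prob (@ltr01 R)).
Local Notation cube := (@cube R).

(** [cube n.+1] is the law of [row_cons] under a product measure, so Tonelli's theorem splits off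
    the first coordinate. *)
Lemma cube_prod n (psi : 'I_n -> R -> R) (c : 'I_n -> R) :
  (forall i, measurable_fun setT (psi i)) -> (forall i t, 0 <= psi i t) ->
  (forall i, (\int[U]_t (psi i t)%:E = (c i)%:E)%E) ->
  (\int[cube n]_x (\prod_i psi i (x 0 i))%:E = (\prod_i c i)%:E)%E.
Proof.
elim: n psi c => [|n IH] psi c mpsi psi0 Ipsi.
  rewrite (eq_integral (cst 1%E)); last by move=> x _; rewrite big_ord0.
  by rewrite big_ord0 integral_cst// mul1e -[LHS]/(cube 0 setT) probability_setT.
rewrite /= ge0_integral_distribution.
- rewrite (fubini_tonelli1 (fun p => (\prod_i psi i (row_cons p 0 i))%:E)).
  + rewrite /fubini_F /=.
    transitivity (\int[U]_t ((\prod_i c (lift ord0 i))%:E * (psi ord0 t)%:E))%E.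
      apply: eq_integral => t _.
      rewrite -(IH (fun i => psi (lift ord0 i)))//.
      rewrite muleC -ge0_integralZl//=.
      * apply: eq_integral => y _; rewrite -EFinM big_ord_recl; congr EFin.
        rewrite /row_cons mxE unlift_none; congr (_ * _).
        by apply: eq_bigr => i _; rewrite mxE liftK.
      * apply/measurable_EFinP; apply: measurable_prod => i _.
        exact: (measurableT_comp (mpsi _) (measurable_row_coord i)).
      * by move=> y _; rewrite lee_fin prodr_ge0.
      * by rewrite lee_fin psi0.
    rewrite ge0_integralZl//=.
    * by rewrite Ipsi -EFinM mulrC big_ord_recl.
    * by apply/measurable_EFinP; exact: mpsi.
    * by move=> y _; rewrite lee_fin psi0.
    * rewrite lee_fin prodr_ge0// => i _; rewrite -lee_fin -Ipsi.
      by apply: integral_ge0 => t _; rewrite lee_fin.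
  + apply/measurable_EFinP; apply: measurable_prod => i _.
    apply: (measurableT_comp (mpsi i)).
    exact: (measurableT_comp (measurable_row_coord i) (@measurable_row_cons R n)).
  + by move=> p; rewrite lee_fin prodr_ge0.
- apply/measurable_EFinP; apply: measurable_prod => i _.
  exact: (measurableT_comp (mpsi _) (measurable_row_coord i)).
- by move=> y; rewrite lee_fin prodr_ge0.
Qed.

Lemma integral_U (f : R -> R) : measurable_fun setT f -> (forall t, 0 <= f t) ->
  (\int[U]_t (f t)%:E = \int[lebesgue_measure]_(t in `[0%R, 1%R]) (f t)%:E)%E.
Proof.
move=> mf f0; rewrite integral_uniform//.
- by rewrite subr0 invr1 mul1e.
- exact/measurable_EFinP.
Qed.

Lemma cube_coord n (i : 'I_n) (f : R -> R) c : measurable_fun setT f ->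
  (forall t, 0 <= f t) -> (\int[U]_t (f t)%:E = c%:E)%E ->
  (\int[cube n]_x (f (x 0 i))%:E = c%:E)%E.
Proof.
move=> mf f0 fc.
have := @cube_prod n (fun j => if j == i then f else cst 1)
  (fun j => if j == i then c else 1).
have P1 (F : 'I_n -> R) : (forall j, j != i -> F j = 1) -> \prod_j F j = F i.
  by move=> F1; rewrite (bigD1 i)//= big1 ?mulr1.
rewrite P1; last by move=> j /negbTE ->.
rewrite eqxx => <-.
- apply: eq_integral => x _; rewrite P1 ?eqxx// => j /negbTE ->; by [].
- by move=> j; case: ifP.
- by move=> j t; case: ifP.
- move=> j; case: ifP => // _; rewrite (eq_integral (cst 1%E))//.
  by rewrite integral_cst// mul1e; exact: (@probability_setT _ _ _ U).
Qed.

(** The faces of the cube are null sets. Hence almost every point has vanishing integer parts and is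
    fixed by [frac]. *)
Lemma cube_ae01 n : {ae cube n, forall x : 'rV[R]_n, forall i, 0 < x 0 i < 1}.
Proof.
have H (i : 'I_n) : {ae cube n, forall x : 'rV[R]_n, 0 < x 0 i < 1}.
  pose A := ~` (`]0, 1[%classic : set R).
  have mA : measurable A by exact: measurableC.
  exists (row_coord i @^-1` A); split.
  - rewrite -[X in measurable X]setTI; exact: measurable_row_coord.
  - have mA' : measurable (row_coord i @^-1` A).
      by rewrite -[X in measurable X]setTI; exact: measurable_row_coord.
    transitivity (\int[cube n]_x (\1_(row_coord i @^-1` A) x)%:E)%E.
      by rewrite integral_indic// setIT.
    transitivity (\int[cube n]_x (\1_A (x 0 i) : R)%:E)%E.
      by apply: eq_integral => x _; rewrite !indicE.
    apply: cube_coord.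
    - exact: measurable_indic.
    - by move=> t; rewrite indicE.
    rewrite integral_U; [|exact: measurable_indic|by move=> t; rewrite indicE].
    rewrite integral_indic// (_ : _ `&` _ = [set 0] `|` [set 1]); last first.
      apply/seteqP; split => x /=; rewrite !in_itv/=.
        move=> [H /andP[x0 x1]]; apply: contrapT => /not_orP[n0 n1]; apply: H.
        rewrite /= in_itv/=.
        by rewrite !lt_neqAle x0 x1 !andbT; apply/andP; split; apply/eqP => // /esym.
      by move=> [->|->]; (split; first by rewrite /A /= in_itv/= ltxx ?andbF);
        rewrite ?lexx ?ler01.
    apply/eqP; rewrite eq_le; apply/andP; split => //.
    apply: (le_trans (measureU2 _ _ _)) => //.
    rewrite -[leRHS]adde0; apply: leeD; rewrite le_eqVlt; apply/orP; left; apply/eqP;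
      exact: lebesgue_measure_set1.
  - by move=> x /= H; apply: contrapT => H2; apply: H; move: H2 => /contrapT; rewrite /= in_itv.
have : {ae cube n, forall x : 'rV[R]_n, forall i, i \in enum 'I_n -> 0 < x 0 i < 1}.
  elim: (enum 'I_n) => [|j s IH]; first by apply: aeW.
  apply: filterS2 IH (H j) => x H1 H2 i.
  by rewrite inE => /predU1P[->//|]; exact: H1.
by apply: filterS => x H1 i; apply: H1; rewrite mem_enum.
Qed.

(** Composition with this representative in [0, 1[^n makes any function periodic and changes it only
    on a null set of the cube. *)
Definition frac n (x : 'rV[R]_n) : 'rV[R]_n :=
  \row_i (x 0 i - (Num.floor (x 0 i))%:~R).

Lemma measurable_frac n : measurable_fun setT (@frac n).
Proof.
apply: measurable_fun_row => i.
rewrite (_ : _ \o _ = (fun t : R => t - (Num.floor t)%:~R) \o row_coord i).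
  apply: (measurableT_comp _ (measurable_row_coord i)).
  apply: measurable_funB => //; apply: nondecreasing_measurable => // s t st.
  by rewrite ler_int le_floor.
by apply/funext => x; rewrite /row_coord /frac /= mxE.
Qed.

Lemma frac_ae n : {ae cube n, forall x : 'rV[R]_n, frac x = x}.
Proof.
apply: filterS (@cube_ae01 n) => x H; apply/rowP => i; rewrite mxE.
rewrite (_ : Num.floor _ = 0) ?subr0//.
by apply/floor_def; rewrite add0r; have /andP[/ltW -> ->] := H i.
Qed.

Lemma frac_periodic n (Y : Type) (f : 'rV[R]_n -> Y) : Zd_periodic (f \o @frac n).
Proof.
move=> x i; congr f; apply/rowP => j; rewrite !mxE.
rewrite eqxx /=; case: (j == i); rewrite ?mulr0n ?addr0// mulr1n.
rewrite floorDrz// floor1 intrD; ring.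
Qed.

Lemma periodic_add n (Y : Type) (f : 'rV[R]_n -> Y) x i (k : int) :
  Zd_periodic f -> f (x + k%:~R *: basis_vec i) = f x.
Proof.
move=> pf.
have Hn (m : nat) y : f (y + m%:R *: basis_vec i) = f y.
  elim: m y => [|m IH] y; first by rewrite scale0r addr0.
  by rewrite -natr1 scalerDl scale1r addrA pf IH.
case: k => m; first exact: Hn.
rewrite NegzE mulrNz scaleNr -[LHS](Hn m.+1) -pmulrn.
by rewrite subrK.
Qed.

Lemma periodic_frac n (Y : Type) (f : 'rV[R]_n -> Y) x :
  Zd_periodic f -> f (frac x) = f x.
Proof.
move=> pf.
have -> : frac x = x + \sum_(i < n) (- Num.floor (x 0 i))%:~R *: basis_vec i.
  apply/rowP => j; rewrite !mxE summxE (bigD1 j)//= big1.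
    by rewrite !mxE !eqxx/= mulr1 addr0 mulrNz.
  by move=> i ij; rewrite !mxE eqxx /= eq_sym (negbTE ij) mulr0.
elim: (index_enum _) => [|i s IH]; first by rewrite big_nil addr0.
by rewrite big_cons addrCA addrC periodic_add.
Qed.

End cube_facts.

(** * Trigonometric kernels *)

Section periodic_kernel.
Context {R : realType}.
Implicit Types (u s t : R) (n N : nat).
Local Notation U := (uniform_prob (@ltr01 R)).
Local Notation pi := (@pi R).

Definition pcos u : R := cos (2 * pi * u).
Definition psin u : R := sin (2 * pi * u).
(* [cos (pi u) ^+ 2], written as a polynomial in [pcos]. *)
Definition halfcos u : R := (1 + pcos u) / 2.
(* Mean value of [halfcos ^+ n] over a period. *)
Definition wallis n : R := \prod_(j < n) ((2 * j%:R + 1) / (2 * j%:R + 2)).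
Definition ker n u : R := halfcos u ^+ n / wallis n.
(* A periodic primitive of [ker N - 1]. *)
Definition primker N u : R :=
  \sum_(n < N) (halfcos u ^+ n * psin u) / (2 * pi * (2 * n%:R + 2) * wallis n.+1).

Lemma wallis_gt0 n : 0 < wallis n.
Proof. by apply: prodr_gt0 => j _; rewrite divr_gt0// ltr_wpDl. Qed.

Lemma wallisS n : wallis n.+1 = wallis n * ((2 * n%:R + 1) / (2 * n%:R + 2)).
Proof. by rewrite /wallis big_ord_recr. Qed.

Lemma pcosD1 u : pcos (u + 1) = pcos u.
Proof.
by rewrite /pcos mulrDr mulr1 -(cosD2pi (2 * pi * u)) mulr2n mulrDl mul1r.
Qed.

Lemma psinD1 u : psin (u + 1) = psin u.
Proof.
by rewrite /psin mulrDr mulr1 -(sinD2pi (2 * pi * u)) mulr2n mulrDl mul1r.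
Qed.

Lemma pcosB s t : pcos (s - t) = pcos s * pcos t + psin s * psin t.
Proof. by rewrite /pcos mulrBr cosB. Qed.

Lemma psinB s t : psin (s - t) = psin s * pcos t - pcos s * psin t.
Proof. by rewrite /psin mulrBr sinB. Qed.

Lemma primkerD1 N u : primker N (u + 1) = primker N u.
Proof.
by apply: eq_bigr => n _; rewrite /halfcos pcosD1 psinD1.
Qed.

Lemma halfcos01 u : 0 <= halfcos u <= 1.
Proof.
have := cos_geN1 (2 * pi * u); have := cos_le1 (2 * pi * u).
by rewrite /halfcos /pcos; lra.
Qed.

Lemma ker_ge0 n u : 0 <= ker n u.
Proof.
rewrite /ker divr_ge0//; last exact/ltW/wallis_gt0.
by rewrite exprn_ge0//; have /andP[] := halfcos01 u.
Qed.

Lemma ker_sym n u : ker n (- u) = ker n u.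
Proof. by rewrite /ker /halfcos /pcos mulrN cosN. Qed.

Global Instance is_derive_pcos u : is_derive u 1 pcos (- (2 * pi) * psin u).
Proof.
have h : is_derive u 1 (fun t : R => 2 * pi * t) (2 * pi).
  have := is_deriveZ (2 * pi) (is_derive_id u 1).
  by move/is_derive_eq; apply; rewrite /GRing.scale/= mulr1.
have := is_derive1_comp (is_derive_cos (2 * pi * u)) h.
by move/is_derive_eq; apply; rewrite /psin; ring.
Qed.

Global Instance is_derive_psin u : is_derive u 1 psin (2 * pi * pcos u).
Proof.
have h : is_derive u 1 (fun t : R => 2 * pi * t) (2 * pi).
  have := is_deriveZ (2 * pi) (is_derive_id u 1).
  by move/is_derive_eq; apply; rewrite /GRing.scale/= mulr1.
have := is_derive1_comp (is_derive_sin (2 * pi * u)) h.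
by move/is_derive_eq; apply; rewrite /pcos; ring.
Qed.

Lemma is_derive_halfcos u : is_derive u 1 halfcos (- pi * psin u).
Proof.
have := is_deriveZ 2^-1 (is_deriveD (is_derive_cst (1:R) u 1) (is_derive_pcos u)).
rewrite (_ : (_ \*: _) = halfcos); last first.
  by apply/funext => t; rewrite /halfcos mulrC.
by move/is_derive_eq; apply; rewrite /GRing.scale/= add0r; field.
Qed.

Lemma halfcos_psin u : psin u ^+ 2 = 4 * halfcos u * (1 - halfcos u).
Proof. by rewrite /psin sin2cos2 /halfcos /pcos; field. Qed.

(** From [psin ^ 2 = 4 * halfcos * (1 - halfcos)] and [pcos = 2 * halfcos - 1], only two consecutive
    powers of [halfcos] remain. With the denominator used in [primker] the result is
    [ker n.+1 - ker n], so the sum telescopes. *)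
Lemma is_derive_primker_term n u :
  is_derive u 1 (fun t => halfcos t ^+ n * psin t)
   (2 * pi * ((2 * n%:R + 2) * halfcos u ^+ n.+1
              - (2 * n%:R + 1) * halfcos u ^+ n)).
Proof.
have := is_deriveM (is_deriveX n (is_derive_halfcos u)) (is_derive_psin u).
rewrite (_ : _ * psin = fun t => halfcos t ^+ n * psin t); last first.
  by apply/funext => t /=; rewrite !fctE.
move/is_derive_eq; apply.
rewrite /GRing.scale/= (_ : psin u * _ =
  - pi * (n%:R * halfcos u ^+ n.-1) * psin u ^+ 2); last by ring.
rewrite halfcos_psin (_ : pcos u = 2 * halfcos u - 1); last first.
  by rewrite /halfcos; field.
rewrite !fctE; case: n => [|n] /=; first by rewrite ?expr1 ?expr0; ring.
by rewrite -natr1 !exprS; ring.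
Qed.

Lemma is_derive_primker N u : is_derive u 1 (primker N) (ker N u - 1).
Proof.
elim: N => [|N IH].
  rewrite (_ : primker 0 = cst 0); last first.
    by apply/funext => t; rewrite /primker big_ord0.
  rewrite /ker /wallis big_ord0 expr0 divr1 subrr; exact: is_derive_cst.
pose c := (2 * pi * (2 * N%:R + 2) * wallis N.+1)^-1.
have := is_deriveD IH (is_deriveZ c (is_derive_primker_term N u)).
rewrite (_ : _ + _ = primker N.+1); last first.
  apply/funext => t; rewrite /primker big_ord_recr/=; congr (_ + _).
  by rewrite [RHS]mulrC.
move/is_derive_eq; apply; rewrite /GRing.scale/= /c /ker wallisS.
have p0 := pi_gt0 R; have w0 := wallis_gt0 N.
have n0 : 0 <= N%:R :> R by [].
field.
by rewrite !gt_eqF//; lra.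
Qed.

Lemma derivable_primker N u : derivable (primker N) u 1.
Proof. by have := is_derive_primker N u. Qed.

Lemma continuous_pcos : continuous pcos.
Proof. by move=> u; apply/differentiable_continuous/derivable1_diffP; exact: ex_derive. Qed.

Lemma continuous_halfcos : continuous halfcos.
Proof.
move=> u; apply/differentiable_continuous/derivable1_diffP.
by have := is_derive_halfcos u.
Qed.

Lemma continuous_primker N : continuous (primker N).
Proof.
by move=> u; apply/differentiable_continuous/derivable1_diffP/derivable_primker.
Qed.

Lemma continuous_ker n : continuous (ker n).
Proof.
move=> u; apply: cvgM; last exact: cvg_cst.
exact: (continuous_comp (@continuous_halfcos u) (@exprn_continuous _ n _)).
Qed.

Lemma primker0 N : primker N 0 = 0.
Proof. by rewrite /primker big1// => n _; rewrite /psin mulr0 sin0 mulr0 mul0r. Qed.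

(** [primker N] vanishes at 0 and 1, and its derivative is at least [-1] because [ker N] is
    nonnegative. The mean value theorem from either endpoint gives [- v <= primker N v <= 1 - v] on
    the unit interval, for every [N]. *)
Lemma primker_norm_le1 N u : `|primker N u| <= 1.
Proof.
have mvt a b : a <= b -> exists c, primker N b - primker N a = (ker N c - 1) * (b - a).
  move=> ab; have [||c _ ->] := @MVT_segment _ (primker N) (fun u => ker N u - 1) a b ab.
  - by move=> x _; exact: is_derive_primker.
  - exact/continuous_subspaceT/continuous_primker.
  - by exists c.
have H v : 0 <= v <= 1 -> `|primker N v| <= 1.
  move=> /andP[v0 v1].
  have [c1] := mvt _ _ v0; have [c2] := mvt _ _ v1.
  have -> : primker N 1 = 0 by rewrite -(add0r 1) primkerD1 primker0.
  rewrite primker0 ler_norml; have k1 := ker_ge0 N c1; have k2 := ker_ge0 N c2.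
  have := mulr_ge0 k1 v0; have : 0 <= 1 - v by lra.
  move=> /(mulr_ge0 k2); nra.
have Hz (k : int) v : primker N (v + k%:~R) = primker N v.
  have Hn m w : primker N (w + m%:R) = primker N w.
    elim: m w => [|m IH] w; first by rewrite addr0.
    by rewrite -natr1 addrA primkerD1.
  case: k => m; first exact: Hn.
  by rewrite NegzE mulrNz -[LHS](Hn m.+1) -pmulrn subrK.
rewrite -(subrK (Num.floor u)%:~R u) Hz; apply: H.
by have := floor_itv u; rewrite intrD; lra.
Qed.

Lemma measurable_ker n : measurable_fun setT (ker n).
Proof. by apply: continuous_measurable_fun; exact: continuous_ker. Qed.

Lemma int_ker n s : (\int[U]_t (ker n (s - t))%:E = 1)%E.
Proof.
have cs : continuous (fun t : R => s - t).
  by move=> t; apply: cvgB; [exact: cvg_cst|exact: cvg_id].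
have ck : continuous (fun t : R => ker n (s - t)).
  by move=> t; apply: (continuous_comp (@cs t) (@continuous_ker n _)).
rewrite integral_U.
(* A primitive of the integrand; periodicity of [primker] leaves [F 1 - F 0 = 1], whatever the
   centre [s]. *)
- pose F t := t - primker n (s - t).
  have dF t : is_derive t 1 F (ker n (s - t)).
    have d1 : is_derive t 1 (fun t : R => s - t) (- 1).
      have := is_deriveB (is_derive_cst s t 1) (is_derive_id t 1).
      by move/is_derive_eq; apply; rewrite sub0r.
    have := is_deriveB (is_derive_id t 1)
      (@is_derive1_comp R (primker n) (fun t => s - t) t _ _
         (is_derive_primker n (s - t)) d1).
    by move/is_derive_eq; apply; ring.
  have cF : continuous F.
    move=> t; apply/differentiable_continuous/derivable1_diffP.
    by have := dF t.
  rewrite (@continuous_FTC2 _ _ F)//.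
  + rewrite /F subr0 -(primkerD1 n (s - 1)) subrK -EFinB; congr EFin; ring.
  + exact: continuous_subspaceT.
  + split; first by move=> t _; have := dF t.
    * exact/cvg_at_right_filter/cF.
    * exact/cvg_at_left_filter/cF.
  + by move=> t _; rewrite derive1E; apply: derive_val.
- exact: continuous_measurable_fun.
- by move=> t; exact: ker_ge0.
Qed.

(** Multiplication by [halfcos] turns [ker n] into [(2 * n + 1) / (2 * n + 2)] times [ker n.+1],
    which has integral 1 as well. The decay of this moment expresses the concentration of the kernel
    at the diagonal. *)
Lemma int_ker_moment n s :
  (\int[U]_t ((1 - halfcos (s - t)) * ker n (s - t))%:E = ((2 * n%:R + 2)^-1)%:E)%E.
Proof.
have n0 : 0 <= n%:R :> R by [].
have w0 := wallis_gt0 n.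
have e1 t : (1 - halfcos (s - t)) * ker n (s - t) =
    ker n (s - t) - (2 * n%:R + 1) / (2 * n%:R + 2) * ker n.+1 (s - t).
  rewrite /ker wallisS exprS; field.
  by rewrite !gt_eqF//; lra.
have ik k : U.-integrable setT (EFin \o (fun t => ker k (s - t))).
  apply/integrableP; split.
    apply/measurable_EFinP; apply: (measurableT_comp (measurable_ker k)).
    by apply: measurable_funB.
  rewrite integral_abs_ge0; last by move=> t; exact: ker_ge0.
  by rewrite int_ker ltry.
have iR k : \int[U]_t ker k (s - t) = 1 by rewrite /Rintegral int_ker.
rewrite Rint_EFin.
- congr EFin; transitivity (\int[U]_t (ker n (s - t) -
    (2 * n%:R + 1) / (2 * n%:R + 2) * ker n.+1 (s - t))).
    by apply: eq_Rintegral => t _; exact: e1.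
  rewrite RintB ?RintZ ?iR//; last exact: intbZ.
  by field; rewrite gt_eqF//; lra.
- apply: (intb_ext _ (intbB (ik n) (intbZ _ (ik n.+1)))) => t; exact/esym/e1.
Qed.

(** With [w = v / 2], duplication gives [sin v = 2 sin w cos w] and the mean value theorem
    [sin w = w cos c]. Both cosines are at least [cos (pi / 4)], whose square is 1/2. *)
Lemma sin_ge_half v : 0 <= v <= pi / 2 -> v / 2 <= sin v.
Proof.
move=> /andP[v0 v1]; have p0 := pi_gt0 R.
pose w := v / 2.
have vw : v = w *+ 2 by rewrite /w mulr2n; field.
have q2 : cos (pi / 4) ^+ 2 = 2^-1 :> R.
  have := cos_mulr2n (pi / 4 : R); rewrite (_ : pi / 4 *+ 2 = pi / 2); last first.
    by rewrite mulr2n; field.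
  by rewrite cos_pihalf => /eqP; rewrite eq_sym subr_eq0 mulr2n => /eqP; lra.
have q0 : 0 <= cos (pi / 4 : R) by apply: cos_ge0_pihalf; lra.
have cosq x : 0 <= x <= pi / 4 -> cos (pi / 4) <= cos x.
  move=> /andP[x0 x1]; rewrite leNgt; apply/negP.
  rewrite ltr_cos ?in_itv/=; lra.
have w01 : 0 <= w <= pi / 4 by rewrite /w; lra.
have w0 : 0 <= w by lra.
have csin : {within `[0, w], continuous sin}.
  exact/continuous_subspaceT/continuous_sin.
have [c] := MVT_segment w0 (fun x _ => is_derive_sin x) csin.
rewrite in_itv/= sin0 !subr0 => cw sw.
have cc := cosq c; have cw' := cosq w w01.
rewrite vw sin_mulr2n sw.
have {}cc : cos (pi / 4) <= cos c by apply: cc; lra.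
rewrite mulr2n.
have h1 : cos (pi / 4) * cos (pi / 4) <= cos w * cos c by exact: ler_pM.
move: h1; rewrite -expr2 q2 => h1.
have : 0 <= (cos w * cos c - 2^-1) * w by apply: mulr_ge0; lra.
rewrite mulr2n; nra.
Qed.

(** [1 - halfcos v] is [sin (pi v) ^ 2], and [sin (pi v) >= pi v / 2 >= v]. The squared distance on
    the circle is thus controlled by a function whose kernel moment is known. *)
Lemma halfcos_lower u : `|u| <= 2^-1 -> u ^+ 2 <= 1 - halfcos u.
Proof.
move=> u2.
have -> : u ^+ 2 = `|u| ^+ 2 by rewrite real_normK// num_real.
have -> : halfcos u = halfcos `|u|.
  rewrite /halfcos /pcos; case: (ger0P u) => // _; by rewrite mulrN cosN.
have v0 : 0 <= `|u| by [].
move: (`|u|) v0 u2 => {u} v v0 v2; have p0 := pi_gt0 R; have p2 := pi_ge2 R.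
have -> : 1 - halfcos v = sin (pi * v) ^+ 2.
  rewrite /halfcos /pcos (_ : 2 * pi * v = (pi * v) *+ 2); last by rewrite mulr2n; ring.
  by rewrite cos_mulr2n sin2cos2 mulr2n; field.
have := @sin_ge_half (pi * v).
have -> : 0 <= pi * v <= pi / 2 by nra.
move=> /(_ isT) h.
have : v <= sin (pi * v) by apply: le_trans h; nra.
by move=> ?; rewrite ler_pXn2r ?nnegrE//; lra.
Qed.

End periodic_kernel.

(** * Product kernel and mean oscillation *)

Section averaging.
Context {R : realType} {d : nat}.
Local Notation X := 'rV[R]_d.
Local Notation mu := (@cube R d).
Local Notation mu2 := (mu \x mu)%E.
Implicit Types (f g h : X -> R) (p q c C e : R) (x z : X) (w : X * X).
Local Notation intb f := (mu.-integrable setT (EFin \o f)).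
Local Notation intb2 f := (mu2.-integrable setT (EFin \o f)).

(** A function of two points rather than a convolution: each factor is periodic and even, so [rho]
    has total mass 1 in either variable on the fixed cube. *)
Definition rho (n : nat) x z : R := \prod_i ker n (x 0 i - z 0 i).

Lemma rho_ge0 n x z : 0 <= rho n x z.
Proof. by apply: prodr_ge0 => i _; exact: ker_ge0. Qed.

Lemma rho_sym n x z : rho n x z = rho n z x.
Proof. by apply: eq_bigr => i _; rewrite -ker_sym opprB. Qed.

Lemma measurable_coord (i : 'I_d) : measurable_fun setT (fun x : X => x 0 i).
Proof. exact: measurable_row_coord. Qed.

Lemma measurable_coord1 (i : 'I_d) :
  measurable_fun setT (fun w : X * X => w.1 0 i).
Proof. exact: (measurableT_comp (measurable_coord i) measurable_fst). Qed.

Lemma measurable_coord2 (i : 'I_d) :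
  measurable_fun setT (fun w : X * X => w.2 0 i).
Proof. exact: (measurableT_comp (measurable_coord i) measurable_snd). Qed.

Lemma measurable_rho n : measurable_fun setT (fun w : X * X => rho n w.1 w.2).
Proof.
apply: measurable_prod => i _.
apply: (measurableT_comp (measurable_ker n)).
by apply: measurable_funB; [exact: measurable_coord1|exact: measurable_coord2].
Qed.

Lemma measurable_rho2 n x : measurable_fun setT (rho n x).
Proof.
apply: measurable_prod => i _; apply: (measurableT_comp (measurable_ker n)).
by apply: measurable_funB => //; exact: measurable_coord.
Qed.

Lemma measurable_kerB n (s : R) : measurable_fun setT (fun t : R => ker n (s - t)).
Proof.
by apply: (measurableT_comp (measurable_ker n)); apply: measurable_funB.
Qed.

Lemma int_rho n x : (\int[mu]_z (rho n x z)%:E = 1)%E.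
Proof.
rewrite (@cube_prod R d (fun i t => ker n (x 0 i - t)) (fun=> 1)).
- by rewrite big1.
- by move=> i; exact: measurable_kerB.
- by move=> i t; exact: ker_ge0.
- by move=> i; rewrite int_ker.
Qed.

Lemma int_rho_moment n x (i : 'I_d) :
  (\int[mu]_z ((1 - halfcos (x 0 i - z 0 i)) * rho n x z)%:E
    = ((2 * n%:R + 2)^-1)%:E)%E.
Proof.
pose psi (j : 'I_d) (t : R) : R := if j == i
  then (1 - halfcos (x 0 i - t)) * ker n (x 0 i - t) else ker n (x 0 j - t).
have mh : measurable_fun setT (fun t : R => 1 - halfcos (x 0 i - t)).
  apply: measurable_funB => //; apply: (measurableT_comp (f := @halfcos R)).
    by apply: continuous_measurable_fun; exact: continuous_halfcos.
  exact: measurable_funB.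
have h01 t : 0 <= 1 - halfcos t by have := halfcos01 t; lra.
have := @cube_prod R d psi (fun j => if j == i then (2 * n%:R + 2)^-1 else 1).
rewrite -big_mkcond big_pred1_eq => <-.
- apply: eq_integral => z _; congr EFin; rewrite /rho.
  rewrite [in LHS](bigD1 i)//= [in RHS](bigD1 i)//= /psi eqxx mulrA; congr (_ * _).
  by apply: eq_bigr => j ji; rewrite (negbTE ji).
- move=> j; rewrite /psi; case: (j == i); last exact: measurable_kerB.
  by apply: measurable_funM => //; exact: measurable_kerB.
- move=> j t; rewrite /psi; case: (j == i); last exact: ker_ge0.
  by apply: mulr_ge0; [exact: h01|exact: ker_ge0].
- move=> j; rewrite /psi; case: (j == i); last by rewrite int_ker.
  by rewrite int_ker_moment.
Qed.

Lemma intb_rho n x : intb (rho n x).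
Proof.
apply/integrableP; split; first by apply/measurable_EFinP; exact: measurable_rho2.
by rewrite integral_abs_ge0 ?int_rho ?ltry// => z; exact: rho_ge0.
Qed.

(** As [rho n x] has mass 1, the measure of density [rho n] on the product has [mu] as its first
    marginal. *)
Lemma mu2_int1 n h : intb h -> (forall x, 0 <= h x) ->
  intb2 (fun w => h w.1 * rho n w.1 w.2) /\
  \int[mu2]_w (h w.1 * rho n w.1 w.2) = \int[mu]_x h x.
Proof.
move=> ih h0; have mh := intb_meas ih.
have mF : measurable_fun setT (fun w : X * X => h w.1 * rho n w.1 w.2).
  apply: measurable_funM; last exact: measurable_rho.
  exact: (measurableT_comp mh measurable_fst).
have E : (\int[mu2]_w (h w.1 * rho n w.1 w.2)%:E = (\int[mu]_x h x)%:E)%E.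
  rewrite (fubini_tonelli1 (fun w : X * X => (h w.1 * rho n w.1 w.2)%:E)).
  - rewrite -Rint_EFin//; apply: eq_integral => x _; rewrite /fubini_F /=.
    under eq_integral do rewrite EFinM.
    rewrite ge0_integralZl//=.
    + by rewrite int_rho mule1.
    + by apply/measurable_EFinP; exact: measurable_rho2.
    + by move=> z _; rewrite lee_fin rho_ge0.
    + by rewrite lee_fin.
  - exact/measurable_EFinP.
  - by move=> w; rewrite lee_fin mulr_ge0// rho_ge0.
split; last by rewrite /Rintegral E.
apply/integrableP; split; first exact/measurable_EFinP.
rewrite integral_abs_ge0 ?E ?ltry// => w.
by rewrite mulr_ge0// rho_ge0.
Qed.

Lemma mu2_int2 n h : intb h -> (forall x, 0 <= h x) ->
  intb2 (fun w => h w.2 * rho n w.1 w.2) /\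
  \int[mu2]_w (h w.2 * rho n w.1 w.2) = \int[mu]_x h x.
Proof.
move=> ih h0; have mh := intb_meas ih.
have mF : measurable_fun setT (fun w : X * X => h w.2 * rho n w.1 w.2).
  apply: measurable_funM; last exact: measurable_rho.
  exact: (measurableT_comp mh measurable_snd).
have E : (\int[mu2]_w (h w.2 * rho n w.1 w.2)%:E = (\int[mu]_x h x)%:E)%E.
  rewrite (fubini_tonelli2 (fun w : X * X => (h w.2 * rho n w.1 w.2)%:E)).
  - rewrite -Rint_EFin//; apply: eq_integral => x _; rewrite /fubini_G /=.
    under eq_integral do rewrite EFinM rho_sym.
    rewrite ge0_integralZl//=.
    + by rewrite int_rho mule1.
    + by apply/measurable_EFinP; exact: measurable_rho2.
    + by move=> z _; rewrite lee_fin rho_ge0.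
    + by rewrite lee_fin.
  - exact/measurable_EFinP.
  - by move=> w; rewrite lee_fin mulr_ge0// rho_ge0.
split; last by rewrite /Rintegral E.
apply/integrableP; split; first exact/measurable_EFinP.
rewrite integral_abs_ge0 ?E ?ltry// => w.
by rewrite mulr_ge0// rho_ge0.
Qed.

(* Mean oscillation of [f] at the scale of [rho n]; it controls the L^p distance
   from [f] to its average against [rho n]. *)
Definition osc p n f : R := \int[mu2]_w (`|f w.1 - f w.2| `^ p * rho n w.1 w.2).

Lemma osc_ge0 p n f : 0 <= osc p n f.
Proof. by apply: Rint_ge0 => w; rewrite mulr_ge0 ?powR_ge0 ?rho_ge0. Qed.

Lemma measurable_diff p f : measurable_fun setT f ->
  measurable_fun setT (fun w : X * X => `|f w.1 - f w.2| `^ p).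
Proof.
move=> mf; apply: measurable_powR_abs; apply: measurable_funB.
  exact: (measurableT_comp mf measurable_fst).
exact: (measurableT_comp mf measurable_snd).
Qed.

Lemma osc_bound p n f : 0 <= p -> Lpow mu p f ->
  intb2 (fun w => `|f w.1 - f w.2| `^ p * rho n w.1 w.2) /\
  osc p n f <= 2 `^ p * 2 * \int[mu]_x (`|f x| `^ p).
Proof.
move=> p0 [mf lf].
have [i1 e1] := mu2_int1 n lf (fun x => powR_ge0 _ _).
have [i2 e2] := mu2_int2 n lf (fun x => powR_ge0 _ _).
have le w : `|f w.1 - f w.2| `^ p * rho n w.1 w.2 <= 2 `^ p *
    (`|f w.1| `^ p * rho n w.1 w.2 + `|f w.2| `^ p * rho n w.1 w.2).
  rewrite -mulrDl mulrA ler_wpM2r ?rho_ge0//.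
  by rewrite -(normrN (f w.2)); exact: powR_normD_le.
have ib : intb2 (fun w => `|f w.1 - f w.2| `^ p * rho n w.1 w.2).
  apply: (intb_le _ _ (intbZ (2 `^ p) (intbD i1 i2))).
    by apply: measurable_funM; [exact: measurable_diff|exact: measurable_rho].
  by move=> w; rewrite ger0_norm ?le// mulr_ge0 ?powR_ge0 ?rho_ge0.
split => //; apply: (le_trans (Rint_le ib (intbZ (2 `^ p) (intbD i1 i2)) le)).
by rewrite RintZ ?RintD ?e1 ?e2//; [lra|exact: intbD].
Qed.

Lemma osc_lin p n c f g : 0 <= p -> Lpow mu p f -> Lpow mu p g ->
  osc p n (fun x => c * f x + g x) <=
  2 `^ p * (`|c| `^ p * osc p n f + osc p n g).
Proof.
move=> p0 Lf Lg.
have [i1 _] := osc_bound n p0 Lf; have [i2 _] := osc_bound n p0 Lg.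
have [i3 _] := osc_bound n p0 (LpowD p0 (LpowZ c Lf) Lg).
have i4 := intbZ (`|c| `^ p) i1.
rewrite /osc -RintZ// -RintD// -RintZ; last exact: intbD.
apply: Rint_le => //; first by apply: intbZ; exact: intbD.
move=> w; rewrite mulrA -mulrDl mulrA ler_wpM2r ?rho_ge0//.
rewrite -powRM// -normrM.
rewrite (_ : _ - _ = c * (f w.1 - f w.2) + (g w.1 - g w.2)); last by ring.
exact: powR_normD_le.
Qed.

Definition osc_vanishes p f := osc p n f @[n --> \oo] --> 0.

Lemma osc_vanishes_lin p c f g : 0 <= p -> Lpow mu p f -> Lpow mu p g ->
  osc_vanishes p f -> osc_vanishes p g ->
  osc_vanishes p (fun x => c * f x + g x).
Proof.
move=> p0 Lf Lg vf vg.
have H : 2 `^ p * (`|c| `^ p * osc p n f + osc p n g) @[n --> \oo] --> 0.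
  rewrite -(mulr0 (2 `^ p)); apply: cvgMr; rewrite -(addr0 0).
  have v0 : `|c| `^ p * osc p n f @[n --> \oo] --> 0.
    by rewrite -(mulr0 (`|c| `^ p)); exact: cvgMr vf.
  exact: cvgD v0 vg.
apply: (squeeze_cvgr _ (cvg_cst 0) H); apply: nearW => n.
by rewrite osc_ge0 osc_lin.
Qed.

Lemma osc_vanishes_lim p f : 0 <= p -> Lpow mu p f ->
  (forall e, 0 < e -> exists g, [/\ Lpow mu p g, osc_vanishes p g &
       \int[mu]_x (`|f x - g x| `^ p) <= e]) -> osc_vanishes p f.
Proof.
move=> p0 Lf H; apply/cvgrPdist_le => e e0.
pose K : R := 2 `^ p; have K0 : 0 < K by rewrite powR_gt0.
(* The approximation error passes through [osc_bound], which costs [K * 2], and [osc_lin], which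
   costs [K]; with this denominator each of the two contributions is [e / 2]. *)
have e1 : 0 < e / (2 * (K * (K * 2))) by rewrite divr_gt0 ?mulr_gt0.
have e2 : 0 < e / (2 * K) by rewrite divr_gt0 ?mulr_gt0.
have [g [Lg vg fg]] := H _ e1.
have vg' : osc p n g @[n --> \oo] --> 0 := vg.
move: e2 => /(@cvgr_distC_le _ _ _ _ _ _ _ vg'); apply: filterS => n /=.
rewrite subr0 sub0r normrN !ger0_norm ?osc_ge0// => Hn.
have -> : f = (fun x => 1 * (f x - g x) + g x).
  by apply/funext => x; rewrite mul1r subrK.
apply: (le_trans (osc_lin _ _ p0 (LpowB p0 Lf Lg) Lg)).
rewrite normr1 powR1 mul1r -/K.
have [_ b] := osc_bound n p0 (LpowB p0 Lf Lg).
have {}b : osc p n (fun x => f x - g x) <= e / (2 * K).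
  apply: (le_trans b); apply: (@le_trans _ _ (K * 2 * (e / (2 * (K * (K * 2)))))).
    by apply: ler_wpM2l => //; rewrite mulr_ge0// ltW.
  rewrite le_eqVlt; apply/orP; left; apply/eqP; field.
  by rewrite gt_eqF.
have : K * (osc p n (fun x => f x - g x) + osc p n g) <= K * (e / (2 * K) + e / (2 * K)).
  exact: (ler_wpM2l (ltW K0) (lerD b Hn)).
move=> /le_trans; apply; rewrite le_eqVlt; apply/orP; left; apply/eqP; field.
by rewrite gt_eqF.
Qed.

End averaging.

(** * Approximation by the kernels *)

Section oscillation.
Context {R : realType}.

Lemma period1_int (Y : Type) (f : R -> Y) (u : R) (k : int) :
  (forall u, f (u + 1) = f u) -> f (u + k%:~R) = f u.
Proof.
move=> f1.
have Hn m w : f (w + m%:R) = f w.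
  elim: m w => [|m IH] w; first by rewrite addr0.
  by rewrite -natr1 addrA f1.
case: k => m; first exact: Hn.
by rewrite NegzE mulrNz -[LHS](Hn m.+1) -pmulrn subrK.
Qed.

Lemma maxr_lip (x y z : R) : `|Num.max x y - Num.max x z| <= `|y - z|.
Proof.
case: (leP x y) => h1; case: (leP x z) => h2; rewrite ler_norml;
  case: (ger0P (y - z)) => h3; lra.
Qed.

Lemma minr_lip (x y z : R) : `|Num.min x y - Num.min x z| <= `|y - z|.
Proof.
case: (leP x y) => h1; case: (leP x z) => h2; rewrite ler_norml;
  case: (ger0P (y - z)) => h3; lra.
Qed.

(** Trapezoid of slope [k] on the unit interval. As [k] grows it tends to the indicator of the part
    of []0, 1[] above [c]; vanishing at both ends makes it Lipschitz on the circle too. *)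
Definition tent (k : nat) (c a : R) : R :=
  Num.max 0 (Num.min 1 (k%:R * Num.min (a - Num.max c 0) (1 - a))).

Lemma tent01 k c a : 0 <= tent k c a <= 1.
Proof.
rewrite /tent le_max lexx /= ge_max ler01 /= ge_min lexx//.
Qed.

Lemma tent_le k c a : 0 <= a <= 1 ->
  tent k c a <= k%:R * a /\ tent k c a <= k%:R * (1 - a).
Proof.
move=> /andP[a0 a1]; have k0 : 0 <= k%:R :> R by [].
have m0 : 0 <= Num.max c 0 by rewrite le_max lexx orbT.
have b1 : 0 <= 1 - a by rewrite subr_ge0.
split; rewrite /tent ge_max mulr_ge0//= ge_min; apply/orP; right;
  rewrite ler_wpM2l// ge_min; apply/orP; [left|right] => //; lra.
Qed.

(** For [b <= a] two routes join the points on the circle: the direct one, of length [a - b], and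
    the one through the endpoints, where [tent] vanishes, of length [1 - (a - b)]. The shorter is at
    most 1/2, so [halfcos_lower] applies. *)
Lemma tent_lip k c a b : 0 <= a <= 1 -> 0 <= b <= 1 ->
  (tent k c a - tent k c b) ^+ 2 <= k%:R ^+ 2 * (1 - halfcos (a - b)).
Proof.
wlog ba : a b / b <= a.
  move=> H a01 b01; case: (leP b a) => ba; first exact: H.
  have := H _ _ (ltW ba) b01 a01.
  rewrite (_ : halfcos (a - b) = halfcos (b - a)); last first.
    by rewrite /halfcos /pcos -opprB mulrN cosN.
  by rewrite -[X in X ^+ 2 <= _]opprB sqrrN.
move=> a01 b01; have k0 : 0 <= k%:R :> R by [].
have [ta1 ta2] := tent_le k c a01; have [tb1 tb2] := tent_le k c b01.
have /andP[ta0 _] := tent01 k c a; have /andP[tb0 _] := tent01 k c b.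
have L1 : `|tent k c a - tent k c b| <= k%:R * (a - b).
  apply: (le_trans (maxr_lip _ _ _)); apply: (le_trans (minr_lip _ _ _)).
  rewrite -mulrBr normrM (ger0_norm k0) ler_wpM2l//.
  set m := Num.max c 0; rewrite ler_norml.
  case: (leP (a - m) (1 - a)) => h1; case: (leP (b - m) (1 - b)) => h2; lra.
have L2 : `|tent k c a - tent k c b| <= k%:R * (1 - (a - b)).
  have h : 0 <= k%:R * b by rewrite mulr_ge0//; lra.
  have h' : 0 <= k%:R * (1 - a) by rewrite mulr_ge0//; lra.
  rewrite ler_norml; apply/andP; split; lra.
have sq x : 0 <= x -> `|tent k c a - tent k c b| <= k%:R * x ->
    (tent k c a - tent k c b) ^+ 2 <= k%:R ^+ 2 * x ^+ 2.
  move=> x0 h; rewrite -exprMn -real_normK ?num_real//.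
  by rewrite ler_pXn2r ?nnegrE ?mulr_ge0.
have k2 : 0 <= k%:R ^+ 2 :> R by exact: sqr_ge0.
have [h|h] := leP (a - b) 2^-1.
  apply: (le_trans (sq _ _ L1)); first lra.
  by rewrite ler_wpM2l// halfcos_lower// ger0_norm; lra.
apply: (le_trans (sq _ _ L2)); first lra.
rewrite ler_wpM2l// -(sqrrN (1 - _)) opprB.
have -> : halfcos (a - b) = halfcos (a - b - 1).
  by rewrite -{1}(subrK 1 (a - b)) /halfcos pcosD1.
apply: halfcos_lower; rewrite ler_norml; lra.
Qed.

End oscillation.

(** * Vanishing of the mean oscillation *)

Section vanishing.
Context {R : realType} {d : nat}.
Local Notation X := 'rV[R]_d.
Local Notation mu := (@cube R d).
Local Notation mu2 := (mu \x mu)%E.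
Local Notation fr t := (t - (Num.floor t)%:~R : R).
Implicit Types (f g : X -> R) (p c e : R).

Let tent_i k c (i : 'I_d) (x : X) : R := tent k c (fr (x 0 i)).

Let measurable_fr : measurable_fun setT (fun t : R => fr t).
Proof.
apply: measurable_funB => //; apply: nondecreasing_measurable => // s t st.
by rewrite ler_int le_floor.
Qed.

Let measurable_tent k c i : measurable_fun setT (tent_i k c i).
Proof.
have mfr : measurable_fun setT (fun x : X => fr (x 0 i)).
  exact: (measurableT_comp measurable_fr (measurable_coord i)).
apply: measurable_maxr => //; apply: measurable_minr => //.
apply: measurable_funM => //; apply: measurable_minr; exact: measurable_funB.
Qed.

Let Lpow_tent p k c i : 0 <= p -> Lpow mu p (tent_i k c i).
Proof.
move=> p0; apply: (@Lpow_bdd _ _ _ _ _ _ 1) => // x.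
by have /andP[? ?] := tent01 k c (fr (x 0 i)); rewrite ger0_norm.
Qed.

(** The squared increment is at most [k ^ 2 * (1 - halfcos)], and the average of the latter against
    [rho n] is the kernel moment, which tends to 0. The exponent 2 comes from this quadratic
    bound. *)
Let tent_vanishes k c i : osc_vanishes 2 (tent_i k c i).
Proof.
have H : k%:R ^+ 2 * (2 * n%:R + 2)^-1 @[n --> \oo] --> (0 : R).
  rewrite -(mulr0 (k%:R ^+ 2)); apply: cvgMr.
  apply: (@squeeze_cvgr _ _ _ _ (cst 0) (fun n : nat => n.+1%:R^-1)).
  - apply: nearW => n /=; rewrite invr_ge0 addr_ge0 ?mulr_ge0//=.
    by rewrite lef_pV2 ?posrE ?ltr_wpDl ?mulr_ge0// -natr1; have := ler0n R n; lra.
  - exact: cvg_cst.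
  - exact: cvg_harmonic.
apply: (squeeze_cvgr _ (cvg_cst 0) H); apply: nearW => n.
rewrite osc_ge0/=.
have mh : measurable_fun setT (fun w : X * X => 1 - halfcos (w.1 0 i - w.2 0 i)).
  apply: measurable_funB => //; apply: (measurableT_comp (f := @halfcos R)).
    by apply: continuous_measurable_fun; exact: continuous_halfcos.
  by apply: measurable_funB; [exact: measurable_coord1|exact: measurable_coord2].
have h01 t : 0 <= 1 - halfcos t :> R by have := halfcos01 t; lra.
have mF : measurable_fun setT (fun w : X * X =>
    (1 - halfcos (w.1 0 i - w.2 0 i)) * rho n w.1 w.2).
  by apply: measurable_funM => //; exact: measurable_rho.
have E : (\int[mu2]_w ((1 - halfcos (w.1 0 i - w.2 0 i)) * rho n w.1 w.2)%:E
    = ((2 * n%:R + 2)^-1)%:E)%E.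
  rewrite (fubini_tonelli1 (fun w : X * X =>
    ((1 - halfcos (w.1 0 i - w.2 0 i)) * rho n w.1 w.2)%:E)).
  - rewrite /fubini_F /=.
    under eq_integral do rewrite int_rho_moment.
    rewrite (eq_integral (cst ((2 * n%:R + 2)^-1)%:E))//.
    by rewrite integral_cst// -[RHS]mule1; congr (_ * _)%E; exact: probability_setT.
  - exact/measurable_EFinP.
  - by move=> w; rewrite lee_fin mulr_ge0 ?rho_ge0 ?h01.
have iF : mu2.-integrable setT (EFin \o (fun w : X * X =>
    (1 - halfcos (w.1 0 i - w.2 0 i)) * rho n w.1 w.2)).
  apply/integrableP; split; first exact/measurable_EFinP.
  rewrite integral_abs_ge0 ?E ?ltry// => w.
  by rewrite mulr_ge0 ?rho_ge0 ?h01.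
have EF : \int[mu2]_w ((1 - halfcos (w.1 0 i - w.2 0 i)) * rho n w.1 w.2)
    = (2 * n%:R + 2)^-1 by rewrite /Rintegral E.
rewrite -EF -RintZ//.
have [io _] := osc_bound n (ler0n _ 2) (Lpow_tent k c i (ler0n _ 2)).
apply: Rint_le => //; first exact: intbZ.
move=> w; rewrite mulrA ler_wpM2r ?rho_ge0//.
rewrite powR_mulrn// real_normK ?num_real// /tent_i.
have frE t : 0 <= fr t <= 1.
  by have := floor_itv t; rewrite intrD; lra.
apply: (le_trans (tent_lip k c (frE _) (frE _))); rewrite ler_wpM2l ?sqr_ge0//.
rewrite le_eqVlt; apply/orP; left; apply/eqP; congr (1 - _).
(* Taking fractional parts changes the difference by an integer, which [halfcos] does not see. *)
rewrite (_ : _ - _ - _ = w.1 0 i - w.2 0 i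
  + (Num.floor (w.2 0 i) - Num.floor (w.1 0 i))%:~R); last first.
  by rewrite intrD intrN; ring.
by apply: period1_int => u; rewrite /halfcos pcosD1.
Qed.

(** These sets form a sigma-algebra: complements by linearity, intersections by a pointwise
    comparison of indicators, countable unions by bounded convergence. *)
Let good (A : set X) := measurable A /\ osc_vanishes 2 (\1_A : X -> R).

Let p20 : (0 : R) <= 2 := ler0n _ 2.

Let L2I A : measurable A -> Lpow mu 2 (\1_A : X -> R).
Proof. by move=> mA; exact: Lpow_indic. Qed.

Let osc_vanishes_ext p f g : f =1 g -> osc_vanishes p f -> osc_vanishes p g.
Proof. by move=> /funext ->. Qed.

Let good0 : good set0.
Proof.
split; first by []; rewrite indic0 /osc_vanishes.
rewrite (_ : (fun _ => _) = cst 0); first exact: cvg_cst.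
apply/funext => n; rewrite /osc -(Rint_zero mu2); apply: eq_Rintegral => w _ /=.
by rewrite subrr normr0 powR0 ?mul0r// gt_eqF.
Qed.

Let cst_vanishes c : osc_vanishes 2 (cst c : X -> R).
Proof.
rewrite /osc_vanishes (_ : (fun _ => _) = cst 0); first exact: cvg_cst.
apply/funext => n; rewrite /osc -(Rint_zero mu2); apply: eq_Rintegral => w _ /=.
by rewrite subrr normr0 powR0 ?mul0r// gt_eqF.
Qed.

Let L2cst c : Lpow mu 2 (cst c : X -> R).
Proof. exact: (@Lpow_bdd _ _ _ _ _ _ `|c|). Qed.

Let goodC A : good A -> good (~` A).
Proof.
move=> [mA vA]; split; first exact: measurableC.
apply: (@osc_vanishes_ext _ (fun x => -1 * \1_A x + cst 1 x)).
  move=> x; rewrite !indicE in_setC; case: (x \in A) => /=; ring.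
exact: (osc_vanishes_lin _ p20 (L2I mA) (L2cst 1) vA (cst_vanishes 1)).
Qed.

Let goodI A B : good A -> good B -> good (A `&` B).
Proof.
move=> [mA vA] [mB vB]; have mAB := measurableI _ _ mA mB; split; first by [].
have H : osc 2 n (\1_A : X -> R) + osc 2 n (\1_B : X -> R) @[n --> \oo] --> (0 : R).
  rewrite -[X in _ --> X]addr0.
  exact: (@cvgD _ _ _ \oo _ (fun n => osc 2 n \1_A) (fun n => osc 2 n \1_B) _ _ vA vB).
apply: (squeeze_cvgr _ (cvg_cst 0) H); apply: nearW => n.
have [iA _] := osc_bound n p20 (L2I mA).
have [iB _] := osc_bound n p20 (L2I mB).
have [iAB _] := osc_bound n p20 (L2I mAB).
rewrite osc_ge0/= /osc -RintD//; apply: Rint_le => //; first exact: intbD.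
move=> w; rewrite -mulrDl ler_wpM2r ?rho_ge0// !indicI /= !indicE !powR_mulrn//.
rewrite !real_normK ?num_real//.
by case: (w.1 \in A); case: (w.1 \in B); case: (w.2 \in A); case: (w.2 \in B);
  rewrite /= ?mulr1n ?mulr0n; lra.
Qed.

Let goodU A B : good A -> good B -> good (A `|` B).
Proof.
move=> gA gB; rewrite -(setCK (A `|` B)) setCU.
exact: (goodC (goodI (goodC gA) (goodC gB))).
Qed.

Let good_lim A (f_ : nat -> X -> R) : measurable A ->
  (forall n, Lpow mu 2 (f_ n)) -> (forall n, osc_vanishes 2 (f_ n)) ->
  (forall n x, 0 <= f_ n x <= 1) ->
  {ae mu, forall x : X, f_ n x @[n --> \oo] --> (\1_A x : R)} -> good A.
Proof.
move=> mA Lf vf f01 fA; split; first by [].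
 apply: (osc_vanishes_lim p20 (L2I mA)) => e e0.
have [|||||_ H] := @Rint_dct _ _ _ mu
    (fun n x => `|\1_A x - f_ n x| `^ 2) (cst 0) (cst 1) => //.
- by move=> n; apply: measurable_powR_abs; apply: measurable_funB => //; case: (Lf n).
- apply: filterS fA => x fx; apply: cvg_powR0 => //.
  rewrite -(normr0 R) -(subrr (\1_A x : R)); apply: cvg_norm.
  by apply: cvgB => //; exact: cvg_cst.
- exact: finite_measure_integrable_cst.
- move=> n x; rewrite ger0_norm ?powR_ge0// powR_mulrn//.
  have /andP[? ?] := f01 n x; rewrite exprn_ile1// ler_norml indicE.
  by case: (_ \in _) => /=; lra.
move: H; rewrite Rint_cst => H.
have [n _ /(_ n (leqnn n)) /= Hn] := @cvgr_distC_le _ _ _ _ _ _ _ H _ e0.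
exists (f_ n); split; [exact: Lf|exact: vf|].
by move: Hn; rewrite subr0; apply: le_trans; exact: ler_norm.
Qed.

Let good_bigcup (F : (set X)^nat) : (forall n, good (F n)) -> good (\bigcup_n F n).
Proof.
move=> gF.
have gS n : good (\big[setU/set0]_(i < n) F i).
  elim: n => [|n IH]; first by rewrite big_ord0.
  by rewrite big_ord_recr; exact: (goodU IH (gF n)).
apply: (@good_lim _ (fun n => \1_(\big[setU/set0]_(i < n) F i))).
- by apply: bigcupT_measurable => n; case: (gF n).
- by move=> n; apply: L2I; case: (gS n).
- by move=> n; case: (gS n).
- by move=> n x; rewrite indicE; case: (_ \in _); rewrite ?lexx ?ler01.
- apply: aeW => x; have [[k _ Fk]|Fx] := pselect ((\bigcup_n F n) x).
    apply: cvg_near_cst; exists k.+1 => // n /= kn.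
    rewrite !indicE !mem_set//; first by exists k.
    by rewrite -bigcup_mkord; exists k.
  apply: cvg_near_cst; apply: nearW => n; rewrite !indicE !memNset//.
  by rewrite -bigcup_mkord => -[k _ Fk]; apply: Fx; exists k.
Qed.

Let good_ray (i : 'I_d) c : good [set x : X | c < x 0 i].
Proof.
apply: (@good_lim _ (fun k => tent_i k c i)).
- rewrite (_ : mkset _ = (fun x : X => x 0 i) @^-1` [set` `]c, +oo[]).
    by rewrite -[X in measurable X]setTI; exact: measurable_coord.
  by apply/seteqP; split => x /=; rewrite in_itv/= andbT.
- by move=> n; exact: Lpow_tent.
- by move=> n; exact: tent_vanishes.
- by move=> n x; exact: tent01.
(* Almost every point lies in the open cube, where the fractional part in [tent_i] is the coordinate
   itself. *)
apply: filterS (@cube_ae01 R d) => x /(_ i) x01.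
rewrite /tent_i (_ : Num.floor (x 0 i) = 0) ?subr0; last first.
  by apply/floor_def; rewrite add0r; have /andP[/ltW -> ->] := x01.
move: x01; set t := x 0 i => /andP[t0 t1].
rewrite indicE; have [ct|ct] := ltP c t; last first.
  rewrite memNset/=; last by rewrite -/t ltNge ct.
  apply: cvg_near_cst; apply: nearW => k; rewrite /tent max_l//.
  rewrite ge_min; apply/orP; right; rewrite mulr_ge0_le0// ge_min; apply/orP; left.
  by rewrite subr_le0 le_max ct.
rewrite mem_set//.
have h0 : 0 < Num.min (t - Num.max c 0) (1 - t).
  by rewrite lt_min !subr_gt0 gt_max ct t0 t1.
set h := Num.min _ _ in h0.
(* From this index on [k * h >= 1], so [tent] has reached its plateau. *)
apply: cvg_near_cst; exists (Num.truncn h^-1).+1 => // k /= kn.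
rewrite /tent -/h min_l ?max_r//.
rewrite -ler_pdivrMr// div1r (le_trans (ltW (truncnS_gt _)))// ler_nat//.
Qed.

Lemma good_measurable A : measurable A -> osc_vanishes 2 (\1_A : X -> R).
Proof.
suff: (@measurable _ X) `<=` good by move=> H /H[].
apply: smallest_sub.
  split; first exact: good0.
    by move=> B gB; rewrite setTD; exact: goodC.
  exact: good_bigcup.
rewrite -bigcup_seq; apply: bigcup_sub => i _ => _ [B mB <-]; rewrite setTI.
move: B mB; suff: (@measurable _ (measurableTypeR R)) `<=`
  [set B | good (@row_coord R d i @^-1` B)] by [].
have -> : @measurable _ (measurableTypeR R) = <<s RGenOInfty.G (R:=R) >>.
  exact: RGenOInfty.measurableE.
apply: smallest_sub; first split.
- by rewrite /= preimage_set0; exact: good0.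
- by move=> B gB; rewrite setTD/= preimage_setC; exact: goodC.
- by move=> F gF; rewrite /= preimage_bigcup; exact: good_bigcup.
- move=> _ [c ->] /=; have := good_ray i c; congr good.
  by apply/seteqP; split => x /=; rewrite in_itv/= andbT.
Qed.

(** Increments of an indicator are 0 or 1 in absolute value, so its oscillation is the same for the
    exponents [p] and 2; density then reaches all of L^p. *)
Theorem oscillation_vanishes p f : 1 <= p -> Lpow mu p f -> osc_vanishes p f.
Proof.
move=> p1; have p0 : 0 <= p by rewrite (le_trans _ p1).
apply: (Lpow_ind p1).
- by move=> A mA; exact: Lpow_indic.
- move=> A mA; have E : (fun n => osc p n \1_A) = (fun n => osc 2 n (\1_A : X -> R)).
    apply/funext => n; apply: eq_Rintegral => w _; congr (_ * _).
    have p0' : p != 0 by rewrite gt_eqF// (lt_le_trans _ p1).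
    have q0 : 2 != 0 :> R by rewrite gt_eqF.
    rewrite !indicE; case: (_ \in _); case: (_ \in _) => /=;
      by rewrite ?subrr ?subr0 ?sub0r ?normrN ?normr0 ?normr1 ?powR1 ?powR0.
  by rewrite /osc_vanishes E; exact: (good_measurable mA).
- by move=> c g h Lg Lh vg vh; exact: (osc_vanishes_lin c p0 Lg Lh vg vh).
- by move=> g Lg H; exact: (osc_vanishes_lim p0 Lg H).
Qed.

End vanishing.

(** * Continuous and smooth functions *)

Section continuous_measurable.
Context {R : realType} {dd : measure_display} {T : measurableType dd}.

(* The coordinates [c] are only required to refine the topology of [Y]. *)
Definition coord_system (Y : topologicalType) (J : finType) (c : J -> Y -> R) :=
  forall O : set Y, open O -> forall y, O y ->
    exists2 e : R, 0 < e & forall y', (forall j, `|c j y' - c j y| < e) -> O y'.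

(** Measurability is known for coordinates only. An open set is recovered as the countable union of
    the boxes with rational centre and radius [1 / (k + 1)] that it contains. *)
Lemma measurable_open_preimage (Y : topologicalType) (J : finType)
    (c : J -> Y -> R) (f : T -> Y) :
  coord_system c -> (forall j, measurable_fun setT (c j \o f)) ->
  forall O : set Y, open O -> measurable (f @^-1` O).
Proof.
move=> cs mf O oO.
pose box (p : {ffun J -> rat} * nat) : set Y :=
  [set y | forall j, `|c j y - ratr (p.1 j)| < p.2.+1%:R^-1].
have mbox p : measurable (f @^-1` box p).
  have -> : f @^-1` box p = \bigcap_(j in [set` [set: J]%SET])
      ((c j \o f) @^-1` (ball (ratr (p.1 j) : R) p.2.+1%:R^-1)).
    apply/seteqP; split=> t /= H j.
      by move=> _; rewrite /ball/= distrC; exact: H.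
    by have := H j; rewrite /ball/= inE distrC => /(_ isT).
  apply: fin_bigcap_measurable => [|j _]; first exact: finite_finset.
  rewrite -[X in measurable X]setTI; apply: mf => //.
  by apply: measurable_ball.
have -> : f @^-1` O = \bigcup_(p in [set p | box p `<=` O]) (f @^-1` box p).
  apply/seteqP; split=> t /=; last by move=> [p /= pO tp]; exact: pO.
  move=> Ot; have [e e0 He] := cs O oO _ Ot.
  (* A box of radius [1 / (k + 1)] whose centre is that close to [f t] has all its points within
     [2 / (k + 1) < e] of [f t]. *)
  pose k := Num.truncn (2 / e).
  have k2 : 2 * k.+1%:R^-1 < e.
    by rewrite ltr_pdivrMr// mulrC -ltr_pdivrMr//; exact: truncnS_gt.
  have k0 : 0 < k.+1%:R^-1 :> R by rewrite invr_gt0.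
  have Hq j : exists q : rat, `|c j (f t) - ratr q| < k.+1%:R^-1.
    have lt12 : c j (f t) - k.+1%:R^-1 < c j (f t) + k.+1%:R^-1.
      by move: k0; set b := _^-1; lra.
    have [q] := rat_in_itvoo lt12.
    rewrite in_itv/= => q12; exists q; move: q12; set b := _^-1 => /andP[? ?].
    by rewrite ltr_norml; lra.
  pose q := [ffun j => projT1 (cid (Hq j))].
  have qP j : `|c j (f t) - ratr (q j)| < k.+1%:R^-1.
    by rewrite ffunE; exact: projT2 (cid (Hq j)).
  exists (q, k) => //= y Hy; apply: He => j.
  have := Hy j; have := qP j; rewrite /=; move: k2; set b := _^-1.
  rewrite !ltr_norml; lra.
rewrite bigcup_mkcond; apply: countable_bigcupT_measurable => // p.
by case: ifP.
Qed.

(** [F] is continuous relative to an arbitrary set [S]: this covers Hamiltonians and couplings that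
    are constrained only for [m] in [E]. *)
Lemma measurable_continuous_comp (Y : topologicalType) (J : finType)
    (c : J -> Y -> R) (S : set Y) (F : Y -> R) (f : T -> Y) :
  coord_system c -> (forall j, measurable_fun setT (c j \o f)) ->
  (forall t, S (f t)) ->
  (forall y, S y -> forall e, 0 < e -> exists O : set Y, [/\ open O, O y &
     forall y', O y' -> S y' -> `|F y' - F y| < e]) ->
  measurable_fun setT (F \o f).
Proof.
move=> cs mf Sf cF.
apply: (measurability (@RGenOInfty.G R)) => [|/= _ [_] [r] -> <-].
  exact: RGenOInfty.measurableE.
(* [O] is open in the whole space although [F] is controlled on [S] only; since [f] stays in [S],
   its preimage is that of [F > r]. *)
pose O := [set y | exists P : set Y, [/\ open P, P y &
  forall y', P y' -> S y' -> r < F y']].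
have oO : open O.
  rewrite openE => y /= [P [oP Py HP]].
  have : nbhs y P by exact: open_nbhs_nbhs.
  by apply: filterS => y' Py'; exists P.
rewrite setTI (_ : _ @^-1` _ = f @^-1` O); first exact: (measurable_open_preimage cs mf).
apply/seteqP; split=> t /=; rewrite in_itv/= andbT.
  move=> rt; have e0 : 0 < F (f t) - r by rewrite subr_gt0.
  have [P [oP Pt HP]] := cF _ (Sf t) _ e0; exists P; split => // y Py Sy.
  by have := HP y Py Sy; rewrite ltr_norml; lra.
by move=> [P [_ Pt HP]]; exact: HP.
Qed.

End continuous_measurable.

(** * Smooth functions on a normed space *)

Section smooth_functions.
Context {R : realType}.

Lemma Ck_on_eq (V : normedModType R) k (U : set V) (f g : V -> R) : open U ->
  (forall x, U x -> f x = g x) -> Ck_on k U f -> Ck_on k U g.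
Proof.
move=> oU; elim: k f g => [|k IH] f g fg /= [cf H];
  have cg x : U x -> {for x, continuous g}.
- move=> Ux; have := cf x Ux; rewrite /prop_for /continuous_at (fg x Ux).
  apply: cvg_trans; apply: near_eq_cvg.
  by apply: filterS (open_nbhs_nbhs (conj oU Ux)) => y /fg.
- by split.
- move=> Ux; have := cf x Ux; rewrite /prop_for /continuous_at (fg x Ux).
  apply: cvg_trans; apply: near_eq_cvg.
  by apply: filterS (open_nbhs_nbhs (conj oU Ux)) => y /fg.
split => //.
- move=> v; have [df Cf] := H v.
  have nfg x : U x -> \near x, f x = g x.
    by move=> Ux; apply: filterS (open_nbhs_nbhs (conj oU Ux)) => y /fg.
  split; first by move=> x Ux; apply: near_eq_derivable (df x Ux); exact: nfg.
  by apply: IH Cf => x Ux; apply: near_eq_derive; exact: nfg.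
Qed.

Lemma Ck_on_glue (V : normedModType R) k (f : V -> R) :
  (forall x, exists U, [/\ open U, U x & Ck_on k U f]) -> Ck_on k setT f.
Proof.
elim: k f => [|k IH] f H /=; split => //.
- by move=> x _; have [U [_ Ux [cf _]]] := H x; exact: cf.
- by move=> x _; have [U [_ Ux [cf _]]] := H x; exact: cf.
- move=> v; split.
    by move=> x _; have [U [_ Ux /= [_ /(_ v) [df _]]]] := H x; exact: df.
  by apply: IH => x; have [U [oU Ux /= [_ /(_ v) [_ Cf]]]] := H x; exists U.
Qed.

Definition smooth (V : normedModType R) (f : V -> R) := forall k, Ck_on k setT f.

(** Near each point [f] coincides with a smooth local extension; derivatives depend on germs only,
    so the local statements glue. *)
Lemma smooth_onT (V : normedModType R) (f : V -> R) :
  smooth_on setT f <-> smooth f.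
Proof.
split=> [H k|sf x _].
  apply: Ck_on_glue => x; have [U [F [oU Ux CF Ff]]] := H x I.
  exists U; split => //; apply: (Ck_on_eq oU _ (CF k)) => y Uy; exact: Ff.
by exists setT, f; split => //; exact: openT.
Qed.

Section ring_of_smooth.
Variable V : normedModType R.
Implicit Types f g : V -> R.

Lemma smooth_continuous f : smooth f -> continuous f.
Proof. by move=> /(_ 0%N) [cf _] x; exact: cf. Qed.

Lemma smooth_derivable f x v : smooth f -> derivable f x v.
Proof. by move=> /(_ 1%N) /= [_ /(_ v) [df _]]; exact: df. Qed.

Lemma smooth_derive f v : smooth f -> smooth ('D_v f).
Proof. by move=> sf k; have /= [_ /(_ v) []] := sf k.+1. Qed.

Lemma CkD k f g : Ck_on k setT f -> Ck_on k setT g ->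
  Ck_on k setT (fun x => f x + g x).
Proof.
elim: k f g => [|k IH] f g /= [cf Hf] [cg Hg]; split => //;
  try by move=> x _; apply: cvgD; [exact: cf|exact: cg].
move=> v; have [df Df] := Hf v; have [dg Dg] := Hg v; split.
  by move=> x _; apply: derivableD; [exact: df|exact: dg].
have -> : 'D_v (fun x => f x + g x) = (fun x => 'D_v f x + 'D_v g x).
  by apply/funext => x; apply: deriveD; [exact: df|exact: dg].
exact: IH.
Qed.

Lemma smoothD f g : smooth f -> smooth g -> smooth (fun x => f x + g x).
Proof. by move=> sf sg k; exact: CkD. Qed.

Lemma smooth_cst c : smooth (cst c : V -> R).
Proof.
move=> k; elim: k c => [|k IH] c /=; split => //; try by move=> x _; exact: cvg_cst.
move=> v; split; first by move=> x _; exact: derivable_cst.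
rewrite (_ : 'D_v _ = cst 0)//.
by apply/funext => x; exact: derive_cst.
Qed.

(** The induction on [k] keeps both factors smooth, since the product rule pairs each factor with
    the derivative of the other. *)
Lemma smoothM f g : smooth f -> smooth g -> smooth (fun x => f x * g x).
Proof.
move=> sf sg k; elim: k f g sf sg => [|k IH] f g sf sg /=; split => //;
  try by move=> x _; apply: cvgM; exact: smooth_continuous.
move=> v; have df x : derivable f x v by exact: smooth_derivable.
have dg x : derivable g x v by exact: smooth_derivable.
split; first by move=> x _; exact: derivableM.
have -> : 'D_v (fun x => f x * g x) =
    (fun x => f x * 'D_v g x + g x * 'D_v f x).
  by apply/funext => x; rewrite deriveM.
by apply: CkD; apply: IH => //; exact: smooth_derive.
Qed.

End ring_of_smooth.
End smooth_functions.

(** * Smooth periodic functions and finite-rank kernels *)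

Section torus_smooth.
Context {R : realType} {d : nat}.
Local Notation X := 'rV[R]_d.
Local Notation mu := (@cube R d).
Implicit Types (f g : X -> R) (x y z : X) (i j : 'I_d) (c e : R).

Lemma Cinf_smooth f : Cinf f <-> Zd_periodic f /\ smooth f.
Proof. by split=> -[pf sf]; split => //; move: sf => /smooth_onT. Qed.

Lemma Cinf_cst c : Cinf (cst c : X -> R).
Proof. by apply/Cinf_smooth; split => //; exact: smooth_cst. Qed.

Lemma CinfD f g : Cinf f -> Cinf g -> Cinf (fun x => f x + g x).
Proof.
move=> /Cinf_smooth[pf sf] /Cinf_smooth[pg sg]; apply/Cinf_smooth.
by split; [move=> x i; rewrite pf pg|exact: smoothD].
Qed.

Lemma CinfM f g : Cinf f -> Cinf g -> Cinf (fun x => f x * g x).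
Proof.
move=> /Cinf_smooth[pf sf] /Cinf_smooth[pg sg]; apply/Cinf_smooth.
by split; [move=> x i; rewrite pf pg|exact: smoothM].
Qed.

Lemma CinfZ c f : Cinf f -> Cinf (fun x => c * f x).
Proof. by move=> Cf; apply: CinfM => //; exact: Cinf_cst. Qed.

Lemma CinfX n f : Cinf f -> Cinf (fun x => f x ^+ n).
Proof.
move=> Cf; elim: n => [|n IH]; first exact: Cinf_cst.
rewrite (_ : (fun _ => _) = fun x => f x * f x ^+ n); first exact: CinfM.
by apply/funext => x; rewrite exprS.
Qed.

Lemma Cinf_sum I (s : seq I) (F : I -> X -> R) : (forall k, Cinf (F k)) ->
  Cinf (fun x => \sum_(k <- s) F k x).
Proof.
move=> CF; elim: s => [|k s IH].
  rewrite (_ : (fun _ => _) = cst 0); first exact: Cinf_cst.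
  by apply/funext => x; rewrite big_nil.
rewrite (_ : (fun _ => _) = fun x => F k x + \sum_(k <- s) F k x).
  exact: CinfD.
by apply/funext => x; rewrite big_cons.
Qed.

Lemma Cinf_prod I (s : seq I) (F : I -> X -> R) : (forall k, Cinf (F k)) ->
  Cinf (fun x => \prod_(k <- s) F k x).
Proof.
move=> CF; elim: s => [|k s IH].
  rewrite (_ : (fun _ => _) = cst 1); first exact: Cinf_cst.
  by apply/funext => x; rewrite big_nil.
rewrite (_ : (fun _ => _) = fun x => F k x * \prod_(k <- s) F k x).
  exact: CinfM.
by apply/funext => x; rewrite big_cons.
Qed.

Lemma Cinf_derivable f x v : Cinf f -> derivable f x v.
Proof. by move=> /Cinf_smooth[_ sf]; exact: smooth_derivable. Qed.

Lemma Cinf_continuous f : Cinf f -> continuous f.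
Proof. by move=> /Cinf_smooth[_ sf]; exact: smooth_continuous. Qed.

Lemma Cinf_pderiv f i : Cinf f -> Cinf (pderiv i f).
Proof.
move=> /Cinf_smooth[pf sf]; apply/Cinf_smooth; split; last exact: (smooth_derive (basis_vec i) sf).
move=> x j; rewrite /pderiv /derive.
rewrite (_ : (fun h => _) = (fun h : R =>
  h^-1 *: ((f \o shift x) (h *: basis_vec i) - f x)))//.
by apply/funext => h /=; rewrite pf addrA pf.
Qed.

Lemma coord_system_row : coord_system (fun (i : 'I_d) (x : X) => x 0 i).
Proof.
move=> O oO x Ox; have : nbhs x O by exact: open_nbhs_nbhs.
move=> /nbhs_ballP[e /= e0 He]; exists e => // y Hy; apply: He.
by split => // k i; rewrite (ord1 k) /ball/= distrC; exact: Hy.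
Qed.

Lemma continuous_measurable f : continuous f -> measurable_fun setT f.
Proof.
move=> cf; apply: (@measurable_continuous_comp _ _ _ _ _ _ setT f id
  coord_system_row) => //.
  by move=> i; exact: measurable_coord.
move=> x _ e e0; have /cvgrPdist_lt/(_ e e0) := cf x.
rewrite nearE nbhsE => -[P [oP Px] HP]; exists P; split => // y Py _.
by rewrite distrC; exact: HP.
Qed.

Lemma Cinf_measurable f : Cinf f -> measurable_fun setT f.
Proof. by move=> /Cinf_continuous; exact: continuous_measurable. Qed.

Lemma continuous_periodic_bounded f : Zd_periodic f -> continuous f ->
  exists2 B, 0 <= B & forall x, `|f x| <= B.
Proof.
move=> pf cf.
pose K := [set x : X | forall i, `[0, 1]%classic (x ord0 i)].
have cK : compact K.
  exact: (@rV_compact R d (fun=> `[0, 1]%classic) (fun i => @segment_compact _ 0 1)).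
have cfK : compact (f @` K).
  by apply: continuous_compact => //; exact: continuous_subspaceT.
have [M [_ HM]] := compact_bounded cfK.
exists (Num.max 0 (M + 1)) => [|x]; first by rewrite le_max lexx.
rewrite -(periodic_frac x pf) le_max; apply/orP; right.
apply: (HM (M + 1)); first by rewrite ltrDl.
exists (frac x) => // i; rewrite /frac mxE /= in_itv/=.
by have := floor_itv (x ord0 i); rewrite intrD; lra.
Qed.

Lemma Cinf_bounded f : Cinf f -> exists2 B, 0 <= B & forall x, `|f x| <= B.
Proof.
by move=> /[dup] /Cinf_continuous cf [pf _]; exact: continuous_periodic_bounded.
Qed.

Lemma is_derive_slice f x (v : X) (df : R) :
  is_derive (0 : R) 1 (fun h : R => f (h *: v + x)) df -> is_derive x v f df.
Proof.
move=> [d1 d2]; split; first exact/derivable1P.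
pose F (h : R) := f (h *: v + x).
have E : (fun h : R => h^-1 *: ((f \o shift x) (h *: v) - f x)) =
    (fun h : R => h^-1 *: ((F \o shift 0) (h *: (1 : R)) - F 0)).
  by apply/funext => h /=; rewrite /F scale0r add0r addr0 /GRing.scale/= mulr1.
by rewrite -d2 /derive E.
Qed.

(** Invariance under translation along the axis [i]: on each line in this direction such a factor is
    a constant, and differentiation reduces to one variable. *)
Definition indep i (psi : X -> R) :=
  forall x (h : R), psi (h *: basis_vec i + x) = psi x.

Lemma is_derive_coordM (phi : R -> R) dphi (psi : X -> R) x i : indep i psi ->
  is_derive (x 0 i) 1 phi dphi ->
  is_derive x (basis_vec i) (fun y => phi (y 0 i) * psi y) (dphi * psi x).
Proof.
move=> ipsi dp; apply: is_derive_slice.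
rewrite (_ : (fun h => _) = psi x \*: (fun h : R => phi (h + x 0 i))); last first.
  apply/funext => h; rewrite ipsi !mxE !eqxx /= mulr1 mulrC //.
have d1 : is_derive (0 : R) 1 (fun h : R => h + x 0 i) 1.
  have := is_deriveD (is_derive_id (0:R) 1) (is_derive_cst (x 0 i) (0:R) 1).
  by move/is_derive_eq; apply; rewrite addr0.
have dp' : is_derive (0 + x 0 i) 1 phi dphi by rewrite add0r.
have := is_deriveZ (psi x) (@is_derive1_comp R phi (fun h => h + x 0 i) 0 _ _ dp' d1).
by move/is_derive_eq; apply; rewrite /GRing.scale/= mulr1 mulrC.
Qed.

Lemma indep_cst i c : indep i (cst c).
Proof. by []. Qed.

Lemma indepM i f g : indep i f -> indep i g -> indep i (fun x => f x * g x).
Proof. by move=> hf hg x h; rewrite hf hg. Qed.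

Lemma indep_coord i j (phi : R -> R) : i != j -> indep i (fun x => phi (x 0 j)).
Proof.
by move=> ij x h; rewrite !mxE eqxx /= eq_sym (negbTE ij) mulr0 add0r.
Qed.

Lemma indep_prod i (s : seq 'I_d) (phi : 'I_d -> R -> R) : i \notin s ->
  indep i (fun x => \prod_(j <- s) phi j (x 0 j)).
Proof.
move=> si x h; apply: eq_big_seq => j js; apply: (@indep_coord i j).
by apply: contra si => /eqP ->.
Qed.

(** A derivative in direction [v] exchanges [pcos] and [psin] and multiplies the coefficient by
    [2 * pi * v_i] up to sign; the induction needs both functions and all coefficients at once. *)
Lemma smooth_trig i k :
  (forall c, Ck_on k setT (fun x : X => c * pcos (x 0 i))) /\
  (forall c, Ck_on k setT (fun x : X => c * psin (x 0 i))).
Proof.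
have dcos x v c : is_derive x v (fun x : X => c * pcos (x 0 i))
    ((c * v 0 i * (- (2 * pi))) * psin (x 0 i)).
  apply: is_derive_slice.
  have d1 : is_derive (0 : R) 1 (fun h : R => h * v 0 i + x 0 i) (v 0 i).
    have := is_deriveD (is_deriveM (is_derive_id (0:R) 1) (is_derive_cst (v 0 i) (0:R) 1))
      (is_derive_cst (x 0 i) (0:R) 1).
    by move/is_derive_eq; apply; rewrite /GRing.scale/= mulr0 add0r mulr1 addr0.
  rewrite (_ : (fun h => _) = c \*: (fun h : R => pcos (h * v 0 i + x 0 i))); last first.
    by apply/funext => h; rewrite !mxE.
  have := is_deriveZ c (@is_derive1_comp R pcos _ 0 _ _ (is_derive_pcos _) d1).
  by move/is_derive_eq; apply; rewrite /GRing.scale/= mul0r add0r; ring.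
have dsin x v c : is_derive x v (fun x : X => c * psin (x 0 i))
    ((c * v 0 i * (2 * pi)) * pcos (x 0 i)).
  apply: is_derive_slice.
  have d1 : is_derive (0 : R) 1 (fun h : R => h * v 0 i + x 0 i) (v 0 i).
    have := is_deriveD (is_deriveM (is_derive_id (0:R) 1) (is_derive_cst (v 0 i) (0:R) 1))
      (is_derive_cst (x 0 i) (0:R) 1).
    by move/is_derive_eq; apply; rewrite /GRing.scale/= mulr0 add0r mulr1 addr0.
  rewrite (_ : (fun h => _) = c \*: (fun h : R => psin (h * v 0 i + x 0 i))); last first.
    by apply/funext => h; rewrite !mxE.
  have := is_deriveZ c (@is_derive1_comp R psin _ 0 _ _ (is_derive_psin _) d1).
  by move/is_derive_eq; apply; rewrite /GRing.scale/= mul0r add0r; ring.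
have ccos c : continuous (fun x : X => c * pcos (x 0 i)).
  move=> x; have H : pcos (y 0 i) @[y --> x] --> pcos (x 0 i).
    exact: (@continuous_comp _ _ _ (fun y : X => y 0 i) pcos x
      (@coord_continuous _ _ _ 0 i x) (@continuous_pcos R _)).
  exact: (continuousM (@cst_continuous X R c x) H).
have cpsin : continuous (@psin R).
  by move=> u; apply/differentiable_continuous/derivable1_diffP; exact: ex_derive.
have csin c : continuous (fun x : X => c * psin (x 0 i)).
  move=> x; have H : psin (y 0 i) @[y --> x] --> psin (x 0 i).
    exact: (@continuous_comp _ _ _ (fun y : X => y 0 i) psin x
      (@coord_continuous _ _ _ 0 i x) (@cpsin _)).
  exact: (continuousM (@cst_continuous X R c x) H).
elim: k => [|k [IHc IHs]] /=; first by split=> c; split => // x _; [exact: ccos|exact: csin].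
split=> c; split; [by move=> x _; exact: ccos| |by move=> x _; exact: csin|].
- move=> v; split; first by move=> x _; have [] := dcos x v c.
  rewrite (_ : 'D_v _ = (fun x => (c * v 0 i * (- (2 * pi))) * psin (x 0 i))).
    exact: IHs.
  by apply/funext => x; have [_ ->] := dcos x v c.
- move=> v; split; first by move=> x _; have [] := dsin x v c.
  rewrite (_ : 'D_v _ = (fun x => (c * v 0 i * (2 * pi)) * pcos (x 0 i))).
    exact: IHc.
  by apply/funext => x; have [_ ->] := dsin x v c.
Qed.

Lemma coord_addb x i j : (x + basis_vec j) 0 i = x 0 i \/
  (x + basis_vec j) 0 i = x 0 i + 1.
Proof.
by rewrite !mxE eqxx /=; case: (i == j); [right; rewrite mulr1n|left; rewrite mulr0n addr0].
Qed.

Lemma Cinf_pcos i : Cinf (fun x : X => pcos (x 0 i)).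
Proof.
apply/Cinf_smooth; split.
  by move=> x j; have [->//|->] := coord_addb x i j; rewrite pcosD1.
move=> k; have [/(_ 1) H _] := smooth_trig i k.
by rewrite (_ : (fun _ => _) = (fun x : X => 1 * pcos (x 0 i)))//;
  apply/funext => x; rewrite mul1r.
Qed.

Lemma Cinf_psin i : Cinf (fun x : X => psin (x 0 i)).
Proof.
apply/Cinf_smooth; split.
  by move=> x j; have [->//|->] := coord_addb x i j; rewrite psinD1.
move=> k; have [_ /(_ 1) H] := smooth_trig i k.
by rewrite (_ : (fun _ => _) = (fun x : X => 1 * psin (x 0 i)))//;
  apply/funext => x; rewrite mul1r.
Qed.

Lemma Cinf_ext f g : f =1 g -> Cinf f -> Cinf g.
Proof. by move=> /funext ->. Qed.

Lemma Cinf_pcosB i (s : R) : Cinf (fun x : X => pcos (s - x 0 i)).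
Proof.
apply: (@Cinf_ext (fun x => pcos s * pcos (x 0 i) + psin s * psin (x 0 i))).
  by move=> x; rewrite pcosB.
by apply: CinfD; apply: CinfZ; [exact: Cinf_pcos|exact: Cinf_psin].
Qed.

Lemma Cinf_psinB i (s : R) : Cinf (fun x : X => psin (s - x 0 i)).
Proof.
apply: (@Cinf_ext (fun x => psin s * pcos (x 0 i) + (- pcos s) * psin (x 0 i))).
  by move=> x; rewrite psinB mulNr.
by apply: CinfD; apply: CinfZ; [exact: Cinf_pcos|exact: Cinf_psin].
Qed.

Lemma Cinf_halfcosB i (s : R) : Cinf (fun x : X => halfcos (s - x 0 i)).
Proof.
apply: (@Cinf_ext (fun x => 2^-1 * (1 + pcos (s - x 0 i)))).
  by move=> x; rewrite /halfcos mulrC.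
by apply/CinfZ/CinfD; [exact: Cinf_cst|exact: Cinf_pcosB].
Qed.

Lemma Cinf_kerB n i (s : R) : Cinf (fun x : X => ker n (s - x 0 i)).
Proof.
apply: (@Cinf_ext (fun x => (wallis n)^-1 * halfcos (s - x 0 i) ^+ n)).
  by move=> x; rewrite /ker mulrC.
by apply/CinfZ/CinfX; exact: Cinf_halfcosB.
Qed.

Lemma Cinf_primkerB n i (s : R) : Cinf (fun x : X => primker n (s - x 0 i)).
Proof.
apply: (@Cinf_ext (fun x => \sum_(k < n) (2 * pi * (2 * k%:R + 2) * wallis k.+1)^-1 *
    (halfcos (s - x 0 i) ^+ k * psin (s - x 0 i)))).
  by move=> x; apply: eq_bigr => k _; rewrite mulrC.
apply: Cinf_sum => k; apply/CinfZ/CinfM; last exact: Cinf_psinB.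
by apply: CinfX; exact: Cinf_halfcosB.
Qed.

Lemma Cinf_rho n x : Cinf (rho n x).
Proof. by apply: Cinf_prod => i; exact: Cinf_kerB. Qed.

(** Kernels of finite rank with smooth factors: integrated against an integrable function they give
    a finite combination of fixed smooth functions, whose smoothness is immediate. *)
Definition separable (K : X -> X -> R) := exists (I : finType) (a b : I -> X -> R),
  [/\ forall k, Cinf (a k), forall k, Cinf (b k) &
      forall x z, K x z = \sum_k a k x * b k z].

Lemma separableD K L : separable K -> separable L ->
  separable (fun x z => K x z + L x z).
Proof.
move=> [I [a [b [Ca Cb E]]]] [J [a' [b' [Ca' Cb' E']]]].
exists (I + J)%type, (fun k => match k with inl k => a k | inr k => a' k end),
  (fun k => match k with inl k => b k | inr k => b' k end).
by split; [case|case|move=> x z; rewrite big_sumType/= E E'].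
Qed.

Lemma separableM K L : separable K -> separable L ->
  separable (fun x z => K x z * L x z).
Proof.
move=> [I [a [b [Ca Cb E]]]] [J [a' [b' [Ca' Cb' E']]]].
exists (I * J)%type, (fun k x => a k.1 x * a' k.2 x), (fun k x => b k.1 x * b' k.2 x).
split=> [k|k|x z]; [exact: CinfM|exact: CinfM|].
rewrite E E' big_distrlr/= pair_big/=; apply: eq_bigr => k _.
by rewrite mulrACA.
Qed.

Lemma separable1 f g : Cinf f -> Cinf g -> separable (fun x z => f x * g z).
Proof.
move=> Cf Cg; exists unit, (fun=> f), (fun=> g); split => // x z.
by rewrite (big_pred1 tt)//; case.
Qed.

Lemma separable_ext K L : (forall x z, K x z = L x z) -> separable K -> separable L.
Proof. by move=> KL [I [a [b [Ca Cb E]]]]; exists I, a, b; split => // x z; rewrite -KL. Qed.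

Lemma separable_cst c : separable (fun _ _ => c).
Proof.
apply: separable_ext (separable1 (Cinf_cst c) (Cinf_cst 1)) => x z.
by rewrite /cst mulr1.
Qed.

Lemma separable_rho n : separable (@rho R d n).
Proof.
have sk i : separable (fun x z => ker n (x 0 i - z 0 i)).
  have h : separable (fun x z => halfcos (x 0 i - z 0 i)).
    apply: (@separable_ext (fun x z => 2^-1 *
      (1 + (pcos (x 0 i) * pcos (z 0 i) + psin (x 0 i) * psin (z 0 i))))).
      by move=> x z; rewrite /halfcos pcosB mulrC.
    apply: (separableM (separable_cst _)); apply: (separableD (separable_cst _)).
    by apply: separableD; apply: separable1;
      [exact: Cinf_pcos|exact: Cinf_pcos|exact: Cinf_psin|exact: Cinf_psin].
  apply: (@separable_ext (fun x z => (wallis n)^-1 * halfcos (x 0 i - z 0 i) ^+ n)).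
    by move=> x z; rewrite /ker mulrC.
  apply: (separableM (separable_cst _)).
  elim: n => [|m IH]; first exact: (separable_ext _ (separable_cst 1)).
  by apply: (separable_ext _ (separableM h IH)) => x z; rewrite exprS.
rewrite /rho; elim: (index_enum _) => [|i s IH].
  by apply: (separable_ext _ (separable_cst 1)) => x z; rewrite big_nil.
by apply: (separable_ext _ (separableM (sk i) IH)) => x z; rewrite big_cons.
Qed.

End torus_smooth.

(** * Mollification *)

Section mollifier.
Context {R : realType} {d : nat}.
Local Notation X := 'rV[R]_d.
Local Notation mu := (@cube R d).
Local Notation mu2 := (mu \x mu)%E.
Local Notation intb f := (mu.-integrable setT (EFin \o f)).
Local Notation intb2 f := (mu2.-integrable setT (EFin \o f)).
Implicit Types (f g w phi : X -> R) (x y z : X) (i j : 'I_d) (c e lam C : R).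

Lemma intb_Cinf phi : Cinf phi -> intb phi.
Proof.
move=> Cp; have [B _ HB] := Cinf_bounded Cp.
exact: (intb_bdd _ (Cinf_measurable Cp) HB).
Qed.

Lemma intbM_Cinf f phi : intb f -> Cinf phi -> intb (fun x => f x * phi x).
Proof.
move=> hf Cp; have [B _ HB] := Cinf_bounded Cp.
exact: (intb_bddM hf (Cinf_measurable Cp) (aeW _ HB)).
Qed.

Lemma Lpow_Cinf p phi : 0 <= p -> Cinf phi -> Lpow mu p phi.
Proof.
move=> p0 Cp; have [B _ HB] := Cinf_bounded Cp.
exact: (Lpow_bdd _ p0 (Cinf_measurable Cp) HB).
Qed.

Definition moll n f x : R := \int[mu]_z (f z * rho n x z).

Lemma intb_moll n f x : intb f -> intb (fun z => f z * rho n x z).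
Proof. by move=> hf; apply: intbM_Cinf => //; exact: Cinf_rho. Qed.

Lemma moll_sep n : exists (I : finType) (a b : I -> X -> R),
  [/\ forall k, Cinf (a k), forall k, Cinf (b k),
      forall x z, rho n x z = \sum_k a k x * b k z &
      forall f, intb f -> forall x, moll n f x = \sum_k a k x * \int[mu]_z (f z * b k z)].
Proof.
have [I [a [b [Ca Cb E]]]] := @separable_rho R d n.
exists I, a, b; split => // f hf x.
rewrite /moll; transitivity (\int[mu]_z \sum_k (a k x * (f z * b k z))).
  apply: eq_Rintegral => z _; rewrite E mulr_sumr.
  by apply: eq_bigr => k _; rewrite mulrCA.
rewrite Rint_sum; last by move=> k; apply: intbZ; exact: intbM_Cinf.
by apply: eq_bigr => k _; rewrite RintZ//; exact: intbM_Cinf.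
Qed.

Lemma Cinf_moll n f : intb f -> Cinf (moll n f).
Proof.
move=> hf; have [I [a [b [Ca Cb _ M]]]] := moll_sep n.
apply: (@Cinf_ext _ _ (fun x => \sum_k (\int[mu]_z (f z * b k z)) * a k x)).
  by move=> x; rewrite M//; apply: eq_bigr => k _; rewrite mulrC.
by apply: Cinf_sum => k; exact: CinfZ.
Qed.

Lemma pderiv_sum (I : finType) (c : I -> R) (a : I -> X -> R) i x :
  (forall k, Cinf (a k)) ->
  pderiv i (fun x => \sum_k a k x * c k) x = \sum_k pderiv i (a k) x * c k.
Proof.
move=> Ca.
suff: is_derive x (basis_vec i) (fun x => \sum_k a k x * c k)
  (\sum_k pderiv i (a k) x * c k) by case.
elim: (index_enum I) => [|k s IH].
  rewrite big_nil (_ : (fun _ => _) = cst 0); first exact: is_derive_cst.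
  by apply/funext => y; rewrite big_nil.
rewrite big_cons (_ : (fun _ => _) =
  (c k \*: a k) + (fun y => \sum_(j <- s) a j y * c j)); last first.
  by apply/funext => y; rewrite big_cons mulrC.
apply: is_deriveD => //.
have := is_deriveZ (c k) (derivableP (@Cinf_derivable _ _ _ x (basis_vec i) (Ca k))).
by move/is_derive_eq; apply; rewrite /GRing.scale/= mulrC.
Qed.

Lemma ker_is_derive n (u : R) : is_derive u 1 (ker n) ('D_1 (ker n) u).
Proof.
apply: derivableP.
have := is_deriveZ (wallis n)^-1 (is_deriveX n (is_derive_halfcos u)).
rewrite (_ : _ \*: _ = ker n); first by case.
by apply/funext => t; rewrite /ker [RHS]mulrC /= !fctE.
Qed.

Lemma pderiv_rho n x z i :
  pderiv i (fun x => rho n x z) x = - pderiv i (rho n x) z.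
Proof.
pose psi y y' := \prod_(j | j != i) ker n (y 0 j - y' 0 j).
have E y y' : rho n y y' = ker n (y 0 i - y' 0 i) * psi y y'.
  by rewrite /rho (bigD1 i).
have i1 y' : indep i (psi^~ y').
  move=> y h; apply: eq_bigr => j ji; apply: (@indep_coord _ _ i j (fun t => ker n (t - y' 0 j))).
  by rewrite eq_sym.
have i2 y : indep i (psi y).
  move=> y' h; apply: eq_bigr => j ji; apply: (@indep_coord _ _ i j (fun t => ker n (y 0 j - t))).
  by rewrite eq_sym.
have s1 : is_derive (x 0 i) 1 (fun t : R => t - z 0 i) 1.
  have := is_deriveB (is_derive_id (x 0 i) 1) (is_derive_cst (z 0 i) (x 0 i) 1).
  by move/is_derive_eq; apply; rewrite subr0.
have s2 : is_derive (z 0 i) 1 (fun t : R => x 0 i - t) (- 1).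
  have := is_deriveB (is_derive_cst (x 0 i) (z 0 i) 1) (is_derive_id (z 0 i) 1).
  by move/is_derive_eq; apply; rewrite sub0r.
have [_ D1] := is_derive_coordM (i1 z)
  (@is_derive1_comp R (ker n) (fun t => t - z 0 i) _ _ _ (ker_is_derive n (x 0 i - z 0 i)) s1).
have [_ D2] := is_derive_coordM (i2 x)
  (@is_derive1_comp R (ker n) (fun t => x 0 i - t) _ _ _ (ker_is_derive n (x 0 i - z 0 i)) s2).
rewrite /pderiv (_ : (fun x => rho n x z) = (fun y => ker n (y 0 i - z 0 i) * psi y z)).
  rewrite (_ : rho n x = (fun y => ker n (x 0 i - y 0 i) * psi x y)).
    by rewrite D1 D2 mulrN1 mulNr opprK mulr1.
  by apply/funext => y; rewrite E.
by apply/funext => y; rewrite E.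
Qed.

(** A single weak derivative, as a relation between two given functions, so that it can be applied
    at each step along a multi-index. *)
Definition wderiv i f f' := [/\ intb f, intb f' &
  forall phi, Cinf phi -> \int[mu]_x (f' x * phi x) = - \int[mu]_x (f x * pderiv i phi x)].

(** [rho n x] is itself a test function, and its derivative in [x] is minus the one in [z]; so the
    weak derivative of [f] moves onto the kernel. Only a finite sum is differentiated. *)
Lemma pderiv_moll n i f f' x : wderiv i f f' ->
  pderiv i (moll n f) x = moll n f' x.
Proof.
move=> [hf hf' ibp]; have [I [a [b [Ca Cb E M]]]] := moll_sep n.
rewrite [moll n f' x]ibp; last exact: Cinf_rho.
rewrite (_ : moll n f = (fun x => \sum_k a k x * \int[mu]_z (f z * b k z))); last first.
  by apply/funext => y; rewrite M.
rewrite pderiv_sum//.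
transitivity (\int[mu]_z \sum_k (pderiv i (a k) x * (f z * b k z))).
  rewrite Rint_sum; last by move=> k; apply: intbZ; exact: intbM_Cinf.
  by apply: eq_bigr => k _; rewrite RintZ//; exact: intbM_Cinf.
rewrite -RintN; last by apply: intbM_Cinf => //; exact/Cinf_pderiv/Cinf_rho.
apply: eq_Rintegral => z _.
rewrite -mulrN -pderiv_rho.
rewrite (_ : (fun x => rho n x z) = (fun x => \sum_k a k x * b k z)); last first.
  by apply/funext => y; rewrite E.
rewrite pderiv_sum// mulr_sumr; apply: eq_bigr => k _.
by rewrite mulrCA.
Qed.

Lemma Rint_rho n x : \int[mu]_z rho n x z = 1.
Proof. by rewrite /Rintegral int_rho. Qed.

Lemma moll_diff n f w : measurable_fun setT f -> intb w ->
  intb2 (fun p => f p.1 * ((w p.2 - w p.1) * rho n p.1 p.2)) ->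
  intb (fun x => f x * (moll n w x - w x)) /\
  \int[mu]_x (f x * (moll n w x - w x)) =
  \int[mu2]_p (f p.1 * ((w p.2 - w p.1) * rho n p.1 p.2)).
Proof.
move=> mf hw iF.
have ibd x : intb (fun z => (w z - w x) * rho n x z).
  apply: intb_moll; apply: intbB => //; exact: finite_measure_integrable_cst.
have E x : (\int[mu]_z (f x * ((w z - w x) * rho n x z))%:E =
    (f x * (moll n w x - w x))%:E)%E.
  rewrite Rint_EFin; last by apply: intbZ.
  congr EFin; rewrite RintZ//; congr (_ * _).
  rewrite /moll -[w x in RHS]mulr1 -(Rint_rho n x) -RintZ; last exact: intb_rho.
  rewrite -RintB; [|exact: intb_moll|apply: intbZ; exact: intb_rho].
  by apply: eq_Rintegral => z _; rewrite mulrBl.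
have H := integral12_prod_meas1 iF.
have H2 := integrable_fubini_F iF.
have EF : fubini_F mu (EFin \o (fun p => f p.1 * ((w p.2 - w p.1) * rho n p.1 p.2)))
    = EFin \o (fun x => f x * (moll n w x - w x)).
  by apply/funext => x; rewrite /fubini_F /= E.
rewrite EF in H H2.
by split => //; rewrite /Rintegral -H.
Qed.

(** The bound separates [f] from [n]: the first term is small with [lam], uniformly over bounded
    sets of L^p, and the second tends to 0 with [n] independently of [f]. *)
Lemma moll_diff_young p q n f w lam : 0 < p -> 0 < q -> p^-1 + q^-1 = 1 ->
  1 <= q -> 0 < lam -> Lpow mu p f -> Lpow mu q w ->
  `|\int[mu]_x (f x * (moll n w x - w x))| <=
  lam `^ p * \int[mu]_x (`|f x| `^ p) + lam^-1 `^ q * osc q n w.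
Proof.
move=> p0 q0 pq q1 lam0 [mf lf] Lw; have [mw lw] := Lw.
have hw : intb w by apply/Lpow1; exact: (Lpow_le ler01 q1).
have [i1 e1] := mu2_int1 n lf (fun x => powR_ge0 _ _).
have [i2 _] := osc_bound n (ltW q0) Lw.
have pt (s : X * X) : `|f s.1 * ((w s.2 - w s.1) * rho n s.1 s.2)| <=
    lam `^ p * (`|f s.1| `^ p * rho n s.1 s.2) +
    lam^-1 `^ q * (`|w s.1 - w s.2| `^ q * rho n s.1 s.2).
  rewrite !mulrA -mulrDl normrM (ger0_norm (rho_ge0 n s.1 s.2)).
  rewrite ler_wpM2r ?rho_ge0// normrM distrC.
  have -> : `|f s.1| * `|w s.1 - w s.2| =
      (lam * `|f s.1|) * (lam^-1 * `|w s.1 - w s.2|).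
    by rewrite mulrACA divff ?gt_eqF// mul1r.
  have l0 := ltW lam0; have l1 : 0 <= lam^-1 by rewrite invr_ge0.
  apply: (le_trans (conjugate_powR _ _ p0 q0 pq)); rewrite ?mulr_ge0//.
  have p1' : p^-1 <= 1 by rewrite -pq lerDl invr_ge0 ltW.
  have q1' : q^-1 <= 1 by rewrite -pq lerDr invr_ge0 ltW.
  by apply: lerD; rewrite powRM// ler_piMr ?mulr_ge0 ?powR_ge0.
have iR := intbD (intbZ (lam `^ p) i1) (intbZ (lam^-1 `^ q) i2).
have iF : intb2 (fun s => f s.1 * ((w s.2 - w s.1) * rho n s.1 s.2)).
  apply: (intb_le _ pt iR).
  apply: measurable_funM; first exact: (measurableT_comp mf measurable_fst).
  apply: measurable_funM; last exact: measurable_rho.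
  apply: measurable_funB; first exact: (measurableT_comp mw measurable_snd).
  exact: (measurableT_comp mw measurable_fst).
have [_ ->] := moll_diff mf hw iF.
apply: (le_trans (Rint_norm iF)).
apply: (le_trans (Rint_le (intb_norm iF) iR pt)).
by rewrite RintD ?RintZ ?e1//; exact: intbZ.
Qed.

Lemma moll_diff_bdd n f w C : measurable_fun setT f -> (forall x, `|f x| <= C) ->
  intb w -> `|\int[mu]_x (f x * (moll n w x - w x))| <= C * osc 1 n w.
Proof.
move=> mf fC hw; have Lw := (Lpow1 mu w).1 hw; have [mw _] := Lw.
have [i2 _] := osc_bound n ler01 Lw.
have pt (s : X * X) : `|f s.1 * ((w s.2 - w s.1) * rho n s.1 s.2)| <=
    C * (`|w s.1 - w s.2| `^ 1 * rho n s.1 s.2).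
  rewrite normrM [X in _ * X]normrM (ger0_norm (rho_ge0 n s.1 s.2)) powRr1// distrC.
  by rewrite ler_wpM2r ?fC// mulr_ge0 ?rho_ge0.
have iR := intbZ C i2.
have iF : intb2 (fun s => f s.1 * ((w s.2 - w s.1) * rho n s.1 s.2)).
  apply: (intb_le _ pt iR).
  apply: measurable_funM; first exact: (measurableT_comp mf measurable_fst).
  apply: measurable_funM; last exact: measurable_rho.
  apply: measurable_funB; first exact: (measurableT_comp mw measurable_snd).
  exact: (measurableT_comp mw measurable_fst).
have [_ ->] := moll_diff mf hw iF.
apply: (le_trans (Rint_norm iF)).
by rewrite -RintZ//; exact: (Rint_le (intb_norm iF) iR pt).
Qed.

Lemma moll_cvg_bdd f w C : measurable_fun setT f -> (forall x, `|f x| <= C) ->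
  intb w -> \int[mu]_x (f x * moll n w x) @[n --> \oo] --> \int[mu]_x (f x * w x).
Proof.
move=> mf fC hw.
have v : osc 1 n w @[n --> \oo] --> 0.
  by apply: oscillation_vanishes => //; exact/Lpow1.
have H : C * osc 1 n w @[n --> \oo] --> 0 by rewrite -(mulr0 C); exact: cvgMr.
apply/subr_cvg0/norm_cvg0P.
apply: (squeeze_cvgr _ (cvg_cst 0) H); apply: nearW => n; rewrite normr_ge0/=.
have ifw g : intb g -> intb (fun x => f x * g x).
  by move=> hg; apply: intb_ext (intb_bddM hg mf (aeW _ fC)) => x; rewrite mulrC.
rewrite -RintB ?ifw//; last exact/intb_Cinf/Cinf_moll.
rewrite (_ : \int[mu]_x _ = \int[mu]_x (f x * (moll n w x - w x))).
  exact: moll_diff_bdd.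
by apply: eq_Rintegral => x _; rewrite mulrBr.
Qed.

Lemma moll_cvg2 f w : Lpow mu 2 f -> Lpow mu 2 w ->
  \int[mu]_x (f x * moll n w x) @[n --> \oo] --> \int[mu]_x (f x * w x).
Proof.
move=> Lf Lw; have p12 : (1 : R) <= 2 by rewrite ler1n.
have hw : intb w by apply/Lpow1; exact: (Lpow_le ler01 p12 Lw).
have v : osc 2 n w @[n --> \oo] --> 0 by exact: oscillation_vanishes.
pose A := \int[mu]_x (`|f x| `^ 2).
have A0 : 0 <= A by apply: Rint_ge0 => x; exact: powR_ge0.
apply/cvgrPdist_le => e e0.
(* Makes [lam ^ 2 * A] at most [e / 2]; [A + 1] avoids a division by 0. *)
pose lam := Num.sqrt (e / (2 * (A + 1))).
have A1 : 0 < 2 * (A + 1) by rewrite mulr_gt0// ltr_wpDl.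
have lam0 : 0 < lam by rewrite sqrtr_gt0 divr_gt0.
have e2 : 0 < e / (2 * lam^-1 `^ 2).
  by rewrite divr_gt0// mulr_gt0// powR_gt0// invr_gt0.
have /cvgrPdist_le/(_ _ e2) := v; apply: filterS => n /=.
rewrite sub0r normrN ger0_norm ?osc_ge0// => Hn.
have Lm : Lpow mu 2 (moll n w) by apply: Lpow_Cinf => //; exact: Cinf_moll.
rewrite distrC -RintB ?Lpow2M//.
rewrite (_ : \int[mu]_x _ = \int[mu]_x (f x * (moll n w x - w x))); last first.
  by apply: eq_Rintegral => x _; rewrite mulrBr.
have pq : (2 : R)^-1 + 2^-1 = 1 by rewrite [RHS]splitr !div1r.
apply: (le_trans (moll_diff_young n _ _ pq p12 lam0 Lf Lw)) => //.
rewrite (splitr e); apply: lerD.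
  rewrite powR_mulrn ?sqrtr_ge0// sqr_sqrtr; last by rewrite ltW// divr_gt0.
  rewrite -/A mulrAC ler_pdivrMr// mulrAC ler_pdivlMr// -mulrA ler_wpM2l ?ltW//.
  by lra.
have l0 : 0 < lam^-1 `^ 2 by rewrite powR_gt0// invr_gt0.
apply: (le_trans (ler_wpM2l (ltW l0) Hn)).
rewrite le_eqVlt; apply/orP; left; apply/eqP; field.
by rewrite gt_eqF.
Qed.

Lemma intb_eq0 g : intb g ->
  (forall A, measurable A -> \int[mu]_x (\1_A x * g x) = 0) ->
  {ae mu, forall x, g x = 0}.
Proof.
move=> hg H.
have := @integral_ae_eq _ _ _ mu setT measurableT (cst 0%E) (EFin \o g) hg _.
move=> /(_ _) H2.
have : ae_eq mu setT (EFin \o g) (cst 0%E).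
  apply: H2 => // A _ mA; rewrite integral0 integral_mkcond.
  transitivity (\int[mu]_x (\1_A x * g x)%:E)%E.
    apply: eq_integral => x _; rewrite patchE indicE.
    by case: (_ \in _); rewrite ?mul1r ?mul0r.
  rewrite Rint_EFin ?H//.
  apply: intb_ext (intb_bddM hg _ (aeW _ (indic_le1 A))) => // x.
  by rewrite mulrC.
by apply: filterS => x /(_ I) [].
Qed.

(** The kernels are test functions, so [f] and [g] have the same averages; these converge against
    indicators of measurable sets, which detect equality a.e. *)
Lemma distr_eq_ae f g : intb f -> intb g ->
  (forall phi, Cinf phi -> \int[mu]_x (f x * phi x) = \int[mu]_x (g x * phi x)) ->
  {ae mu, forall x, f x = g x}.
Proof.
move=> hf hg H; have hfg := intbB hf hg.
have m0 n x : moll n (fun x => f x - g x) x = 0.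
  rewrite /moll; transitivity (\int[mu]_z (f z * rho n x z - g z * rho n x z)).
    by apply: eq_Rintegral => z _; rewrite mulrBl.
  rewrite RintB; [|exact: intb_moll|exact: intb_moll].
  by rewrite H ?subrr//; exact: Cinf_rho.
have : {ae mu, forall x, f x - g x = 0}.
  apply: intb_eq0 => // A mA.
  have mI : measurable_fun setT (\1_A : X -> R) by exact: measurable_indic.
  have := moll_cvg_bdd mI (indic_le1 A) hfg.
  rewrite (_ : (fun n => _) = cst 0); last first.
    apply/funext => n; rewrite -(Rint_zero mu); apply: eq_Rintegral => x _.
    by rewrite m0 mulr0.
  by move/cvg_lim => <- //; exact: lim_cst.
by apply: filterS => x /eqP; rewrite subr_eq0 => /eqP.
Qed.

(** Testing the averages with the indicator of [{C < g}] shows that [g - C] has nonpositive integral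
    on this set, where it is positive; the set is null. This is applied to [f] and to [- f]. *)
Lemma moll_bound_ae f C : intb f -> (forall n x, `|moll n f x| <= C) ->
  {ae mu, forall x, `|f x| <= C}.
Proof.
have H g : intb g -> (forall n x, moll n g x <= C) -> {ae mu, forall x, g x <= C}.
  move=> hg mC; have mg := intb_meas hg.
  pose A := [set x | C < g x].
  have mA : measurable A.
    rewrite (_ : A = g @^-1` [set` `]C, +oo[]).
      by rewrite -[X in measurable X]setTI; exact: mg.
    by apply/seteqP; split => x /=; rewrite in_itv/= andbT.
  have mI : measurable_fun setT (\1_A : X -> R) by exact: measurable_indic.
  have iI h : intb h -> intb (fun x => \1_A x * h x).
    move=> hh; apply: intb_ext (intb_bddM hh mI (aeW _ (indic_le1 A))) => x.
    by rewrite mulrC.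
  have iC : intb (cst C) by exact: finite_measure_integrable_cst.
  have le : \int[mu]_x (\1_A x * g x) <= \int[mu]_x (\1_A x * C).
    apply: (cvgr_to_le (moll_cvg_bdd mI (indic_le1 A) hg)); apply: nearW => n.
    apply: Rint_le; [apply: iI; exact/intb_Cinf/Cinf_moll|exact: (iI (cst C))|].
    by move=> x; rewrite ler_wpM2l// indicE.
  have i0 : intb (fun x => \1_A x * (g x - C)).
    by apply: iI; exact: intbB.
  have p0 x : 0 <= \1_A x * (g x - C).
    rewrite indicE; have [|] := boolP (x \in A); last by rewrite mul0r.
    by rewrite inE /A/= mul1r subr_ge0 => /ltW.
  have I0 : \int[mu]_x (\1_A x * (g x - C)) = 0.
    apply/eqP; rewrite eq_le Rint_ge0// andbT.
    rewrite (_ : \int[mu]_x _ = \int[mu]_x (\1_A x * g x) - \int[mu]_x (\1_A x * C)).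
      by rewrite subr_le0.
    rewrite -RintB; [|exact: iI|exact: (iI (cst C))].
    by apply: eq_Rintegral => x _; rewrite mulrBr.
  apply: filterS (Rint_eq0_ae i0 p0 I0) => x.
  rewrite indicE; have [|] := boolP (x \in A).
    by rewrite inE /A/= mul1r => Cg /eqP; rewrite subr_eq0 => /eqP ->.
  by rewrite notin_setE /A/= => /negP; rewrite -leNgt.
move=> hf mC.
have H1 := H f hf (fun n x => le_trans (ler_norm _) (mC n x)).
have H2 : {ae mu, forall x, - f x <= C}.
  apply: H => [|n x]; first exact: intbN.
  rewrite (_ : moll n _ x = - moll n f x).
    by apply: le_trans (mC n x); rewrite -normrN ler_norm.
  rewrite /moll -RintN; last exact: intb_moll.
  by apply: eq_Rintegral => z _; rewrite mulNr.
by apply: filterS2 H1 H2 => x h1 h2; rewrite ler_norml h1 andbT lerNl.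
Qed.

End mollifier.

(** * Weak derivatives and Sobolev embedding *)

Section weak_derivatives.
Context {R : realType} {d : nat}.
Local Notation X := 'rV[R]_d.
Local Notation mu := (@cube R d).
Local Notation intb f := (mu.-integrable setT (EFin \o f)).
Implicit Types (f g w phi : X -> R) (x y z : X) (i j : 'I_d) (c p C : R) (s l : seq 'I_d).

Lemma cvg_eq (v : nat -> R) (a b : R) :
  v n @[n --> \oo] --> a -> v n @[n --> \oo] --> b -> a = b.
Proof. by move=> /(cvg_lim (@Rhausdorff R)) <- /(cvg_lim (@Rhausdorff R)) <-. Qed.

Lemma Lp1P f : Lp 1 f <-> Zd_periodic f /\ intb f.
Proof.
split=> -[pf hf]; split => //.
  by apply/Lpow1/(LpowP mu f ltr01).
by apply/(LpowP mu f ltr01)/Lpow1.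
Qed.

Lemma weak_derivE s f g : weak_deriv s f g <->
  [/\ Zd_periodic f, intb f, Zd_periodic g, intb g &
      forall phi, Cinf phi -> dDs s (dist f) phi = \int[mu]_x (g x * phi x)].
Proof.
split=> [[/Lp1P[pf hf] /Lp1P[pg hg] H]|[pf hf pg hg H]].
  by split.
by split; [apply/Lp1P; split|apply/Lp1P; split|].
Qed.

Lemma weak_deriv_ae s f g g' : weak_deriv s f g -> weak_deriv s f g' ->
  {ae mu, forall x, g x = g' x}.
Proof.
move=> /weak_derivE[_ _ _ hg H] /weak_derivE[_ _ _ hg' H'].
by apply: distr_eq_ae => // phi Cp; rewrite -H// -H'.
Qed.

Lemma weak_deriv_wD s f g : weak_deriv s f g -> weak_deriv s f (wD s f).
Proof. by move=> H; apply: (@xgetPex _ (cst 0)  [set g | weak_deriv s f g]); exists g. Qed.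

Lemma weak_deriv_wD_ae s f g : weak_deriv s f g -> {ae mu, forall x, wD s f x = g x}.
Proof. by move=> H; exact: weak_deriv_ae (weak_deriv_wD H) H. Qed.

Lemma weak_deriv_step i s f g g' : weak_deriv s f g -> weak_deriv (i :: s) f g' ->
  wderiv i g g'.
Proof.
move=> /weak_derivE[pf hf _ hg H] /weak_derivE[_ _ _ hg' H']; split => // phi Cp.
by rewrite -H'// /= /dD H//; exact: Cinf_pderiv.
Qed.

Lemma weak_deriv0 f : Zd_periodic f -> intb f -> weak_deriv [::] f f.
Proof. by move=> pf hf; apply/weak_derivE. Qed.

Lemma Zd_periodic_sum (I : finType) (F : I -> X -> R) : (forall k, Zd_periodic (F k)) ->
  Zd_periodic (fun x => \sum_k F k x).
Proof. by move=> H x i; apply: eq_bigr => k _; rewrite H. Qed.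

Lemma dDs_sum (I : finType) (T : distr) (S : I -> distr) s :
  (forall phi, Cinf phi -> T phi = \sum_k S k phi) ->
  forall phi, Cinf phi -> dDs s T phi = \sum_k dDs s (S k) phi.
Proof.
move=> H; elim: s => //= i s IH phi Cp.
by rewrite /dD IH ?sumrN//; exact: Cinf_pderiv.
Qed.

(** Sobolev space of integer order through the chosen representatives [wD s f]. For the empty
    multi-index, [wD [::] f] equals [f] only a.e. *)
Definition wsob k p f := forall s, (size s <= k)%N ->
  weak_deriv s f (wD s f) /\ Lpow mu p (wD s f).

Lemma wsobP k p f : 0 < p -> (forall s, (size s <= k)%N ->
  exists2 g, weak_deriv s f g & Lpow mu p g) -> wsob k p f.
Proof.
move=> p0 H s /H[g wg [mg lg]].
have w := weak_deriv_wD wg; split => //.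
apply: Lpow_ae (conj mg lg).
  by case/weak_derivE: w => _ _ _ /intb_meas.
by move: (weak_deriv_wD_ae wg); apply: filterS => x ->.
Qed.

Lemma sobolev_wsob k p f : 0 < p -> sobolev k%:R p f -> wsob k p f.
Proof.
move=> p0 [H _]; apply: wsobP => // s; rewrite natrK in H => /H[g wg [_ Lg]].
by exists g => //; exact/(LpowP mu g p0).
Qed.

Lemma wsob_le k k' p f : (k' <= k)%N -> wsob k p f -> wsob k' p f.
Proof. by move=> kk H s /leq_trans/(_ kk)/H. Qed.

Lemma wsob_wderiv k p f i s : wsob k p f -> (size s < k)%N ->
  wderiv i (wD s f) (wD (i :: s) f).
Proof.
move=> H sk; have [w1 _] := H s (ltnW sk); have [w2 _] := H (i :: s) sk.
exact: weak_deriv_step w1 w2.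
Qed.

Lemma wsob_base k p f : wsob k p f -> [/\ Zd_periodic f, intb f &
  {ae mu, forall x, wD [::] f x = f x}].
Proof.
move=> /(_ [::] (leq0n _))[/weak_derivE[pf hf pg hg H] _]; split => //.
by apply: weak_deriv_wD_ae; exact: weak_deriv0.
Qed.

Lemma wsob_Lpow k p f : wsob k p f -> Lpow mu p f.
Proof.
move=> H; have [pf hf e] := wsob_base H; have [_ L] := H [::] (leq0n _).
exact: Lpow_ae (intb_meas hf) e L.
Qed.

Lemma wsob_wderiv0 k p f i : wsob k.+1 p f -> wderiv i f (wD [:: i] f).
Proof.
move=> H; have [pf hf e] := wsob_base H; have [w _] := H [:: i] isT.
exact: weak_deriv_step (weak_deriv0 pf hf) w.
Qed.

Lemma Lpow_sum p (I : finType) (F : I -> X -> R) : 0 < p ->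
  (forall k, Lpow mu p (F k)) -> Lpow mu p (fun x => \sum_k F k x).
Proof.
move=> p0 H.
suff Hs (s : seq I) : Lpow mu p (fun x => \sum_(k <- s) F k x) by exact: Hs.
elim: s => [|k s IH].
  rewrite (_ : (fun _ => _) = cst 0).
    by apply: (@Lpow_bdd _ _ _ _ _ _ 0); [exact: ltW|exact: measurable_cst|move=> x; rewrite normr0].
  by apply/funext => x; rewrite big_nil.
rewrite (_ : (fun _ => _) = (fun x => F k x + \sum_(k <- s) F k x)).
  exact: LpowD (ltW p0) (H k) IH.
by apply/funext => x; rewrite big_cons.
Qed.

Lemma wsob_wlap k p f : 1 <= p -> wsob k.+2 p f -> wsob k p (wlap f).
Proof.
move=> p1 H; have p0 : 0 < p by apply: lt_le_trans p1.
apply: wsobP => // s sk.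
(* [dDs] folds from the right, so the two derivatives of the Laplacian come last in the list. *)
have Hs i : (size (s ++ [:: i; i]) <= k.+2)%N by rewrite size_cat addn2 !ltnS.
exists (fun x => \sum_i wD (s ++ [:: i; i]) f x); last first.
  by apply: Lpow_sum => // i; case: (H _ (Hs i)).
apply/weak_derivE.
have pw t : (size t <= k.+2)%N -> Zd_periodic (wD t f) /\ intb (wD t f).
  by move=> /H[/weak_derivE[_ _ ? ?]].
split.
- by apply: Zd_periodic_sum => i; exact: (pw [:: i; i] isT).1.
- by apply: intb_sum => i; exact: (pw [:: i; i] isT).2.
- by apply: Zd_periodic_sum => i; exact: (pw _ (Hs i)).1.
- by apply: intb_sum => i; exact: (pw _ (Hs i)).2.
move=> phi Cp.
rewrite (@dDs_sum _ _ (fun i => dDs [:: i; i] (dist f)))//; last first.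
  move=> psi Cpsi; rewrite /dist.
  transitivity (\int[mu]_x \sum_i (wD [:: i; i] f x * psi x)).
    by apply: eq_Rintegral => x _; rewrite mulr_suml.
  rewrite Rint_sum; last first.
    by move=> i; apply: intbM_Cinf => //; exact: (pw [:: i; i] isT).2.
  apply: eq_bigr => i _.
  by have [/weak_derivE[_ _ _ _ ->]] := H [:: i; i] isT.
transitivity (\int[mu]_x \sum_i (wD (s ++ [:: i; i]) f x * phi x)); last first.
  by apply: eq_Rintegral => x _; rewrite mulr_suml.
rewrite Rint_sum; last first.
  by move=> i; apply: intbM_Cinf => //; exact: (pw _ (Hs i)).2.
apply: eq_bigr => i _.
have [/weak_derivE[_ _ _ _ <-//] _] := H _ (Hs i).
by rewrite /dDs foldr_cat.
Qed.

Lemma wsob_iter_wlap k p f r : 1 <= p -> wsob (k + r.*2) p f ->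
  wsob k p (iter r wlap f).
Proof.
move=> p1; elim: r k => [|r IH] k; first by rewrite addn0.
by rewrite doubleS !addnS => H /=; apply/(wsob_wlap p1)/IH; rewrite !addSn.
Qed.

(** Only [g] is averaged, which makes it an admissible test function for [f]; the derivative of the
    average is the average of [g'], and both sides converge in the L^2 pairing. *)
Lemma wderiv_ibp i f f' g g' : Lpow mu 2 f -> Lpow mu 2 f' -> Lpow mu 2 g ->
  Lpow mu 2 g' -> wderiv i f f' -> wderiv i g g' ->
  \int[mu]_x (f' x * g x) = - \int[mu]_x (f x * g' x).
Proof.
move=> Lf Lf' Lg Lg' [_ _ H] wg; have [hg _ _] := wg.
have c1 := moll_cvg2 Lf' Lg.
have c2 : (- \int[mu]_x (f x * moll n g' x)) @[n --> \oo] --> - \int[mu]_x (f x * g' x).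
  exact: cvgN (moll_cvg2 Lf Lg').
move: c1; rewrite (_ : (fun n => \int[mu]_x (f' x * moll n g x)) =
  (fun n => - \int[mu]_x (f x * moll n g' x))); last first.
  apply/funext => n; rewrite (H _ (Cinf_moll n hg)); congr (- _).
  by apply: eq_Rintegral => x _; rewrite (pderiv_moll _ _ wg).
move=> c1; exact: cvg_eq c1 c2.
Qed.

Lemma wlap_ibp f g : wsob 2 2 f -> wsob 1 2 g ->
  \int[mu]_x (wlap f x * g x) = - \sum_i \int[mu]_x (wD [:: i] f x * wD [:: i] g x).
Proof.
move=> Hf Hg.
transitivity (\int[mu]_x \sum_i (wD [:: i; i] f x * g x)).
  by apply: eq_Rintegral => x _; rewrite mulr_suml.
rewrite Rint_sum; last first.
  by move=> i; apply: Lpow2M; [exact: (Hf [:: i; i] isT).2|exact: (wsob_Lpow Hg)].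
rewrite -sumrN; apply: eq_bigr => i _.
apply: (wderiv_ibp (Hf [:: i] isT).2 (Hf [:: i; i] isT).2 (wsob_Lpow Hg) (Hg [:: i] isT).2).
  exact: (wsob_wderiv i Hf).
exact: wsob_wderiv0 Hg.
Qed.

Lemma wlap_sym f g : wsob 2 2 f -> wsob 2 2 g ->
  \int[mu]_x (wlap f x * g x) = \int[mu]_x (f x * wlap g x).
Proof.
move=> Hf Hg; rewrite (wlap_ibp Hf (wsob_le (leqnSn 1) Hg)).
transitivity (\int[mu]_x (wlap g x * f x)); last by apply: eq_Rintegral => x _; rewrite mulrC.
rewrite (wlap_ibp Hg (wsob_le (leqnSn 1) Hf)).
apply: (congr1 (@GRing.opp R)); apply: eq_bigr => i _.
by apply: eq_Rintegral => x _; rewrite mulrC.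
Qed.

Lemma wlap_le0 f : wsob 2 2 f -> \int[mu]_x (wlap f x * f x) <= 0.
Proof.
move=> Hf; rewrite (wlap_ibp Hf (wsob_le (leqnSn 1) Hf)).
by rewrite oppr_le0 sumr_ge0// => i _; apply: Rint_ge0 => x; rewrite -expr2 sqr_ge0.
Qed.

(** Half of the Laplacians move to the other factor one at a time, and the integrand becomes a
    square. Each transfer is the symmetry of [wlap] on W^{2,2}, available as long as both factors
    carry fewer than [2 * N] Laplacians. *)
Lemma iter_wlap_ge0 N f : (0 < N)%N -> wsob (4 * N) 2 f ->
  0 <= \int[mu]_x (iter (2 * N) wlap f x * f x).
Proof.
move=> N0 Hf; have p12 : (1 : R) <= 2 by rewrite ler1n.
have Hr r : (r.+1 <= 2 * N)%N -> wsob 2 2 (iter r wlap f).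
  move=> rN; apply: wsob_iter_wlap => //; apply: wsob_le Hf.
  by move: rN; rewrite -muln2; lia.
have H r : (r <= N)%N -> \int[mu]_x (iter (2 * N) wlap f x * f x) =
    \int[mu]_x (iter (2 * N - r) wlap f x * iter r wlap f x).
  elim: r => [|r IH] rN; first by rewrite subn0.
  rewrite IH ?(ltnW rN)//.
  have rN2 : (r < 2 * N)%N by rewrite (leq_trans rN)// leq_pmull.
  rewrite -(subnSK rN2) /= wlap_sym//; apply: Hr => //.
  by rewrite (subnSK rN2) leq_subr.
rewrite (H N)// mul2n -addnn addnK.
by apply: Rint_ge0 => x; rewrite -expr2 sqr_ge0.
Qed.

End weak_derivatives.

(** * Sup bounds from integrable derivatives *)

Section sobolev_embedding.
Context {R : realType} {d : nat}.
Local Notation X := 'rV[R]_d.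
Local Notation mu := (@cube R d).
Local Notation intb f := (mu.-integrable setT (EFin \o f)).
Implicit Types (f g w phi Phi : X -> R) (x y z : X) (i j : 'I_d) (c p C : R) (s l : seq 'I_d).

Definition kers n l x z : R := \prod_(i <- l) ker n (x 0 i - z 0 i).

Lemma Cinf_kers n l x : Cinf (kers n l x).
Proof. by apply: Cinf_prod => i; exact: Cinf_kerB. Qed.

Lemma indep_kers n l x i : i \notin l -> indep i (kers n l x).
Proof. by move=> il; exact: (@indep_prod _ _ i l (fun j t => ker n (x 0 j - t))). Qed.

Lemma is_derive_subl (a : R) (phi : R -> R) dphi (t : R) :
  is_derive (a - t) 1 phi dphi -> is_derive t 1 (fun t => phi (a - t)) (- dphi).
Proof.
move=> H; have s2 : is_derive t 1 (fun t : R => a - t) (- 1).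
  have := is_deriveB (is_derive_cst a t 1) (is_derive_id t 1).
  by move/is_derive_eq; apply; rewrite sub0r.
have := @is_derive1_comp R phi (fun t => a - t) _ _ _ H s2.
by rewrite mulrN1.
Qed.

(* Weighted bound after removing the kernels one coordinate at a time: [ker] is
   [1] plus the derivative of [primker], and integration by parts moves this
   derivative to [F s]. *)
Fixpoint embedding_bound (F : seq 'I_d -> X -> R) l s : R :=
  if l is i :: l' then embedding_bound F l' s + embedding_bound F l' (i :: s)
  else \int[mu]_z `|F s z|.

(** [Phi] collects the factors [primker] of the coordinates already removed: it is bounded by 1
    whatever [n] is, and it does not depend on the coordinates still in [l], so each integration by
    parts differentiates a single factor. *)
Lemma embedding_step (F : seq 'I_d -> X -> R) k n x l s Phi :
  (forall s, (size s <= k)%N -> intb (F s)) ->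
  (forall i s, (size s < k)%N -> wderiv i (F s) (F (i :: s))) ->
  uniq l -> (size s + size l <= k)%N -> Cinf Phi -> (forall z, `|Phi z| <= 1) ->
  (forall i, i \in l -> indep i Phi) ->
  `|\int[mu]_z (F s z * (Phi z * kers n l x z))| <= embedding_bound F l s.
Proof.
move=> iF wF; elim: l s Phi => [|i l IH] s Phi ul sk CP P1 iP.
  rewrite addn0 in sk.
  have iFP : intb (fun z => F s z * (Phi z * kers n [::] x z)).
    by apply: intbM_Cinf (iF _ sk) _; apply: CinfM => //; exact: Cinf_kers.
  apply: (le_trans (Rint_norm iFP)).
  apply: (Rint_le (intb_norm iFP) (intb_norm (iF _ sk))) => z.
  by rewrite /kers big_nil mulr1 normrM ler_piMr.
move: ul => /= /andP[il ul]; rewrite /= addnS in sk.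
have sk' : (size s < k)%N by apply: leq_trans sk; rewrite ltnS leq_addr.
pose G z := primker n (x 0 i - z 0 i).
pose Psi z := Phi z * kers n l x z.
have CG : Cinf G by exact: Cinf_primkerB.
have CPsi : Cinf Psi by apply: CinfM => //; exact: Cinf_kers.
have iPsi : indep i Psi.
  by apply: indepM; [apply: iP; rewrite mem_head|exact: indep_kers].
have DG z : pderiv i (fun z => G z * Psi z) z = - (ker n (x 0 i - z 0 i) - 1) * Psi z.
  have := is_derive_coordM iPsi (is_derive_subl (is_derive_primker n (x 0 i - z 0 i))).
  by case.
have CGP : Cinf (fun z => G z * Psi z) by exact: CinfM.
have i1 : intb (fun z => F s z * Psi z) by apply: intbM_Cinf => //; exact: iF (ltnW sk').
have i2 : intb (fun z => F s z * pderiv i (fun z => G z * Psi z) z).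
  by apply: intbM_Cinf; [exact: iF (ltnW sk')|exact: Cinf_pderiv].
(* The kernel of the coordinate [i] is split as [1 + (ker - 1)]; the second part is minus the
   derivative of [G] along [z_i]. *)
have E : \int[mu]_z (F s z * (Phi z * kers n (i :: l) x z)) =
    \int[mu]_z (F s z * Psi z) + \int[mu]_z (F (i :: s) z * (G z * Psi z)).
  have [_ _ ->//] := wF i s sk'.
  rewrite -RintB//; apply: eq_Rintegral => z _.
  by rewrite DG /Psi /kers big_cons; ring.
rewrite E /=; apply: (le_trans (ler_normD _ _)); apply: lerD.
  apply: IH => //; first exact: ltnW.
  by move=> j jl; apply: iP; rewrite inE jl orbT.
rewrite (_ : \int[mu]_z _ =
    \int[mu]_z (F (i :: s) z * ((G z * Phi z) * kers n l x z))); last first.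
  by apply: eq_Rintegral => z _; rewrite /Psi (mulrA (G z)).
apply: IH => //; first exact: CinfM.
  move=> z; rewrite normrM -[1]mulr1.
  by apply: ler_pM => //; exact: primker_norm_le1.
move=> j jl; apply: indepM; last by apply: iP; rewrite inE jl orbT.
apply: (@indep_coord _ _ j i (fun t => primker n (x 0 i - t))).
by apply: contraNneq il => <-.
Qed.

(** One extra derivative per coordinate bounds the averages of [wD s f] uniformly in [n] and [x],
    and such a bound passes to the function itself. *)
Lemma wsob_bounded k p f s : 1 <= p -> wsob k p f -> (size s + d <= k)%N ->
  exists C, {ae mu, forall x, `|wD s f x| <= C}.
Proof.
move=> p1 H sk; pose F s := wD s f.
have iF t : (size t <= k)%N -> intb (F t) by move=> /H[/weak_derivE[_ _ _ hF _] _].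
have wF i t : (size t < k)%N -> wderiv i (F t) (F (i :: t)) by move=> tk; exact: (wsob_wderiv i H tk).
exists (embedding_bound F (enum 'I_d) s).
apply: moll_bound_ae => [|n x].
  by apply: iF; apply: leq_trans sk; exact: leq_addr.
have := @embedding_step F k n x (enum 'I_d) s (cst 1) iF wF (enum_uniq _).
rewrite size_enum_ord => /(_ sk (Cinf_cst _)).
rewrite (_ : \int[mu]_z _ = moll n (wD s f) x); last first.
  apply: eq_Rintegral => z _; rewrite /kers /rho mul1r; congr (_ * _).
  by rewrite big_enum.
apply => [z|i _]; first by rewrite normr1.
exact: indep_cst.
Qed.

(** The kernel is a product over coordinates, so both mixed derivatives can be computed and
    compared. *)
Lemma rho_schwarz n x i j :
  pderiv i (pderiv j (rho n x)) = pderiv j (pderiv i (rho n x)) :> (X -> R).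
Proof.
have [->//|ij] := eqVneq i j.
pose psi z := \prod_(l | (l != i) && (l != j)) ker n (x 0 l - z 0 l).
pose k' : R -> R := 'D_1 (ker n : R -> R).
have dk (l : 'I_d) z : is_derive (z 0 l) 1 (fun t => ker n (x 0 l - t)) (- k' (x 0 l - z 0 l)).
  exact: is_derive_subl (ker_is_derive n (x 0 l - z 0 l)).
have psii : indep i psi.
  move=> z h; apply: eq_bigr => l /andP[li lj].
  by rewrite !mxE eqxx /= (negbTE li) mulr0 add0r.
have psij : indep j psi.
  move=> z h; apply: eq_bigr => l /andP[li lj].
  by rewrite !mxE eqxx /= (negbTE lj) mulr0 add0r.
have gen a b (g : X -> R) : a != b -> indep a g -> indep b g ->
    pderiv a (pderiv b (fun z => ker n (x 0 b - z 0 b) * (ker n (x 0 a - z 0 a) * g z)))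
    = (fun z => k' (x 0 a - z 0 a) * (k' (x 0 b - z 0 b) * g z)).
  move=> ab ga gb; apply/funext => z.
  have E : pderiv b (fun z => ker n (x 0 b - z 0 b) * (ker n (x 0 a - z 0 a) * g z))
    = (fun z => ker n (x 0 a - z 0 a) * (- k' (x 0 b - z 0 b) * g z)).
    apply/funext => y.
    have ib : indep b (fun z => ker n (x 0 a - z 0 a) * g z).
      apply: indepM => //.
      by apply: (@indep_coord _ _ b a (fun t => ker n (x 0 a - t))); rewrite eq_sym.
    have [_ D] := is_derive_coordM ib (dk b y).
    by rewrite /pderiv D; ring.
  rewrite E.
  have ia : indep a (fun z => - k' (x 0 b - z 0 b) * g z).
    apply: indepM => //.
    exact: (@indep_coord _ _ a b (fun t => - k' (x 0 b - t))).
  have [_ D] := is_derive_coordM ia (dk a z).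
  by rewrite /pderiv D; ring.
have ji : j != i by rewrite eq_sym.
have E1 : rho n x = (fun z => ker n (x 0 j - z 0 j) * (ker n (x 0 i - z 0 i) * psi z)).
  apply/funext => z; rewrite /rho (bigD1 i)//= (bigD1 j)//= mulrCA.
  by congr (_ * (_ * _)); apply: eq_bigl => l; rewrite andbC andbC.
have E2 : rho n x = (fun z => ker n (x 0 i - z 0 i) * (ker n (x 0 j - z 0 j) * psi z)).
  by rewrite E1; apply/funext => z; ring.
rewrite [in LHS]E1 [in RHS]E2 gen// gen//.
by apply/funext => z; ring.
Qed.

Lemma moll_eq_ae f g : intb f -> intb g ->
  (forall n x, moll n f x = moll n g x) -> {ae mu, forall x, f x = g x}.
Proof.
move=> hf hg E; have h := intbB hf hg.
have : {ae mu, forall x, `|f x - g x| <= 0}.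
  apply: (moll_bound_ae h) => n x.
  rewrite (_ : moll n _ x = moll n f x - moll n g x); first by rewrite E subrr normr0.
  rewrite /moll -(RintB (intb_moll n x hf) (intb_moll n x hg)).
  by apply: eq_Rintegral => z _; rewrite mulrBl.
by apply: filterS => x; rewrite normr_le0 subr_eq0 => /eqP.
Qed.

(** The weak equation produces derivatives of the test function in the order [i, j], whereas [whess]
    is built from [[:: j; i]]. Comparing averages is enough, and there the symmetry is that of the
    kernel. *)
Lemma wD_schwarz k p f i j : wsob k.+2 p f ->
  {ae mu, forall x, wD [:: i; j] f x = wD [:: j; i] f x}.
Proof.
move=> H.
have [/weak_derivE[_ _ _ h1 e1] _] := H [:: i; j] isT.
have [/weak_derivE[_ _ _ h2 e2] _] := H [:: j; i] isT.
apply: (moll_eq_ae h1 h2) => n x.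
apply: etrans (esym (e1 _ (Cinf_rho n x))) _.
apply: etrans (e2 _ (Cinf_rho n x)).
exact: (congr1 (fun v => - - dist f v) (rho_schwarz n x j i)).
Qed.

End sobolev_embedding.

(** * Weak compactness in L^q *)

Section diagonal.
Context {R : realType}.
Implicit Types (v w : nat -> R) (k : nat -> nat).

Lemma increasing_ge k : {homo k : a b / (a < b)%N} -> forall n, (n <= k n)%N.
Proof.
move=> H; elim=> // n IH; apply: (leq_ltn_trans IH); exact: H.
Qed.

Lemma cvg_subseq_ge v (k : nat -> nat) (a : R) : (forall n, (n <= k n)%N) ->
  v n @[n --> \oo] --> a -> v (k n) @[n --> \oo] --> a.
Proof.
move=> kn /cvgrPdist_le va; apply/cvgrPdist_le => e e0.
have [M _ HM] := va e e0.
by exists M => // n /= Mn; apply: HM; exact: leq_trans Mn (kn n).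
Qed.

Lemma bounded_cvg_subseq v B : (forall n, `|v n| <= B) ->
  exists2 k, {homo k : a b / (a < b)%N} & exists a : R, v (k n) @[n --> \oo] --> a.
Proof.
move=> vB.
have bv : bounded_fun v.
  by exists B; split; [exact: num_real|move=> y By n _ /=; exact: (le_trans (vB n) (ltW By))].
have [f fi fc] := bolzano_weierstrass bv.
exists f; last by exists (limn (v \o f)).
move=> a b; rewrite !ltnNge; apply: contra => fab.
by have := fi b a; rewrite /Order.le /= => <-.
Qed.

Lemma diagonal_subseq (v : nat -> nat -> R) (B : nat -> R) :
  (forall l n, `|v l n| <= B l) ->
  exists2 k, {homo k : a b / (a < b)%N} &
    forall l, exists a : R, v l (k n) @[n --> \oo] --> a.
Proof.
move=> vB.
have S l (s : nat -> nat) : exists t, {homo t : a b / (a < b)%N} /\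
    exists a : R, v l (s (t n)) @[n --> \oo] --> a.
  by have [t ? ?] := @bounded_cvg_subseq (v l \o s) (B l) (fun n => vB l _); exists t.
pose tau l s := projT1 (cid (S l s)).
have tauI l s : {homo tau l s : a b / (a < b)%N} := (projT2 (cid (S l s))).1.
have tauC l s := (projT2 (cid (S l s))).2; rewrite -/(tau _ _) in tauC.
(* [sg l] is the subsequence after [l] extractions; the sequence [v l] converges along [sg l.+1]. *)
pose sg := fix sg l := if l is l'.+1 then sg l' \o tau l' (sg l') else id.
have sgI l : {homo sg l : a b / (a < b)%N}.
  by elim: l => //= l IH a b ab; apply/IH/tauI.
(* Entries of a later subsequence are entries of an earlier one at no smaller index; this places the
   tail of the diagonal inside every [sg l]. *)
have sub l r n : exists2 t, (n <= t)%N & sg (l + r)%N n = sg l t.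
  elim: r n => [|r IH] n; first by exists n; rewrite ?addn0.
  have [t nt E] := IH (tau (l + r)%N (sg (l + r)%N) n).
  exists t; first exact: leq_trans (increasing_ge (@tauI _ _) n) nt.
  by rewrite addnS /= E.
exists (fun n => sg n n).
  suff H n : (sg n n < sg n.+1 n.+1)%N.
    by apply: (homo_ltn _ H) => y x z; exact: ltn_trans.
  apply: sgI; apply: leq_trans (increasing_ge (@tauI _ _) n.+1).
  exact: ltnSn.
move=> l; have [a /cvgrPdist_le Ha] := tauC l (sg l); exists a.
apply/cvgrPdist_le => e e0; have [M _ HM] := Ha e e0.
exists (maxn M l.+1) => // n /=; rewrite geq_max => /andP[Mn ln].
have [t nt] := sub l.+1 (n - l.+1)%N n.
rewrite subnKC// => ->; apply: HM => /=; exact: leq_trans Mn nt.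
Qed.

(** Cauchy criterion with [e / 3]: it reduces convergence for a general test function to convergence
    for its averages. *)
Lemma cvg_approx v : (forall e, 0 < e -> exists w (a : R),
    w n @[n --> \oo] --> a /\ forall n, `|v n - w n| <= e) ->
  exists a : R, v n @[n --> \oo] --> a.
Proof.
move=> H; exists (limn v).
suff : cauchy_ex (v n @[n --> \oo]) by move/cauchy_exP/cauchy_cvgP.
move=> e e0; have e3 : 0 < e / 3 by rewrite divr_gt0.
have [w [a [/cvgrPdist_le wa vw]]] := H _ e3.
exists a; have [M _ HM] := wa _ e3; exists M => // n /= Mn.
rewrite /ball /= (_ : a - v n = (a - w n) - (v n - w n)); last by ring.
apply: (le_lt_trans (ler_normB _ _)).
apply: (le_lt_trans (lerD (HM n Mn) (vw n))).
by lra.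
Qed.

Lemma cvg_norm_le v (a B : R) : v n @[n --> \oo] --> a -> (forall n, `|v n| <= B) ->
  `|a| <= B.
Proof.
move=> va vB; have na : `|v n| @[n --> \oo] --> `|a| by exact: cvg_norm va.
by apply: (cvgr_to_le na); apply: nearW.
Qed.

Lemma cvg_sumr (I : Type) (r : seq I) (F : I -> nat -> R) (a : I -> R) :
  (forall i, F i n @[n --> \oo] --> a i) ->
  (\sum_(i <- r) F i n) @[n --> \oo] --> \sum_(i <- r) a i.
Proof.
move=> H; elim: r => [|i r IH].
  rewrite big_nil (_ : (fun n => _) = cst 0); first exact: cvg_cst.
  by apply/funext => n; rewrite big_nil.
rewrite big_cons (_ : (fun n => _) = (fun n => F i n + \sum_(j <- r) F j n)).
  exact: cvgD (H i) IH.
by apply/funext => n; rewrite big_cons.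
Qed.

End diagonal.

(** * Extraction of weakly convergent subsequences *)

Section weak_compactness.
Context {R : realType} {d : nat}.
Local Notation X := 'rV[R]_d.
Local Notation mu := (@cube R d).
Local Notation intb f := (mu.-integrable setT (EFin \o f)).
Implicit Types (f g w phi : X -> R) (x y z : X) (i j : 'I_d) (c p C : R).

(** The functions [c n k] come from the separation of [rho n] and do not depend on [w]: countably
    many test functions whose spans contain all averages. Indices beyond the rank get the zero
    function. *)
Lemma moll_family : exists (c : nat -> nat -> X -> R) (r : nat -> nat),
  (forall n k, Cinf (c n k)) /\ forall n w, intb w -> exists t : nat -> R,
    forall x, moll n w x = \sum_(k < r n) t k * c n k x.
Proof.
have H n : exists (cr : (nat -> X -> R) * nat), (forall k, Cinf (cr.1 k)) /\
  forall w, intb w -> exists t : nat -> R,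
    forall x, moll n w x = \sum_(k < cr.2) t k * cr.1 k x.
  have [I [a [b [Ca Cb _ E]]]] := @moll_sep R d n.
  exists (fun k => if insub k is Some k' then a (enum_val (k' : 'I_#|I|)) else cst 0, #|I|).
  split => [k /=|w hw]; first by case: insubP => [k' _ _|_]; [exact: Ca|exact: Cinf_cst].
  exists (fun k => if insub k is Some k' then
    \int[mu]_z (w z * b (enum_val (k' : 'I_#|I|)) z) else 0) => x.
  rewrite E// (reindex _ (onW_bij _ (@enum_val_bij I))) /=.
  by apply: eq_bigr => k _; rewrite valK mulrC.
exists (fun n => (projT1 (cid (H n))).1), (fun n => (projT1 (cid (H n))).2).
by split => n; case: (projT2 (cid (H n))).
Qed.

Lemma Lpow_cvg_subseq p q K (f_ : nat -> X -> R) : 1 < p -> 1 < q ->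
  p^-1 + q^-1 = 1 -> (forall n, Lpow mu q (f_ n)) ->
  (forall n, \int[mu]_x (`|f_ n x| `^ q) <= K) ->
  exists2 k, {homo k : a b / (a < b)%N} & forall w, Lpow mu p w ->
    exists a : R, (\int[mu]_x (f_ (k n) x * w x)) @[n --> \oo] --> a.
Proof.
move=> p1 q1 pq Lf fK.
have p0 : 0 < p by apply: lt_trans p1.
have q0 : 0 < q by apply: lt_trans q1.
have qp : q^-1 + p^-1 = 1 by rewrite addrC.
have hf n : intb (f_ n) by apply/Lpow1; exact: (Lpow_le ler01 (ltW q1) (Lf n)).
have K0 : 0 <= K.
  by apply: le_trans (fK 0%N); apply: Rint_ge0 => x; exact: powR_ge0.
have [c [r [Cc E]]] := moll_family.
(* One diagonal extraction handles all pairs [(N, k)], coded by integers; an integer that codes no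
   pair gives the zero sequence. *)
pose v l n := if unpickle l is Some (N, k) then \int[mu]_x (f_ n x * c N k x) else 0.
have vB l : exists B, forall n, `|v l n| <= B.
  rewrite /v; case: (unpickle l) => [[N k]|]; last by exists 0 => n; rewrite normr0.
  have Lc : Lpow mu p (c N k) by apply: Lpow_Cinf => //; exact: ltW.
  exists (K `^ q^-1 * (\int[mu]_x (`|c N k x| `^ p)) `^ p^-1) => n.
  apply: (le_trans (hoelder_Rint q0 p0 qp (Lf n) Lc)).
  rewrite ler_wpM2r ?powR_ge0// ge0_ler_powR ?nnegrE ?invr_ge0 ?(ltW q0)//.
  by apply: Rint_ge0 => x; exact: powR_ge0.
have [k kI kC] := diagonal_subseq (fun l n => projT2 (cid (vB l)) n).
exists k => // w Lw.
have hw : intb w by apply/Lpow1; exact: (Lpow_le ler01 (ltW p1) Lw).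
apply: cvg_approx => e e0.
have e2 : 0 < e / 2 by rewrite divr_gt0.
have K1 : 0 < K + 1 by rewrite ltr_wpDl.
(* Makes [lam ^ q * K] at most [e / 2], uniformly along the sequence; the kernel index [N] is chosen
   afterwards. *)
pose lam := (e / 2 / (K + 1)) `^ q^-1.
have lam0 : 0 < lam by rewrite powR_gt0// divr_gt0.
have lamq : lam `^ q = e / 2 / (K + 1).
  by rewrite /lam -powRrM mulVf ?gt_eqF// powRr1// ltW// divr_gt0.
have L0 : 0 < lam^-1 `^ p by rewrite powR_gt0// invr_gt0.
have ov : osc p n w @[n --> \oo] --> 0 by apply: oscillation_vanishes (ltW p1) Lw.
have /cvgrPdist_le/(_ _ (divr_gt0 e2 L0))[N _ /(_ N (leqnn N))] := ov.
rewrite sub0r normrN ger0_norm ?osc_ge0// ler_pdivlMr// => HN.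
have [t Et] := E N w hw.
have CM : Cinf (moll N w) by exact: Cinf_moll.
pose a (j : nat) := projT1 (cid (kC (pickle (N, j)))).
have Ha (j : nat) : (\int[mu]_x (f_ (k n) x * c N j x)) @[n --> \oo] --> a j.
  have vE : v (pickle (N, j)) = fun n => \int[mu]_x (f_ n x * c N j x).
    by apply/funext => n; rewrite /v pickleK.
  by have := projT2 (cid (kC (pickle (N, j)))); rewrite -/(a j) vE.
exists (fun n => \sum_(j < r N) t j * \int[mu]_x (f_ (k n) x * c N j x)).
exists (\sum_(j < r N) t j * a j); split.
  by apply: cvg_sumr => j; apply: cvgMr; exact: Ha.
move=> n.
have iM : intb (fun x => f_ (k n) x * moll N w x) by exact: intbM_Cinf.
have iw : intb (fun x => f_ (k n) x * w x) by exact: (Lpow_intbM q0 p0 qp (Lf _) Lw).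
have -> : \sum_(j < r N) t j * \int[mu]_x (f_ (k n) x * c N j x) =
    \int[mu]_x (f_ (k n) x * moll N w x).
  transitivity (\int[mu]_x \sum_(j < r N) (t j * (f_ (k n) x * c N j x))).
    rewrite Rint_sum; last by move=> j; apply: intbZ; exact: intbM_Cinf.
    by apply: eq_bigr => j _; rewrite RintZ//; exact: intbM_Cinf.
  apply: eq_Rintegral => x _; rewrite Et mulr_sumr.
  by apply: eq_bigr => j _; rewrite mulrCA.
rewrite distrC -(RintB iM iw).
rewrite (_ : \int[mu]_x _ = \int[mu]_x (f_ (k n) x * (moll N w x - w x))); last first.
  by apply: eq_Rintegral => x _; rewrite mulrBr.
apply: (le_trans (moll_diff_young N q0 p0 qp (ltW p1) lam0 (Lf _) Lw)).
rewrite (splitr e); apply: lerD; last by rewrite mulrC.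
rewrite lamq [leLHS]mulrAC ler_pdivrMr//.
apply: (ler_wpM2l (ltW e2)).
by apply: (le_trans (fK _)); rewrite lerDl.
Qed.

Lemma Lp_norm_frac q f : 0 < q -> Lpow mu q f ->
  Lp q (f \o @frac R d) /\
  Lp_norm q (f \o @frac R d) = (\int[mu]_x (`|f x| `^ q)) `^ q^-1.
Proof.
move=> q0 Lf; have mF : measurable_fun setT (f \o @frac R d).
  exact: (measurableT_comp Lf.1 (@measurable_frac R d)).
have fae : {ae mu, forall x, f x = (f \o @frac R d) x}.
  by move: (@frac_ae R d); apply: filterS => x /= ->.
have LF : Lpow mu q (f \o @frac R d) by exact: Lpow_ae mF fae Lf.
split; first by split; [exact: frac_periodic|exact/(LpowP mu _ q0)].
rewrite /Lp_norm (Lp_norm_pow q0 LF); apply: (congr1 (fun t : R => t `^ q^-1)).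
apply: Rint_ae; [exact: measurable_powR_abs|exact: (measurable_powR_abs _ Lf.1)|].
by move: fae; apply: filterS => x ->.
Qed.

(** [l] is constrained on periodic functions only. Composition with [frac] extends it to all
    functions in L^q, where [riesz] applies, and changes nothing on periodic ones. *)
Lemma bounded_functional_repr p q (l : (X -> R) -> R) : 1 < p -> 1 < q ->
  p^-1 + q^-1 = 1 -> bounded_functional (Lp q) (@Lp_norm R d q) l ->
  exists2 w, Lpow mu p w & forall f, Lp q f -> l f = \int[mu]_x (f x * w x).
Proof.
move=> p1 q1 pq [lin [C bd]]; have q0 : 0 < q by apply: lt_trans q1.
have LL : lin_bdd mu q C (fun f => l (f \o @frac R d)).
  split => [c f g Lf Lg|f Lf].
    by rewrite -lin//; [exact: (Lp_norm_frac q0 Lf).1|exact: (Lp_norm_frac q0 Lg).1].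
  by have [L <-] := Lp_norm_frac q0 Lf; exact: bd.
have qp : q^-1 + p^-1 = 1 by rewrite addrC.
have [w Lw Hw] := riesz q1 LL qp.
exists w => // f [pf /(LpowP mu _ q0) Lf].
rewrite -Hw//; congr l; apply/funext => x /=.
by rewrite periodic_frac.
Qed.

(** The limits of the pairings define a functional on L^p, bounded by [K ^ (1 / q)] through Hoelder;
    the function representing it is the weak limit, made periodic by [frac]. *)
Lemma weak_compactness p q K (f_ : nat -> X -> R) : 1 < p -> 1 < q ->
  p^-1 + q^-1 = 1 -> (forall n, Lp q (f_ n)) ->
  (forall n, \int[mu]_x (`|f_ n x| `^ q) <= K) ->
  exists2 k, {homo k : a b / (a < b)%N} & exists2 J, Lp q J &
    forall w, Lpow mu p w ->
      (\int[mu]_x (f_ (k n) x * w x)) @[n --> \oo] --> \int[mu]_x (J x * w x).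
Proof.
move=> p1 q1 pq Lf fK.
have p0 : 0 < p by apply: lt_trans p1.
have q0 : 0 < q by apply: lt_trans q1.
have qp : q^-1 + p^-1 = 1 by rewrite addrC.
have Lf' n : Lpow mu q (f_ n) by have [_ /(LpowP mu _ q0)] := Lf n.
have [k kI kC] := Lpow_cvg_subseq p1 q1 pq Lf' fK.
exists k => //.
pose L w := limn (fun n => \int[mu]_x (f_ (k n) x * w x)).
have HL w : Lpow mu p w -> (\int[mu]_x (f_ (k n) x * w x)) @[n --> \oo] --> L w.
  by move=> /kC[a Ha]; rewrite /L (cvg_lim (@Rhausdorff R) Ha).
have iM n w : Lpow mu p w -> intb (fun x => f_ (k n) x * w x).
  by move=> Lw; exact: (Lpow_intbM q0 p0 qp (Lf' _) Lw).
have LL : lin_bdd mu p (K `^ q^-1) L.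
  split => [c w w' Lw Lw'|w Lw].
    have Lc : Lpow mu p (fun x => c * w x + w' x).
      exact: LpowD (ltW p0) (LpowZ c Lw) Lw'.
    apply: cvg_eq (HL _ Lc) _.
    rewrite (_ : (fun n => _) = (fun n => c * \int[mu]_x (f_ (k n) x * w x) +
      \int[mu]_x (f_ (k n) x * w' x))).
      by apply: cvgD (HL _ Lw'); apply: cvgMr; exact: HL.
    apply/funext => n; rewrite -(RintZ c (iM n w Lw)) -RintD; [|exact: intbZ (iM n w Lw)|exact: iM].
    by apply: eq_Rintegral => x _; rewrite mulrDr mulrCA.
  apply: (cvg_norm_le (HL w Lw)) => n.
  apply: (le_trans (hoelder_Rint q0 p0 qp (Lf' _) Lw)).
  rewrite ler_wpM2r ?powR_ge0// ge0_ler_powR ?nnegrE ?invr_ge0 ?(ltW q0)//.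
    by apply: Rint_ge0 => x; exact: powR_ge0.
  by apply: le_trans (fK 0%N); apply: Rint_ge0 => x; exact: powR_ge0.
have [J LJ HJ] := riesz p1 LL pq.
exists (J \o @frac R d); first exact: (Lp_norm_frac q0 LJ).1.
move=> w Lw; rewrite (_ : \int[mu]_x _ = L w); first exact: HL.
rewrite HJ//.
have mF : measurable_fun setT (J \o @frac R d).
  exact: (measurableT_comp LJ.1 (@measurable_frac R d)).
apply: Rint_ae.
- exact: measurable_funM mF Lw.1.
- exact: measurable_funM Lw.1 LJ.1.
by move: (@frac_ae R d); apply: filterS => x /= ->; rewrite mulrC.
Qed.

End weak_compactness.

(** * Weak convergence of vector fields by coordinates *)

Section vector_fields.
Context {R : realType} {d : nat}.
Local Notation X := 'rV[R]_d.
Local Notation mu := (@cube R d).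
Local Notation intb f := (mu.-integrable setT (EFin \o f)).
Implicit Types (f g w phi : X -> R) (x y z : X) (i j : 'I_d) (c p C : R).

Lemma enorm_scale_basis c i : enorm (c *: basis_vec i : X) = `|c|.
Proof.
rewrite /enorm (bigD1 i)//= big1 ?addr0; last first.
  by move=> j ji; rewrite !mxE eqxx /= (negbTE ji) mulr0 expr0n.
by rewrite !mxE !eqxx mulr1 sqrtr_sqr.
Qed.

Lemma weak_compactness_vec p q K (F_ : nat -> X -> X) : 1 < p -> 1 < q ->
  p^-1 + q^-1 = 1 -> (forall n, Lp_vec q (F_ n)) ->
  (forall n i, \int[mu]_x (`|F_ n x 0 i| `^ q) <= K) ->
  exists2 k, {homo k : a b / (a < b)%N} & exists2 J, Lp_vec q J &
    forall i w, Lpow mu p w ->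
      (\int[mu]_x (F_ (k n) x 0 i * w x)) @[n --> \oo] --> \int[mu]_x (J x 0 i * w x).
Proof.
move=> p1 q1 pq LF FK.
suff [k kI H] : exists2 k : nat -> nat, {homo k : a b / (a < b)%N} &
    forall i, i \in enum 'I_d -> exists2 J, Lp q J & forall w, Lpow mu p w ->
      (\int[mu]_x (F_ (k n) x 0 i * w x)) @[n --> \oo] --> \int[mu]_x (J x * w x).
  exists k => //.
  have H' i : exists J, Lp q J /\ forall w, Lpow mu p w ->
      (\int[mu]_x (F_ (k n) x 0 i * w x)) @[n --> \oo] --> \int[mu]_x (J x * w x).
    by have [J ? ?] := H i (mem_enum _ i); exists J.
  have [J HJ] := choice H'.
  have E i : (fun x => (\row_j J j x : X) 0 i) = J i by apply/funext => x; rewrite mxE.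
  exists (fun x => \row_j J j x) => [i|i w Lw]; first by rewrite E; exact: (HJ i).1.
  rewrite (_ : \int[mu]_x _ = \int[mu]_x (J i x * w x)); first exact: (HJ i).2.
  by apply: eq_Rintegral => x _; rewrite mxE.
elim: (enum 'I_d) => [|i s [k kI IH]]; first by exists id.
have Li n : Lp q (fun x => F_ (k n) x 0 i) by exact: LF.
have [t tI [J LJ HJ]] := weak_compactness p1 q1 pq Li (fun n => FK (k n) i).
exists (k \o t) => [a b ab /=|j]; first exact/kI/tI.
rewrite inE => /predU1P[->|js]; first by exists J.
have [J' LJ' HJ'] := IH j js; exists J' => // w Lw.
exact: (cvg_subseq_ge (increasing_ge tI) (HJ' w Lw)).
Qed.

Lemma Lp_vec_scale q i phi : Lp q phi -> Lp_vec q (fun x => phi x *: basis_vec i : X).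
Proof.
move=> [pp mp] j.
have E : (fun x => (phi x *: basis_vec i : X) 0 j) = (fun x => (j == i)%:R * phi x).
  by apply/funext => x; rewrite !mxE eqxx /= mulrC.
rewrite E; split; first by move=> x k; rewrite pp.
case: (j == i).
  by rewrite (_ : (fun x => _) = phi)//; apply/funext => x; rewrite mul1r.
rewrite (_ : (fun x => _) = cst 0); first exact: Lfun_cst.
by apply/funext => x; rewrite mul0r.
Qed.

Lemma Lp_vecD q (F G : X -> X) : 0 < q -> Lp_vec q F -> Lp_vec q G ->
  Lp_vec q (fun x => F x + G x).
Proof.
move=> q0 LF LG i.
have [pF /(LpowP mu _ q0) lF] := LF i; have [pG /(LpowP mu _ q0) lG] := LG i.
rewrite (_ : (fun x => _) = (fun x => F x 0 i + G x 0 i)); last first.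
  by apply/funext => x; rewrite mxE.
split; first by move=> x k; rewrite pF pG.
by apply/(LpowP mu _ q0); exact: LpowD (ltW q0) lF lG.
Qed.

(** The Euclidean norm of a field along one axis is the absolute value of its coordinate, so
    functionals on vector fields reduce to scalar ones. *)
Lemma bounded_functional_slice q (l : (X -> X) -> R) i : 0 < q ->
  bounded_functional (Lp_vec q) (@Lp_vec_norm R d q) l ->
  bounded_functional (Lp q) (@Lp_norm R d q) (fun phi => l (fun x => phi x *: basis_vec i)).
Proof.
move=> q0 [lin [C bd]]; split => [c f g Lf Lg|].
  rewrite -lin; [|exact: Lp_vec_scale|exact: Lp_vec_scale].
  congr l; apply/funext => x /=.
  by rewrite !fctE scalerDl scalerA.
exists C => f Lf; apply: (le_trans (bd _ (Lp_vec_scale i Lf))).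
rewrite (_ : Lp_vec_norm q _ = Lp_norm q f)//.
rewrite /Lp_vec_norm (_ : enorm \o _ = (fun x => `|f x|)); last first.
  by apply/funext => x /=; rewrite enorm_scale_basis.
have Lf' : Lpow mu q f by case: Lf => _ /(LpowP mu _ q0).
have Ln : Lpow mu q (fun x => `|f x|).
  split; first exact: measurableT_comp Lf'.1.
  by apply: intb_ext Lf'.2 => x; rewrite normr_id.
rewrite /Lp_norm (Lp_norm_pow q0 Lf') (Lp_norm_pow q0 Ln).
apply: (congr1 (fun t : R => t `^ q^-1)).
by apply: eq_Rintegral => x _; rewrite normr_id.
Qed.

Lemma bounded_functional_sum q (l : (X -> X) -> R) (F : X -> X) : 0 < q ->
  bounded_functional (Lp_vec q) (@Lp_vec_norm R d q) l -> Lp_vec q F ->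
  l F = \sum_i l (fun x => F x 0 i *: basis_vec i).
Proof.
move=> q0 [lin _] LF.
have L0 : Lp_vec q (fun _ => 0 : X).
  move=> i; rewrite (_ : (fun x => _) = cst 0).
    by split => //; exact: Lfun_cst.
  by apply/funext => x; rewrite mxE.
have l0 : l (fun _ => 0) = 0.
  have := lin 1 _ _ L0 L0; rewrite mul1r (_ : 1 *: _ + _ = (fun _ => 0 : X)).
    by move/eqP; rewrite -subr_eq subrr => /eqP.
  by apply/funext => x; rewrite !fctE scaler0 addr0.
have Ls i : Lp_vec q (fun x => F x 0 i *: basis_vec i) by exact: Lp_vec_scale.
transitivity (l (fun x => \sum_i F x 0 i *: basis_vec i)).
  by congr l; apply/funext => x; rewrite [LHS]row_sum_delta.
suff [] : Lp_vec q (fun x => \sum_(i <- index_enum 'I_d) F x 0 i *: basis_vec i) /\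
    l (fun x => \sum_(i <- index_enum 'I_d) F x 0 i *: basis_vec i) =
    \sum_(i <- index_enum 'I_d) l (fun x => F x 0 i *: basis_vec i) by [].
elim: (index_enum 'I_d) => [|i s [LIH IH]].
  rewrite big_nil (_ : (fun x => _) = (fun _ => 0)) ?l0//.
  by apply/funext => x; rewrite big_nil.
rewrite big_cons -IH (_ : (fun x => _) = (fun x => F x 0 i *: basis_vec i +
    \sum_(j <- s) F x 0 j *: basis_vec j)); last first.
  by apply/funext => x; rewrite big_cons.
split; first exact: Lp_vecD.
have := lin 1 _ _ (Ls i) LIH; rewrite mul1r => <-; congr l.
by apply/funext => x; rewrite !fctE scale1r.
Qed.

Lemma weak_cvg_vec p q (F_ : nat -> X -> X) (J : X -> X) : 1 < p -> 1 < q ->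
  p^-1 + q^-1 = 1 -> (forall n, Lp_vec q (F_ n)) -> Lp_vec q J ->
  (forall i w, Lpow mu p w ->
    (\int[mu]_x (F_ n x 0 i * w x)) @[n --> \oo] --> \int[mu]_x (J x 0 i * w x)) ->
  weak_cvg (Lp_vec q) (@Lp_vec_norm R d q) F_ J.
Proof.
move=> p1 q1 pq LF LJ H; have q0 : 0 < q by apply: lt_trans q1.
split => // l bl.
have hs i := bounded_functional_repr p1 q1 pq (bounded_functional_slice i q0 bl).
rewrite (bounded_functional_sum q0 bl LJ).
rewrite (_ : (fun n => _) = (fun n => \sum_i l (fun x => F_ n x 0 i *: basis_vec i))).
  apply: cvg_sumr => i; have [w Lw Hw] := hs i.
  rewrite (Hw _ (LJ i)) (_ : (fun n => _) = (fun n => \int[mu]_x (F_ n x 0 i * w x))).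
    exact: H.
  by apply/funext => n; rewrite (Hw _ (LF n i)).
by apply/funext => n; exact: bounded_functional_sum q0 bl (LF n).
Qed.

End vector_fields.

(** * Measurability of compositions with the Hamiltonian *)

Section product_coordinates.
Context {R : realType}.

Lemma coord_system_prod (Y1 Y2 : topologicalType) (J1 J2 : finType)
    (c1 : J1 -> Y1 -> R) (c2 : J2 -> Y2 -> R) :
  coord_system c1 -> coord_system c2 ->
  coord_system (fun (j : J1 + J2) (y : Y1 * Y2) =>
    match j with inl j => c1 j y.1 | inr j => c2 j y.2 end).
Proof.
move=> H1 H2 P oP [y1 y2] Py; have : nbhs (y1, y2) P by exact: open_nbhs_nbhs.
move=> [[A B] /= [nA nB] AB].
move: nA nB; rewrite !nbhsE => -[A' [oA Ay] sA] [B' [oB By] sB].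
have [e1 e10 He1] := H1 A' oA y1 Ay.
have [e2 e20 He2] := H2 B' oB y2 By.
exists (Num.min e1 e2); first by rewrite lt_min e10.
move=> [z1 z2] Hz; apply: AB; split => /=.
  apply: sA; apply: He1 => j; have := Hz (inl j).
  by rewrite lt_min => /andP[].
apply: sB; apply: He2 => j; have := Hz (inr j).
by rewrite lt_min => /andP[].
Qed.

Lemma coord_system_real : coord_system (fun (_ : unit) (x : R) => x).
Proof.
move=> P oP x Px; have : nbhs x P by exact: open_nbhs_nbhs.
move=> /nbhs_ballP[e /= e0 He]; exists e => // y Hy; apply: He.
by rewrite /ball/= distrC; exact: (Hy tt).
Qed.

End product_coordinates.

Section structure.
Context {R : realType} {d : nat}.
Local Notation X := 'rV[R]_d.
Local Notation mu := (@cube R d).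
Implicit Types (m th : X -> R) (p : X -> X) (i j : 'I_d).
Local Notation Z := (X * X * R * R)%type.

Definition locally_continuous (Y : topologicalType) (S : set Y) (F : Y -> R) :=
  forall y, S y -> forall e : R, 0 < e -> exists O : set Y, [/\ open O, O y &
     forall y', O y' -> S y' -> `|F y' - F y| < e].

Lemma locally_continuousP (V : normedModType R) (S : set V) (F : V -> R) :
  (forall x, S x -> exists (U : set V) (G : V -> R),
    [/\ open U, U x, {for x, continuous G} & forall y, U y -> S y -> F y = G y]) ->
  locally_continuous S F.
Proof.
move=> H x Sx e e0; have [U [G [oU Ux cG E]]] := H x Sx.
have /cvgrPdist_lt/(_ e e0) := cG.
rewrite nearE nbhsE => -[P [oP Px] HP]; exists (U `&` P); split => //.
  exact: openI.
by move=> y [Uy Py] Sy; rewrite !E// distrC; exact: HP.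
Qed.

Lemma smooth_on_locally_continuous (V : normedModType R) (S : set V) (F : V -> R) :
  smooth_on S F -> locally_continuous S F.
Proof.
move=> H; apply: locally_continuousP => x Sx.
have [U [G [oU Ux CG E]]] := H x Sx; exists U, G; split => //.
  by have [cG _] := CG 0%N; exact: cG.
by move=> y Uy Sy; rewrite E.
Qed.

Lemma measurable_along (S : set Z) (F : Z -> R) p m th :
  locally_continuous S F -> (forall i, measurable_fun setT (fun x => p x 0 i)) ->
  measurable_fun setT m -> measurable_fun setT th ->
  (forall x, S (x, p x, m x, th x)) ->
  measurable_fun setT (fun x => F (x, p x, m x, th x)).
Proof.
move=> cF mp mm mth HS.
pose cs := coord_system_prod (coord_system_prod (coord_system_prod
  (@coord_system_row R d) (@coord_system_row R d)) (@coord_system_real R))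
  (@coord_system_real R).
apply: (measurable_continuous_comp cs (f := fun x => (x, p x, m x, th x)) _ HS cF).
move=> [[[j|j]|j]|j] //=; first exact: measurable_coord.
exact: mp.
Qed.

(** At a boundary point of [E], [H0] is only the restriction of a smooth [G]. Varying [p] alone
    keeps [m] in [E], so the derivative of [H0] in [p] is a directional derivative of [G], which is
    continuous. *)
Lemma locally_continuous_pderiv (E : set R) (H0 : X -> X -> R -> R -> R) i :
  smooth_on [set z : Z | E z.1.2] (fun z => H0 z.1.1.1 z.1.1.2 z.1.2 z.2) ->
  locally_continuous [set z : Z | E z.1.2] (fun z =>
    'D_(basis_vec i) (fun p' : X => H0 z.1.1.1 p' z.1.2 z.2) z.1.1.2).
Proof.
move=> H; apply: locally_continuousP => x0 Sx.
have [U [G [oU Ux CG EG]]] := H x0 Sx.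
pose v : Z := (0, basis_vec i, 0, 0).
exists U, ('D_v G); split => //.
  by have [_ /(_ v)[_ [cD _]]] := CG 1%N; exact: cD.
move=> [[[x p] r] th] Uy Sy /=.
pose io (p' : X) : Z := (x, p', r, th).
have nU : \forall p' \near p, U (io p').
  have : nbhs (x, p, r, th) U by exact: open_nbhs_nbhs.
  move=> [[A B] /= [[[A1 B1] /= [[[A2 B2] /= [nA2 nB2] s2] nB1] s1] nB] s0].
  move: nB2; apply: filterS => p' Bp'; apply: s0; split => /=; last exact: nbhs_singleton nB.
  apply: s1; split => /=; last exact: nbhs_singleton nB1.
  by apply: s2; split => //=; exact: nbhs_singleton nA2.
transitivity ('D_(basis_vec i) (G \o io) p).
  apply: near_eq_derive.
  by move: nU; apply: filterS => p' Up' /=; rewrite (EG (io p')).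
have EGh h : G (io (h *: basis_vec i + p)) = G (h *: v + (x, p, r, th)).
  by congr G; rewrite /io /v /=; congr (_, _, _, _); rewrite /= scaler0 add0r.
apply: (congr1 (fun k : R -> R => lim (k @ 0^'))).
by apply/funext => h /=; rewrite EGh.
Qed.
End structure.

(** * Energy estimate *)

Section energy.
Context {R : realType} {d : nat}.
Local Notation X := 'rV[R]_d.
Local Notation mu := (@cube R d).
Local Notation intb f := (mu.-integrable setT (EFin \o f)).
Implicit Types (f g w phi m u : X -> R) (x y z : X) (i j : 'I_d) (c p C : R).

Lemma Lpow2_bddM f g C : Lpow mu 2 f -> measurable_fun setT g ->
  {ae mu, forall x, `|g x| <= C} -> Lpow mu 2 (fun x => f x * g x).
Proof.
move=> [mf lf] mg gC; split; first exact: measurable_funM.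
have mfg : measurable_fun setT (fun x => f x * g x) by exact: measurable_funM.
apply: (intb_ae_le (measurable_powR_abs _ mfg) _ (intbZ (`|C| `^ 2) lf)).
move: gC; apply: filterS => x gC.
rewrite ger0_norm ?powR_ge0// normrM powRM// mulrC ler_wpM2r ?powR_ge0//.
by rewrite ge0_ler_powR ?nnegrE// (le_trans gC)// ler_norm.
Qed.

Lemma Lpow_cst p c : 0 <= p -> Lpow mu p (cst c).
Proof. by move=> p0; apply: (@Lpow_bdd _ _ _ _ _ _ `|c|). Qed.

Lemma Lpow2_intb f : Lpow mu 2 f -> intb f.
Proof. by move=> Lf; apply/Lpow1; apply: Lpow_le Lf => //; rewrite ler1n. Qed.

Lemma Rint_wlap0 k f : wsob k.+2 2 f -> \int[mu]_x wlap f x = 0.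
Proof.
move=> H.
have hD t : (size t <= k.+2)%N -> intb (wD t f) by move=> /H[/weak_derivE[]].
rewrite /wlap Rint_sum; last by move=> i; exact: hD.
apply: big1 => i _.
have [_ _ /(_ (cst 1) (Cinf_cst 1)) E] := wsob_wderiv i H (isT : (size [:: i] < k.+2)%N).
transitivity (\int[mu]_x (wD [:: i; i] f x * (cst 1 : X -> R) x)).
  by apply: eq_Rintegral => x _; rewrite mulr1.
rewrite E (_ : \int[mu]_x _ = 0) ?oppr0// -[RHS](Rint_zero mu).
by apply: eq_Rintegral => x _; rewrite /pderiv derive_cst mulr0.
Qed.

Lemma cvg_combination (e1 e2 : R) (s1 s2 s3 s4 s5 s6 s7 : nat -> R)
    (a1 a2 a3 a4 a5 a6 a7 : R) :
  s1 n @[n --> \oo] --> a1 -> s2 n @[n --> \oo] --> a2 -> s3 n @[n --> \oo] --> a3 ->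
  s4 n @[n --> \oo] --> a4 -> s5 n @[n --> \oo] --> a5 -> s6 n @[n --> \oo] --> a6 ->
  s7 n @[n --> \oo] --> a7 ->
  s1 n + s2 n + s3 n - s4 n + e1 * (s5 n + s6 n) + e2 * (s5 n - s7 n) @[n --> \oo] -->
  a1 + a2 + a3 - a4 + e1 * (a5 + a6) + e2 * (a5 - a7).
Proof.
move=> c1 c2 c3 c4 c5 c6 c7; apply: cvgD; last by apply: cvgMr; exact: cvgB c5 c7.
apply: cvgD; last by apply: cvgMr; exact: cvgD c5 c6.
by apply: cvgB c4; exact: cvgD (cvgD c1 c2) c3.
Qed.

(** The Hamiltonian and its derivatives along the solution enter as plain functions [Hx], [b], [A].
    The bounds [Cb] and [CA] put [m b] and [m A] in L^2, so that they pair with the derivatives of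
    [u]; the conclusion is free of them. *)
Lemma energy_inequality N m u (Hx bet : X -> R) (b : 'I_d -> X -> R)
    (A : 'I_d -> 'I_d -> X -> R) (e1 e2 Cb CA : R) :
  (0 < N)%N ->
  wsob (4 * N) 2 m -> wsob (4 * N) 2 u -> (forall x, 0 <= m x) ->
  0 < e1 < 1 -> 0 < e2 < 1 ->
  (forall i, measurable_fun setT (b i)) -> (forall i, {ae mu, forall x, `|b i x| <= Cb}) ->
  (forall i j, measurable_fun setT (A i j)) -> (forall i j x, `|A i j x| <= CA) ->
  measurable_fun setT Hx -> Lpow mu 2 bet -> (forall x, 0 <= bet x * (m x - 1)) ->
  {ae mu, forall x, - u x - Hx x + e1 * (m x + iter (2 * N) wlap m x)
    + e2 * (m x - wlap m x) + bet x = 0} ->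
  (forall phi, Cinf phi ->
    \int[mu]_x (m x * phi x) + \sum_i \int[mu]_x (m x * b i x * pderiv i phi x)
    + \sum_i \sum_j \int[mu]_x (m x * A i j x * pderiv i (pderiv j phi) x)
    - \int[mu]_x (1 * phi x)
    + e1 * (\int[mu]_x (u x * phi x) + \int[mu]_x (iter (2 * N) wlap u x * phi x))
    + e2 * (\int[mu]_x (u x * phi x) - \int[mu]_x (wlap u x * phi x)) = 0) ->
  Lpow mu 2 Hx /\
  \int[mu]_x (m x * (- Hx x + \sum_i b i x * wD [:: i] u x +
     \sum_i \sum_j A i j x * wD [:: j; i] u x)) + \int[mu]_x Hx x <= 2 * \int[mu]_x m x.
Proof.
move=> N0.
have N4 : (1 < 4 * N)%N by lia.
have N42 : (2 <= 4 * N)%N by lia.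
have Er : (2 * N = (2 * N).-1.+1)%N by lia.
have Nr : (2 + (2 * N).-1.*2 <= 4 * N)%N by rewrite -muln2; lia.
have N0r : (0 + (2 * N).*2 <= 4 * N)%N by rewrite -muln2; lia.
move=> Wm Wu m0 e1b e2b mb bb mA bA mH Lbet bet0 eq1 eq2.
have p12 : (1 : R) <= 2 by rewrite ler1n.
have p02 : (0 : R) <= 2 by [].
have Lm := wsob_Lpow Wm; have Lu := wsob_Lpow Wu.
have Wm2 : wsob 2 2 m := wsob_le N42 Wm.
have Wu2 : wsob 2 2 u := wsob_le N42 Wu.
have iterW f : wsob (4 * N) 2 f -> wsob 0 2 (iter (2 * N) wlap f).
  by move=> Wf; exact: (wsob_iter_wlap p12 (wsob_le N0r Wf)).
have LLm := wsob_Lpow (iterW m Wm); have LLu := wsob_Lpow (iterW u Wu).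
have Ldm := wsob_Lpow (wsob_wlap p12 Wm2); have Ldu := wsob_Lpow (wsob_wlap p12 Wu2).
have Lmb i : Lpow mu 2 (fun x => m x * b i x) by exact: (Lpow2_bddM Lm (mb i) (bb i)).
have LmA i j : Lpow mu 2 (fun x => m x * A i j x).
  exact: (Lpow2_bddM Lm (mA i j) (aeW _ (bA i j))).
have LH : Lpow mu 2 Hx.
  apply: (@Lpow_ae _ _ _ mu 2 (fun x => - u x + e1 * (m x + iter (2 * N) wlap m x)
    + e2 * (m x - wlap m x) + bet x) Hx mH).
    by move: eq1; apply: filterS => x E; rewrite -[RHS]add0r -E; ring.
  exact: (LpowD p02 (LpowD p02 (LpowD p02 (LpowN Lu) (LpowZ e1 (LpowD p02 Lm LLm)))
    (LpowZ e2 (LpowB p02 Lm Ldm))) Lbet).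
split => //.
have LDu i : Lpow mu 2 (wD [:: i] u) by case: (Wu2 [:: i] isT).
have LDDu i j : Lpow mu 2 (wD [:: i; j] u) by case: (Wu2 [:: i; j] isT).
have [_ hu _] := wsob_base Wu.
have wu0 i := wsob_wderiv0 i (wsob_le N4 Wu).
have wu1 i j : wderiv i (wD [:: j] u) (wD [:: i; j] u).
  exact: (wsob_wderiv i Wu2 (isT : (size [:: j] < 2)%N)).
(* The second equation tested with [u], as the limit of its mollifications. *)
have E2 : \int[mu]_x (m x * u x) + \sum_i \int[mu]_x (m x * b i x * wD [:: i] u x)
    + \sum_i \sum_j \int[mu]_x (m x * A i j x * wD [:: i; j] u x)
    - \int[mu]_x (1 * u x)
    + e1 * (\int[mu]_x (u x * u x) + \int[mu]_x (iter (2 * N) wlap u x * u x))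
    + e2 * (\int[mu]_x (u x * u x) - \int[mu]_x (wlap u x * u x)) = 0.
  (* One expression for the averaged identity and its limit: derivatives are separate arguments, so
     that averages of weak derivatives can replace derivatives of averages. *)
  pose F (f : X -> R) (f1 : 'I_d -> X -> R) (f2 : 'I_d -> 'I_d -> X -> R) : R :=
    \int[mu]_x (m x * f x) + \sum_i \int[mu]_x (m x * b i x * f1 i x)
    + \sum_i \sum_j \int[mu]_x (m x * A i j x * f2 i j x)
    - \int[mu]_x (1 * f x)
    + e1 * (\int[mu]_x (u x * f x) + \int[mu]_x (iter (2 * N) wlap u x * f x))
    + e2 * (\int[mu]_x (u x * f x) - \int[mu]_x (wlap u x * f x)).
  have Fn n : F (moll n u) (fun i => moll n (wD [:: i] u))
      (fun i j => moll n (wD [:: i; j] u)) = 0.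
    have D1 : (fun i => moll n (wD [:: i] u)) = (fun i => pderiv i (moll n u)).
      by apply/funext => i; apply/funext => x; rewrite (pderiv_moll _ _ (wu0 i)).
    have D2 : (fun i j => moll n (wD [:: i; j] u)) =
        (fun i j => pderiv i (pderiv j (moll n u))).
      apply/funext => i; apply/funext => j.
      have -> : pderiv j (moll n u) = moll n (wD [:: j] u).
        exact: esym (congr1 (fun k : 'I_d -> X -> R => k j) D1).
      by apply/funext => x; rewrite (pderiv_moll _ _ (wu1 i j)).
    exact: etrans (f_equal2 (F (moll n u)) D1 D2) (eq2 _ (Cinf_moll n hu)).
  have Fc : F (moll n u) (fun i => moll n (wD [:: i] u))
      (fun i j => moll n (wD [:: i; j] u)) @[n --> \oo] -->
      F u (fun i => wD [:: i] u) (fun i j => wD [:: i; j] u).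
    have Lc1 : Lpow mu 2 (fun _ : X => 1) by exact: Lpow_cst.
    have c1 := @cvg_sumr R _ (index_enum 'I_d)
      (fun i n => \int[mu]_x (m x * b i x * moll n (wD [:: i] u) x))
      (fun i => \int[mu]_x (m x * b i x * wD [:: i] u x))
      (fun i => moll_cvg2 (Lmb i) (LDu i)).
    have c2' i := @cvg_sumr R _ (index_enum 'I_d)
      (fun j n => \int[mu]_x (m x * A i j x * moll n (wD [:: i; j] u) x))
      (fun j => \int[mu]_x (m x * A i j x * wD [:: i; j] u x))
      (fun j => moll_cvg2 (LmA i j) (LDDu i j)).
    have c2 := @cvg_sumr R _ (index_enum 'I_d)
      (fun i n => \sum_j \int[mu]_x (m x * A i j x * moll n (wD [:: i; j] u) x))
      (fun i => \sum_j \int[mu]_x (m x * A i j x * wD [:: i; j] u x)) c2'.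
    exact: (@cvg_combination e1 e2 _ _ _ _ _ _ _ _ _ _ _ _ _ _ (moll_cvg2 Lm Lu) c1 c2 (moll_cvg2 Lc1 Lu)
      (moll_cvg2 Lu Lu) (moll_cvg2 LLu Lu) (moll_cvg2 Ldu Lu)).
  move: Fc; rewrite (_ : (fun n => _) = cst 0); last by apply/funext => n; exact: Fn.
  by move=> c0; rewrite -[LHS]/(F u (fun i => wD [:: i] u) (fun i j => wD [:: i; j] u));
    exact: cvg_eq c0 (cvg_cst 0).
have N1 := iter_wlap_ge0 N0 Wm; have N2 := iter_wlap_ge0 N0 Wu.
have D1 := wlap_le0 Wm2; have D2 := wlap_le0 Wu2.
have uu : 0 <= \int[mu]_x (u x * u x).
  by apply: Rint_ge0 => x; rewrite -expr2 sqr_ge0.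
have Z1 : \int[mu]_x iter (2 * N) wlap m x = 0.
  apply: etrans (congr1 (fun r => \int[mu]_x iter r wlap m x) Er) _.
  exact: (Rint_wlap0 (wsob_iter_wlap p12 (wsob_le Nr Wm))).
have Z2 : \int[mu]_x wlap m x = 0 by exact: (Rint_wlap0 Wm2).
have L1 : Lpow mu 2 (fun x => m x - 1) by exact: (LpowB p02 Lm (Lpow_cst 1 p02)).
have hm := Lpow2_intb Lm.
have i1 := Lpow2M Lu L1.
have i3 := Lpow2M LLm Lm.
have i4 := Lpow2_intb LLm.
have i5 := Lpow2M Ldm Lm.
have i6 := Lpow2_intb Ldm.
have iHm := Lpow2M LH L1.
have iP := intbD i1 (intbZ 2 hm).
have iQ1 := intbZ e1 (intbB i4 i3).
have iQ2 := intbZ e2 (intbB i5 i6).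
have iQ := intbD iQ1 iQ2.
have iR := intbD iP iQ.
(* First equation times [m - 1]. The Laplacians of [m] have zero mean and a sign against [m]; the
   squares [e1 * m ^ 2] and [e2 * m ^ 2] are discarded, and [e1, e2 < 1] leaves the term
   [2 * int m]. *)
have E1 : (- \int[mu]_x (Hx x * (m x - 1))) <= \int[mu]_x (u x * (m x - 1)) +
    2 * \int[mu]_x m x.
  have EN : (- \int[mu]_x (Hx x * (m x - 1))) = \int[mu]_x (- (Hx x * (m x - 1))).
    exact: esym (RintN iHm).
  rewrite EN; apply: (@le_trans _ _ (\int[mu]_x (u x * (m x - 1) + 2 * m x +
     (e1 * (iter (2 * N) wlap m x - iter (2 * N) wlap m x * m x) +
      e2 * (wlap m x * m x - wlap m x))))).
    apply: (Rint_aele (intbN iHm) iR).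
    move: eq1; apply: filterS => x E.
    have -> : Hx x = - u x + e1 * (m x + iter (2 * N) wlap m x)
      + e2 * (m x - wlap m x) + bet x by rewrite -[LHS]add0r -E; ring.
    have := bet0 x; have := m0 x; have := sqr_ge0 (m x).
    move: e1b e2b => /andP[e10 e11] /andP[e20 e21] s0 mx0 b0.
    have q1 : 0 <= e1 * m x ^+ 2 by rewrite mulr_ge0// ltW.
    have q2 : 0 <= e2 * m x ^+ 2 by rewrite mulr_ge0// ltW.
    have q3 : 0 <= m x - e1 * m x by rewrite subr_ge0 ler_piMl// ltW.
    have q4 : 0 <= m x - e2 * m x by rewrite subr_ge0 ler_piMl// ltW.
    rewrite -subr_ge0.
    set LL := iter _ _ _ _; set DD := wlap _ _.
    rewrite (_ : _ - _ = (m x - e1 * m x) + (m x - e2 * m x) + e1 * m x ^+ 2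
      + e2 * m x ^+ 2 + bet x * (m x - 1)); last by ring.
    exact: addr_ge0 (addr_ge0 (addr_ge0 (addr_ge0 q3 q4) q1) q2) b0.
  have -> : \int[mu]_x (u x * (m x - 1) + 2 * m x +
     (e1 * (iter (2 * N) wlap m x - iter (2 * N) wlap m x * m x) +
      e2 * (wlap m x * m x - wlap m x))) =
    \int[mu]_x (u x * (m x - 1)) + 2 * \int[mu]_x m x +
     (e1 * (\int[mu]_x iter (2 * N) wlap m x - \int[mu]_x (iter (2 * N) wlap m x * m x)) +
      e2 * (\int[mu]_x (wlap m x * m x) - \int[mu]_x wlap m x)).
    apply: etrans (RintD iP iQ) (f_equal2 +%R _ _).
      exact: etrans (RintD i1 (intbZ 2 hm)) (f_equal2 +%R erefl (RintZ 2 hm)).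
    apply: etrans (RintD iQ1 iQ2) (f_equal2 +%R _ _).
      exact: etrans (RintZ e1 (intbB i4 i3)) (congr1 ( *%R e1) (RintB i4 i3)).
    exact: etrans (RintZ e2 (intbB i5 i6)) (congr1 ( *%R e2) (RintB i5 i6)).
  rewrite Z1 Z2 sub0r subr0 gerDl.
  move: e1b e2b => /andP[e10 _] /andP[e20 _].
  apply: (le_trans (lerD (_ : _ <= 0) (_ : _ <= 0))); last by rewrite addr0.
    by rewrite mulrN oppr_le0; exact: mulr_ge0 (ltW e10) N1.
  exact: mulr_ge0_le0 (ltW e20) D1.
have iS1 : intb (fun x => \sum_i (m x * b i x * wD [:: i] u x)).
  by apply: intb_sum => i; exact: (Lpow2M (Lmb i) (LDu i)).
have iS2'  i : intb (fun x => \sum_j (m x * A i j x * wD [:: j; i] u x)).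
  by apply: intb_sum => j; exact: (Lpow2M (LmA i j) (LDDu j i)).
have iS2 : intb (fun x => \sum_i \sum_j (m x * A i j x * wD [:: j; i] u x)).
  by apply: intb_sum => i; exact: iS2'.
rewrite (_ : \int[mu]_x (m x * _) = \int[mu]_x (m x * - Hx x + \sum_i (m x * b i x * wD [:: i] u x)
   + \sum_i \sum_j (m x * A i j x * wD [:: j; i] u x))); last first.
  apply: eq_Rintegral => x _; rewrite !mulrDr !mulr_sumr; congr (_ + _ + _).
    by apply: eq_bigr => i _; rewrite mulrA.
  apply: eq_bigr => i _; rewrite mulr_sumr; apply: eq_bigr => j _.
  by rewrite mulrA.
have imH := Lpow2M Lm (LpowN LH).
have S1 : \int[mu]_x (\sum_i (m x * b i x * wD [:: i] u x)) =
    \sum_i \int[mu]_x (m x * b i x * wD [:: i] u x).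
  exact: (Rint_sum _ (fun i => Lpow2M (Lmb i) (LDu i))).
have S2 : \int[mu]_x (\sum_i \sum_j (m x * A i j x * wD [:: j; i] u x)) =
    \sum_i \sum_j \int[mu]_x (m x * A i j x * wD [:: i; j] u x).
  apply: (etrans (Rint_sum _ iS2')); apply: eq_bigr => i _.
  apply: (etrans (Rint_sum _ (fun j => Lpow2M (LmA i j) (LDDu j i)))); apply: eq_bigr => j _.
  apply: Rint_ae.
  - exact: measurable_funM (LmA i j).1 (LDDu j i).1.
  - exact: measurable_funM (LmA i j).1 (LDDu i j).1.
  by move: (wD_schwarz i j Wu2); apply: filterS => x ->.
have S3 : \int[mu]_x (m x * - Hx x + \sum_i (m x * b i x * wD [:: i] u x)
   + \sum_i \sum_j (m x * A i j x * wD [:: j; i] u x)) =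
   \int[mu]_x (m x * - Hx x) + \sum_i \int[mu]_x (m x * b i x * wD [:: i] u x) +
   \sum_i \sum_j \int[mu]_x (m x * A i j x * wD [:: i; j] u x).
  apply: etrans (RintD (intbD imH iS1) iS2) (f_equal2 +%R _ S2).
  exact: etrans (RintD imH iS1) (f_equal2 +%R erefl S1).
rewrite S3.
have E3 : \int[mu]_x (m x * - Hx x) + \int[mu]_x Hx x = - \int[mu]_x (Hx x * (m x - 1)).
  apply: etrans (esym (RintD imH (Lpow2_intb LH))) (etrans _ (RintN iHm)).
  by apply: eq_Rintegral => x _; ring.
have E4 : \int[mu]_x (u x * (m x - 1)) = \int[mu]_x (m x * u x) - \int[mu]_x (1 * u x).
  have hu1 : intb (fun x => 1 * u x) by apply: intb_ext hu => x; rewrite mul1r.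
  apply: etrans _ (RintB (Lpow2M Lm Lu) hu1).
  by apply: eq_Rintegral => x _; ring.
move: e1b e2b => /andP[e10 _] /andP[e20 _].
have P1' : 0 <= e1 * (\int[mu]_x (u x * u x) + \int[mu]_x (iter (2 * N) wlap u x * u x)).
  by rewrite mulr_ge0 ?addr_ge0// ltW.
have P2' : 0 <= e2 * (\int[mu]_x (u x * u x) - \int[mu]_x (wlap u x * u x)).
  by rewrite mulr_ge0 ?(ltW e20)// subr_ge0 (le_trans D2).
(* [E2] trades [int u (m - 1)] for the terms in [b] and [A]; what is left over is nonnegative by
   [P1'] and [P2']. *)
move: E2 E1 E3 E4 P1' P2'; lra.
Qed.

End energy.

(** * Derivatives of the degenerate Hamiltonian *)

Section structure_facts.
Context {R : realType} {d : nat}.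
Local Notation X := 'rV[R]_d.
Implicit Types (p : X) (i j : 'I_d).

Lemma coord_le_enorm p i : `|p 0 i| <= enorm p.
Proof.
rewrite -sqrtr_sqr ler_wsqrtr// (bigD1 i)//= lerDl sumr_ge0// => j _.
exact: sqr_ge0.
Qed.

Lemma enorm_ge0 p : 0 <= enorm p.
Proof. exact: sqrtr_ge0. Qed.

Lemma enorm_bound p (C : 'I_d -> R) : (forall i, `|p 0 i| <= C i) ->
  enorm p <= Num.sqrt (\sum_i C i ^+ 2).
Proof.
move=> pC; apply: ler_wsqrtr; apply: ler_sum => i _.
by rewrite -real_normK ?num_real// ler_sqr ?nnegrE// (le_trans _ (pC i)).
Qed.

Lemma measurable_enorm (f : X -> X) : (forall i, measurable_fun setT (fun x => f x 0 i)) ->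
  measurable_fun setT (fun x => enorm (f x)).
Proof.
move=> mf.
rewrite (_ : (fun x => enorm (f x)) = (fun x => (\sum_i f x 0 i ^+ 2) `^ 2^-1)); last first.
  apply/funext => x; rewrite powR12_sqrt// sumr_ge0// => i _; exact: sqr_ge0.
apply: (measurableT_comp (measurable_powR _)).
apply: measurable_sum => i; exact: measurable_funX.
Qed.

Variables (E : set R) (H : hamiltonian R d) (H0 : X -> X -> R -> R -> R) (a : X -> 'M[R]_d).
Hypothesis Hdec : forall x p M r th, E r ->
  H x p M r th = H0 x p r th - \sum_i \sum_j a x i j * M i j.

Lemma DpH_degenerate i x p M r th : E r ->
  DpH H i x p M r th = 'D_(basis_vec i) (fun p' : X => H0 x p' r th) p.
Proof.
move=> Er; rewrite /DpH.
rewrite (_ : (fun p' => H x p' M r th) =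
  (fun p' => H0 x p' r th - \sum_i \sum_j a x i j * M i j)); last first.
  by apply/funext => p'; rewrite Hdec.
apply: (congr1 (fun k : R -> R => lim (k @ 0^'))); apply/funext => t /=.
by congr (_ *: _); rewrite opprB addrA subrK.
Qed.

Lemma DMH_degenerate i j x p M r th : E r -> DMH H i j x p M r th = - a x i j.
Proof.
move=> Er; rewrite /DMH.
rewrite (_ : (fun M' => H x p M' r th) =
  (fun M' => H0 x p r th - \sum_k \sum_l a x k l * M' k l)); last first.
  by apply/funext => M'; rewrite Hdec.
apply: cvg_lim; first exact: Rhausdorff.
apply: cvg_near_cst; near=> t.
have t0 : t != 0 by near: t; exact: nbhs_dnbhs_neq.
rewrite /= (_ : \sum_k \sum_l a x k l * (t *: delta_mx i j + M) k l =
   t * a x i j + \sum_k \sum_l a x k l * M k l).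
  by rewrite /GRing.scale /=; field.
rewrite (bigD1 i)//= [in RHS](bigD1 i)//= addrA; congr (_ + _); last first.
  apply: eq_bigr => k ki; apply: eq_bigr => l _.
  by rewrite !mxE (negbTE ki) mulr0 add0r.
rewrite (bigD1 j)//= [in RHS](bigD1 j)//= addrA; congr (_ + _); last first.
  apply: eq_bigr => l lj.
  by rewrite !mxE (negbTE lj) andbF mulr0 add0r.
by rewrite !mxE !eqxx mulr1 mulrDr (mulrC t).
Unshelve. all: by end_near.
Qed.

End structure_facts.

Section pointwise.
Context {R : realType}.

Definition flux_exponent (gamma alpha : R) : R :=
  (alpha + 1) * gamma / ((alpha + 1) * gamma - alpha).

Lemma flux_exponent_conj (gamma alpha : R) : 1 < gamma -> 0 < alpha ->
  let q := flux_exponent gamma alpha in let p := (alpha + 1) * gamma / alpha in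
  [/\ 1 < p, 1 < q & p^-1 + q^-1 = 1].
Proof.
move=> ga al /=; rewrite /flux_exponent.
have g0 : 0 < gamma by apply: lt_trans ga.
have a1 : 0 < alpha + 1 by rewrite addr_gt0.
have ag : alpha < (alpha + 1) * gamma.
  by apply: lt_trans (_ : alpha + 1 < _); [rewrite ltrDl|rewrite ltr_pMr].
have ag0 : 0 < (alpha + 1) * gamma - alpha by rewrite subr_gt0.
split; first by rewrite ltr_pdivlMr// mul1r.
  by rewrite ltr_pdivlMr// mul1r ltrBlDr ltrDl.
field; rewrite !gt_eqF//.
Qed.

(* Hoelder-type bound: with [A = m ^ (alpha + 1)] and [B = m G ^ gamma],
   [m G ^ (gamma - 1) = A ^ s * B ^ t] where [s + t = 1 / q]. *)
Lemma flux_pointwise (gamma alpha m G C : R) : 1 < gamma -> 0 < alpha -> 0 < m ->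
  0 <= G -> 0 <= C ->
  (m * (C * (1 + G `^ (gamma - 1)))) `^ flux_exponent gamma alpha <=
  (2 * C) `^ flux_exponent gamma alpha * (1 + m `^ (alpha + 1) + m * G `^ gamma).
Proof.
move=> ga al m0 G0 C0; set q := flux_exponent gamma alpha.
have [_ q1 pq] := flux_exponent_conj ga al; rewrite -/q in q1 pq.
have q0 : 0 < q by apply: lt_trans q1.
have g0 : 0 < gamma by apply: lt_trans ga.
have a1 : 0 < alpha + 1 by rewrite addr_gt0.
have A0 : 0 <= m `^ (alpha + 1) by exact: powR_ge0.
have B0 : 0 <= m * G `^ gamma by rewrite mulr_ge0 ?powR_ge0// ltW.
(* The summand 1 gives [S >= 1], so that powers of [S] increase with the exponent. *)
set S := 1 + _ + _.
have S1 : 1 <= S by rewrite /S -addrA lerDl addr_ge0.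
have S0 : 0 <= S by apply: le_trans S1.
have AS : m `^ (alpha + 1) <= S by rewrite /S addrAC lerDr addr_ge0.
have BS : m * G `^ gamma <= S by rewrite /S lerDr addr_ge0.
have ag0 : 0 < (alpha + 1) * gamma - alpha.
  rewrite subr_gt0; apply: lt_trans (_ : alpha + 1 < _); first by rewrite ltrDl.
  by rewrite ltr_pMr.
(* This splitting of [1 / q] yields [c2]; for [c1] it implies [1 / (alpha + 1) <= 1 / q]. *)
have iq : q^-1 = 1 / (gamma * (alpha + 1)) + (gamma - 1) / gamma.
  by rewrite /q /flux_exponent; field; rewrite !gt_eqF.
have c1 : m <= S `^ q^-1.
  have -> : m = (m `^ (alpha + 1)) `^ (alpha + 1)^-1.
    by rewrite -powRrM mulfV ?gt_eqF// powRr1// ltW.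
  apply: (@le_trans _ _ (S `^ (alpha + 1)^-1)).
    by rewrite ge0_ler_powR ?nnegrE ?invr_ge0// ltW.
  rewrite ler_powR// iq -subr_ge0.
  rewrite (_ : _ - _ = (gamma - 1) / gamma * (alpha / (alpha + 1))); last first.
    by field; rewrite !gt_eqF.
  by rewrite !mulr_ge0 ?invr_ge0 ?subr_ge0 ?(ltW ga) ?(ltW g0) ?(ltW al) ?(ltW a1).
have c2 : m * G `^ (gamma - 1) <= S `^ q^-1.
  have s0 : 0 <= 1 / (gamma * (alpha + 1)) by rewrite divr_ge0// mulr_ge0// ltW.
  have t0 : 0 <= (gamma - 1) / gamma by rewrite divr_ge0 ?subr_ge0// ltW.
  have -> : m * G `^ (gamma - 1) = (m `^ (alpha + 1)) `^ (1 / (gamma * (alpha + 1))) *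
      (m * G `^ gamma) `^ ((gamma - 1) / gamma).
    rewrite powRM ?powR_ge0 ?(ltW m0)// -!powRrM mulrA -powRD; last first.
      by rewrite (gt_eqF m0) implybT.
    congr (_ * G `^ _); last by field; rewrite gt_eqF.
    rewrite (_ : _ + _ = 1) ?powRr1 ?(ltW m0)//.
    by field; rewrite !gt_eqF.
  rewrite iq [S `^ _]powRD; last by rewrite (gt_eqF (lt_le_trans ltr01 S1)) implybT.
  by apply: ler_pM; rewrite ?powR_ge0// ge0_ler_powR ?nnegrE.
have main : m * (C * (1 + G `^ (gamma - 1))) <= 2 * C * S `^ q^-1.
  rewrite (_ : _ * _ = C * (m + m * G `^ (gamma - 1))); last by ring.
  rewrite (_ : 2 * C * _ = C * (S `^ q^-1 + S `^ q^-1)); last by ring.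
  by rewrite ler_wpM2l// lerD.
apply: (@le_trans _ _ ((2 * C * S `^ q^-1) `^ q)).
  apply: ge0_ler_powR => //; rewrite ?nnegrE ?(ltW q0)//.
    by rewrite !mulr_ge0 ?addr_ge0 ?powR_ge0// ltW.
  by rewrite !mulr_ge0 ?powR_ge0.
rewrite powRM ?mulr_ge0 ?powR_ge0// -powRrM mulVf ?gt_eqF// powRr1//.
Qed.

End pointwise.

Section sandwich.
Context {R : realType} {d : nat}.
Local Notation X := 'rV[R]_d.
Local Notation mu := (@cube R d).
Implicit Types (f g k l : X -> R).

Lemma Lpow_norm p f : Lpow mu p f -> Lpow mu p (fun x => `|f x|).
Proof.
move=> [mf lf]; split; first exact: measurableT_comp.
by apply: intb_ext lf => x; rewrite normr_id.
Qed.

Lemma Lpow_ae_le p f k : 0 <= p -> measurable_fun setT f -> Lpow mu p k ->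
  {ae mu, forall x, `|f x| <= k x} -> Lpow mu p f.
Proof.
move=> p0 mf [mk lk] fk; split => //.
apply: (intb_ae_le (measurable_powR_abs _ mf) _ lk).
move: fk; apply: filterS => x fk.
have k0 : 0 <= k x by apply: le_trans fk.
by rewrite ger0_norm ?powR_ge0// ge0_ler_powR ?nnegrE// (le_trans fk)// ler_norm.
Qed.

Lemma Lpow_sandwich p f l k : 0 <= p -> measurable_fun setT f -> Lpow mu p l ->
  Lpow mu p k -> {ae mu, forall x, l x <= f x <= k x} -> Lpow mu p f.
Proof.
move=> p0 mf Ll Lk H.
apply: (Lpow_ae_le p0 mf (LpowD p0 (Lpow_norm Ll) (Lpow_norm Lk))).
move: H; apply: filterS => x /andP[lf fk]; rewrite ler_norml; apply/andP; split.
  rewrite opprD (le_trans _ lf)//.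
  apply: (le_trans (lerD (lexx _) (_ : - `|k x| <= 0))); first by rewrite oppr_le0.
  by rewrite addr0 lerNl ler_normr lexx orbT.
by rewrite (le_trans fk)// (le_trans (ler_norm _))// lerDr.
Qed.

End sandwich.

(** * Solutions of the regularized system *)

Section regularized_solution.
Context {R : realType} {d : nat}.
Local Notation X := 'rV[R]_d.
Local Notation mu := (@cube R d).
Local Notation intb f := (mu.-integrable setT (EFin \o f)).
Variables (E : set R) (H : hamiltonian R d) (h : (X -> R) -> X -> R)
  (g g1 g2 : coupling R d) (H0 : X -> X -> R -> R -> R) (a : X -> 'M[R]_d)
  (gamma alpha q0 : R) (N : nat) (beta : R -> R -> R).
Hypotheses (HE : E = `]0, +oo[%classic \/ E = `[0, +oo[%classic)
  (Hh : operator_into_C h) (Hg : continuous_coupling E g)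
  (Hgs : g_structure E h g g1 g2) (HS : H_smooth E H)
  (Hdeg : degenerate_structure E H h g g1 H0 a gamma alpha)
  (HN : d%:R / 2 + 1 < 2 * N%:R - 4 :> R) (Hbeta : penalty_family q0 beta).

Let p12 : (1 : R) <= 2. Proof. by rewrite ler1n. Qed.
Let p02 : (0 : R) <= 2. Proof. by []. Qed.

Lemma values_pos r : 0 < r -> E r.
Proof. by move=> r0; case: HE => ->; rewrite /= in_itv /= ?r0 ?(ltW r0). Qed.

(** Bounding second derivatives costs [d] further ones, hence [d + 2]. *)
Lemma exponent_condition : (0 < N)%N /\ (d + 2 <= 4 * N)%N.
Proof.
have d0 : 0 <= d%:R :> R by [].
have N0 : (4 : R) < 2 * N%:R by move: HN d0; lra.
have dN : (d + 2)%:R <= (4 * N)%:R :> R by rewrite natrD natrM; move: HN N0; lra.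
split; last by rewrite ler_nat in dN.
by rewrite lt0n; apply: contraTneq N0 => ->; rewrite mulr0 -leNgt.
Qed.

Lemma gamma_gt1 : 1 < gamma.
Proof. by case: Hdeg => _ _ _ []. Qed.

Lemma Hdecomposition x p M r th : E r ->
  H x p M r th = H0 x p r th - \sum_i \sum_j a x i j * M i j.
Proof. by case: Hdeg => _ _ + _ _; exact. Qed.

Section one_solution.
Variables (e1 e2 : R) (m u : X -> R).
Hypotheses (e1b : 0 < e1 < 1) (e2b : 0 < e2 < 1)
  (Hdom : reg_domain N m u) (Hsol : reg_solution N beta H h e1 e2 m u).

Let b i := hamiltonian_at (DpH H i) h m (wgrad u) (whess u).
Let A i j := hamiltonian_at (DMH H i j) h m (wgrad u) (whess u).
Let Hx := hamiltonian_at H h m (wgrad u) (whess u).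

Lemma sol_wsob : wsob (4 * N) 2 m /\ wsob (4 * N) 2 u.
Proof. by case: Hdom => Sm Su _; split; exact: sobolev_wsob. Qed.

Lemma sol_gt0 x : 0 < m x.
Proof. by case: Hdom => _ _ [c c0 mc]; exact: lt_le_trans (mc x). Qed.

Lemma sol_ge0 x : 0 <= m x.
Proof. exact: ltW (sol_gt0 x). Qed.

Lemma sol_values x : E (m x).
Proof. exact/values_pos/sol_gt0. Qed.

Lemma sol_Lp1 : Lp 1 m.
Proof. by have [Wm _] := sol_wsob; have [pm hm _] := wsob_base Wm; apply/Lp1P. Qed.

Lemma sol_Mac : Mac m.
Proof. split; [exact: sol_Lp1|exact: aeW sol_ge0]. Qed.

Lemma sol_Mac_in : Mac_in E m.
Proof. split; [exact: sol_Mac|exact: aeW sol_values]. Qed.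

Lemma sol_periodic : [/\ Zd_periodic m, Zd_periodic (wgrad u), Zd_periodic (whess u) &
  Zd_periodic (h m)].
Proof.
have [Wm Wu] := sol_wsob; have [_ dN] := exponent_condition.
have [pm _ _] := wsob_base Wm.
have p4 : (2 <= 4 * N)%N by apply: leq_trans dN; exact: leq_addl.
have pD s : (size s <= 2)%N -> Zd_periodic (wD s u).
  by move=> s2; have [/weak_derivE[]] := Wu s (leq_trans s2 p4).
split => //.
- by move=> x i; apply/rowP => j; rewrite !mxE (pD [:: j] isT).
- by move=> x i; apply/matrixP => k l; rewrite !mxE (pD [:: l; k] isT).
by case: Hh => [/(_ m sol_Mac)[]].
Qed.

Lemma sol_measurable : [/\ measurable_fun setT m, measurable_fun setT u,
  forall i, measurable_fun setT (fun x => wgrad u x 0 i),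
  forall i j, measurable_fun setT (fun x => whess u x i j) & measurable_fun setT (h m)].
Proof.
have [Wm Wu] := sol_wsob; have [_ dN] := exponent_condition.
have p4 : (2 <= 4 * N)%N by apply: leq_trans dN; exact: leq_addl.
have mD s : (size s <= 2)%N -> measurable_fun setT (wD s u).
  by move=> s2; have [_ []] := Wu s (leq_trans s2 p4).
split.
- exact: (wsob_Lpow Wm).1.
- exact: (wsob_Lpow Wu).1.
- move=> i; rewrite (_ : (fun x => _) = wD [:: i] u); first exact: mD.
  by apply/funext => x; rewrite mxE.
- move=> i j; rewrite (_ : (fun x => _) = wD [:: j; i] u); first exact: mD.
  by apply/funext => x; rewrite mxE.
by apply: continuous_measurable; case: Hh => [/(_ m sol_Mac)[]].
Qed.

Lemma DpH_sol i x : b i x =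
  'D_(basis_vec i) (fun p' : X => H0 x p' (m x) (h m x)) (wgrad u x).
Proof. by rewrite /b /hamiltonian_at (DpH_degenerate Hdecomposition)//; exact: sol_values. Qed.

Lemma DMH_sol i j x : A i j x = - a x i j.
Proof. by rewrite /A /hamiltonian_at (DMH_degenerate Hdecomposition)//; exact: sol_values. Qed.

Lemma measurable_DpH_sol i : measurable_fun setT (b i).
Proof.
have [mm _ mD _ mh] := sol_measurable.
have S0 : smooth_on [set z : X * X * R * R | E z.1.2]
    (fun z => H0 z.1.1.1 z.1.1.2 z.1.2 z.2) by case: Hdeg => [[]].
rewrite (_ : b i = (fun x =>
    'D_(basis_vec i) (fun p' : X => H0 x p' (m x) (h m x)) (wgrad u x))); last first.
  by apply/funext => x; exact: DpH_sol.
exact: (measurable_along (locally_continuous_pderiv i S0) mD mm mh sol_values).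
Qed.

Lemma measurable_H_sol : measurable_fun setT Hx.
Proof.
have [mm _ mD mD2 mh] := sol_measurable.
have [[_ S0] Ca _ _ _] := Hdeg.
rewrite (_ : Hx = (fun x => H0 x (wgrad u x) (m x) (h m x) -
    \sum_i \sum_j a x i j * whess u x i j)); last first.
  by apply/funext => x; rewrite /Hx /hamiltonian_at Hdecomposition//; exact: sol_values.
apply: measurable_funB.
  exact: (measurable_along (smooth_on_locally_continuous S0) mD mm mh sol_values).
apply: measurable_sum => i; apply: measurable_sum => j.
exact: measurable_funM (Cinf_measurable (Ca i j)) (mD2 i j).
Qed.

Lemma measurable_g_sol : measurable_fun setT (coupling_at g h m).
Proof.
have [mm _ mD mD2 mh] := sol_measurable.
have cg : locally_continuous [set z : X * R * R | E z.1.2]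
    (fun z : X * R * R => g z.1.1 z.1.2 z.2).
  move=> z Sz e e0; have [_ /(_ z)] := Hg.
  move=> /cvgrPdist_lt/(_ e e0); rewrite /prop_near1/= /nbhs/=.
  rewrite -nbhs_subspace_in// /within/= nbhsE => -[P [oP Pz] HP].
  by exists P; split => // y Py Sy; rewrite distrC; exact: HP.
pose cs := coord_system_prod (coord_system_prod
  (@coord_system_row R d) (@coord_system_real R)) (@coord_system_real R).
apply: (measurable_continuous_comp cs (f := fun x => (x, m x, h m x)) _ sol_values cg).
move=> [[j|j]|j] //=; exact: measurable_coord.
Qed.

Lemma sol_bounded : exists C, [/\ {ae mu, forall x, `|m x| <= C},
  {ae mu, forall x, enorm (wgrad u x) <= C} &
  forall i j, {ae mu, forall x, `|whess u x i j| <= C}].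
Proof.
have [Wm Wu] := sol_wsob; have [_ dN] := exponent_condition.
have [_ _ Em] := wsob_base Wm.
have d0 : (size ([::] : seq 'I_d) + d <= 4 * N)%N.
  by rewrite /= add0n (leq_trans (leq_addr 2 d)).
have d1 (i : 'I_d) : (size [:: i] + d <= 4 * N)%N.
  by rewrite (leq_trans _ dN)// /= addnC leq_add2l.
have d2 (i j : 'I_d) : (size [:: j; i] + d <= 4 * N)%N by rewrite (leq_trans _ dN)// addnC.
have [C0 HC0] := wsob_bounded p12 Wm d0.
have [C1 HC1] := choice (fun i => wsob_bounded p12 Wu (d1 i)).
have [C2 HC2] := choice (fun ij : 'I_d * 'I_d => wsob_bounded p12 Wu (d2 ij.1 ij.2)).
pose S1 := Num.sqrt (\sum_i C1 i ^+ 2).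
pose S2 := \sum_ij `|C2 ij|.
have S10 : 0 <= S1 by exact: sqrtr_ge0.
have S20 : 0 <= S2 by exact: sumr_ge0.
exists (`|C0| + S1 + S2); split.
- apply: filterS2 HC0 Em => x + <-; move=> /le_trans; apply.
  by rewrite -addrA (le_trans (ler_norm _))// lerDl addr_ge0.
- have HC : {ae mu, forall x, forall i, `|wD [:: i] u x| <= C1 i} by exact: filter_forall.
  move: HC; apply: filterS => x Hx'; apply: (@le_trans _ _ S1).
    by apply: enorm_bound => i; rewrite mxE.
  by rewrite addrAC lerDr addr_ge0.
move=> i j; move: (HC2 (i, j)); apply: filterS => x; rewrite mxE => /le_trans; apply.
apply: (@le_trans _ _ S2); last by rewrite lerDr addr_ge0.
rewrite /S2 (bigD1 (i, j))//= (le_trans (ler_norm _))// lerDl.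
by rewrite sumr_ge0.
Qed.

Definition drift_growth C5 := forall x p r th, E r ->
  enorm (\row_i 'D_(basis_vec i) (fun p' : X => H0 x p' r th) p)
    <= C5 * (1 + enorm p `^ (gamma - 1)) /\
  C5^-1 * r `^ alpha - C5 <= g1 x r th.

Lemma DpH_growth C5 : drift_growth C5 -> forall x,
  (forall i, `|b i x| <= C5 * (1 + enorm (wgrad u x) `^ (gamma - 1))) /\
  C5^-1 * m x `^ alpha - C5 <= coupling_at g1 h m x.
Proof.
move=> H5 x.
have [H1 H2] := H5 x (wgrad u x) (m x) (h m x) (sol_values x); split => // i.
apply: le_trans H1; rewrite DpH_sol.
have := coord_le_enorm (\row_i 'D_(basis_vec i) (fun p' : X => H0 x p' (m x) (h m x)) (wgrad u x)) i.
by rewrite mxE.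
Qed.

(** The constant depends on the solution and serves for integrability; nothing uniform in the
    parameters is claimed. *)
Lemma DpH_bounded : exists C, forall i, {ae mu, forall x, `|b i x| <= C}.
Proof.
have [_ _ _ _ [_ [C5 C50 /DpH_growth HC]]] := Hdeg; have [C [_ HD _]] := sol_bounded.
exists (C5 * (1 + `|C| `^ (gamma - 1))) => j; move: HD; apply: filterS => x HD.
have [/(_ j) Hb _] := HC x; apply: (le_trans Hb).
rewrite ler_wpM2l ?(ltW C50)// lerD2l ge0_ler_powR ?nnegrE ?enorm_ge0//.
  by rewrite subr_ge0 ltW// gamma_gt1.
by rewrite (le_trans HD)// ler_norm.
Qed.

Lemma reg_weak_form phi : Cinf phi ->
    \int[mu]_x (m x * phi x) + \sum_i \int[mu]_x (m x * b i x * pderiv i phi x)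
    + \sum_i \sum_j \int[mu]_x (m x * A i j x * pderiv i (pderiv j phi) x)
    - \int[mu]_x (1 * phi x)
    + e1 * (\int[mu]_x (u x * phi x) + \int[mu]_x (iter (2 * N) wlap u x * phi x))
    + e2 * (\int[mu]_x (u x * phi x) - \int[mu]_x (wlap u x * phi x)) = 0.
Proof.
move=> Cphi; have [_ H2] := Hsol; have {}H2 := H2 phi Cphi.
have E1 : dist m phi - (\sum_i dD i (dist (fun x => m x * b i x))) phi
    + (\sum_i \sum_j dD j (dD i (dist (fun x => m x * A i j x)))) phi
    - dist (cst 1) phi + e1 * (dist u phi + dist (iter (2 * N) wlap u) phi)
    + e2 * (dist u phi - dist (wlap u) phi) = 0 by exact: H2.
have S1 : (\sum_i dD i (dist (fun x => m x * b i x))) phi =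
    - \sum_i \int[mu]_x (m x * b i x * pderiv i phi x).
  by rewrite fct_sumE -sumrN.
have S2 : (\sum_i \sum_j dD j (dD i (dist (fun x => m x * A i j x)))) phi =
    \sum_i \sum_j \int[mu]_x (m x * A i j x * pderiv i (pderiv j phi) x).
  rewrite fct_sumE; apply: eq_bigr => i _; rewrite fct_sumE; apply: eq_bigr => j _.
  by rewrite /dD opprK.
by rewrite S1 S2 opprK in E1.
Qed.

(** The penalty is nonpositive and vanishes from [e1 < 1] on: for [m >= 1] the product is 0, for
    [m < 1] both factors are nonpositive. By monotonicity the penalty is bounded by its value at the
    positive lower bound of [m]. *)
Lemma sol_beta : Lpow mu 2 (fun x => beta e1 (m x)) /\
  forall x, 0 <= beta e1 (m x) * (m x - 1).
Proof.
have [Sb mono b0 b1 _] := Hbeta e1b; have [mm _ _ _ _] := sol_measurable.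
split; last first.
  move=> x; have [m1|m1] := leP 1 (m x).
    by rewrite b1 ?mul0r// (le_trans _ m1)//; case/andP: e1b => _ /ltW.
  by rewrite mulr_le0// ?b0 ?sol_gt0// subr_le0 ltW.
have [_ _ [c c0 mc]] := Hdom.
apply: (@Lpow_bdd _ _ _ mu 2 _ `|beta e1 c| p02) => [|x].
  apply: (@measurable_continuous_comp R _ X R unit (fun _ t => t) `]0, +oo[%classic
    (beta e1) m (@coord_system_real R) (fun _ => mm) _ (smooth_on_locally_continuous Sb)).
  by move=> x; rewrite /= in_itv /= andbT; exact: sol_gt0.
by rewrite !ler0_norm ?b0 ?sol_gt0// lerN2; exact: mono.
Qed.

Lemma DMH_bounded : exists C, forall i j x, `|A i j x| <= C.
Proof.
have [_ Ca _ _ _] := Hdeg.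
have [C HC] := choice (fun ij : 'I_d * 'I_d =>
  let: ex_intro2 B _ HB := Cinf_bounded (Ca ij.1 ij.2) in ex_intro _ B HB).
exists (\sum_ij `|C ij|) => i j x; rewrite DMH_sol normrN.
apply: (le_trans (HC (i, j) x)); rewrite (bigD1 (i, j))//=.
by rewrite (le_trans (ler_norm _))// lerDl sumr_ge0.
Qed.

(** The expression bounded from below by (H-growth), along the solution; times [m] it is the
    integrand of the energy inequality. *)
Definition legendre_term x : R := - Hx x + \sum_i b i x * wgrad u x 0 i +
  \sum_i \sum_j A i j x * whess u x i j.

Lemma sol_energy : Lpow mu 2 Hx /\
  \int[mu]_x (m x * legendre_term x) + \int[mu]_x Hx x <= 2 * \int[mu]_x m x.
Proof.
have [Wm Wu] := sol_wsob; have [N0 _] := exponent_condition.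
have [Lb b0] := sol_beta; have [Cb HCb] := DpH_bounded; have [CA HCA] := DMH_bounded.
have mA i j : measurable_fun setT (A i j).
  have [_ Ca _ _ _] := Hdeg.
  rewrite (_ : A i j = (fun x => - a x i j)); last by apply/funext => x; exact: DMH_sol.
  exact: measurableT_comp (Cinf_measurable (Ca i j)).
have [eq1 _] := Hsol.
have [LH HE'] := energy_inequality N0 Wm Wu sol_ge0 e1b e2b measurable_DpH_sol HCb
  mA HCA measurable_H_sol Lb b0 eq1 reg_weak_form.
split => //; apply: le_trans HE'; rewrite lerD2r.
rewrite (_ : \int[mu]_x _ = \int[mu]_x (m x * (- Hx x + \sum_i b i x * wD [:: i] u x +
  \sum_i \sum_j A i j x * wD [:: j; i] u x)))//.
apply: eq_Rintegral => x _; rewrite /legendre_term; congr (_ * (_ + _ + _)).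
  by apply: eq_bigr => i _; rewrite mxE.
by apply: eq_bigr => i _; apply: eq_bigr => j _; rewrite mxE.
Qed.

Lemma Lpow_legendre_term : Lpow mu 2 legendre_term.
Proof.
have [LH _] := sol_energy; have [Wm Wu] := sol_wsob; have [_ dN] := exponent_condition.
have [Cb HCb] := DpH_bounded; have [CA HCA] := DMH_bounded.
have [_ Ca _ _ _] := Hdeg.
have p4 : (2 <= 4 * N)%N by apply: leq_trans dN; exact: leq_addl.
have LD s : (size s <= 2)%N -> Lpow mu 2 (wD s u).
  by move=> s2; have [_] := Wu s (leq_trans s2 p4).
have two0 : (0 : R) < 2 by [].
apply: (LpowD p02 (LpowD p02 (LpowN LH) _)).
  apply: (Lpow_sum two0) => i.
  rewrite (_ : (fun x => _) = (fun x => wD [:: i] u x * b i x)); last first.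
    by apply/funext => x; rewrite mxE mulrC.
  exact: (Lpow2_bddM (LD [:: i] isT) (measurable_DpH_sol i) (HCb i)).
apply: (Lpow_sum two0) => i; apply: (Lpow_sum two0) => j.
rewrite (_ : (fun x => _) = (fun x => wD [:: j; i] u x * - a x i j)); last first.
  by apply/funext => x; rewrite mxE mulrC DMH_sol.
apply: (@Lpow2_bddM _ _ _ _ CA (LD [:: j; i] isT)).
  exact: measurableT_comp (Cinf_measurable (Ca i j)).
by apply: aeW => x; rewrite -DMH_sol.
Qed.

(** [g1 >= - C5] and [g2 >= 0] bound [g] from below, and (H-growth) bounds it from above by the
    Legendre term; [g1] lies between [- C5] and [g], and [g2] is the difference. *)
Lemma sol_coupling : [/\ Lpow mu 2 (coupling_at g h m), Lpow mu 2 (coupling_at g1 h m),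
  Lpow mu 2 (coupling_at g2 h m),
  forall x, coupling_at g h m x = coupling_at g1 h m x + coupling_at g2 h m x &
  {ae mu, forall x, 0 <= coupling_at g2 h m x}].
Proof.
have [[_ _ mg1 gE g2pos] _ _ _] := Hgs.
have g20 := g2pos m sol_Mac_in.
have E12 x : coupling_at g h m x = coupling_at g1 h m x + coupling_at g2 h m x.
  by rewrite /coupling_at gE//; exact: sol_values.
have [_ _ _ [_ _ [C1 [C2 [C3 [C4 [[C10 C20 _ _] [Ha _]]]]]]] [_ [C5 C50 /DpH_growth H5]]] := Hdeg.
have g1low x : - C5 <= coupling_at g1 h m x.
  have [_] := H5 x; apply: le_trans.
  by rewrite lerDr mulr_ge0 ?powR_ge0// invr_ge0 ltW.
have gup x : coupling_at g h m x <= C2^-1 * (legendre_term x + C1).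
  have := Ha x (wgrad u x) (whess u x) (m x) (h m x) (sol_values x).
  rewrite ler_pdivlMl// -[X in _ <= X -> _]/(legendre_term x) => HH.
  rewrite -lerBlDr; apply: le_trans HH; rewrite lerD2r lerDr.
  by rewrite !mulr_ge0 ?powR_ge0// invr_ge0 ltW.
have Lup : Lpow mu 2 (fun x => C2^-1 * (legendre_term x + C1)).
  exact: (LpowZ C2^-1 (LpowD p02 Lpow_legendre_term (Lpow_cst C1 p02))).
have Ll := @Lpow_cst R d 2 (- C5) p02.
have Lg : Lpow mu 2 (coupling_at g h m).
  apply: (Lpow_sandwich p02 measurable_g_sol Ll Lup).
  move: g20; apply: filterS => x g20; rewrite gup andbT E12 /=.
  by apply: (le_trans (g1low x)); rewrite lerDl.
have Lg1 : Lpow mu 2 (coupling_at g1 h m).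
  apply: (Lpow_sandwich p02 (mg1 m sol_Mac sol_values) Ll Lg).
  by move: g20; apply: filterS => x g20; rewrite g1low /= E12 lerDl.
split => //.
rewrite (_ : coupling_at g2 h m = (fun x => coupling_at g h m x - coupling_at g1 h m x)).
  exact: LpowB p02 Lg Lg1.
by apply/funext => x; rewrite E12 addrAC subrr add0r.
Qed.

Let Gam x := enorm (wgrad u x) `^ gamma.

Lemma sol_grad_power : Lpow mu 2 Gam /\ {ae mu, forall x, 0 <= Gam x}.
Proof.
have [_ _ mD _ _] := sol_measurable; have [C [_ HC _]] := sol_bounded.
split; last by apply: aeW => x; exact: powR_ge0.
apply: (@Lpow_aebdd _ _ _ mu 2 _ (`|C| `^ gamma) p02).
  exact: (measurableT_comp (measurable_powR _) (measurable_enorm mD)).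
move: HC; apply: filterS => x HC; rewrite ger0_norm ?powR_ge0//.
rewrite ge0_ler_powR ?nnegrE ?enorm_ge0//; last by rewrite (le_trans HC)// ler_norm.
exact: ltW (lt_trans ltr01 gamma_gt1).
Qed.

(** [gamma] may exceed 2, so L^2 regularity does not give this directly; bounded functions on the
    cube lie in every L^p. *)
Lemma sol_sobolev : sobolev 1 gamma u /\
  forall i j, exists f, weak_deriv [:: j; i] u f.
Proof.
have [Wm Wu] := sol_wsob; have [_ dN] := exponent_condition.
have [C [_ HC _]] := sol_bounded.
have g0 : 0 < gamma by exact: lt_trans ltr01 gamma_gt1.
have p4 : (2 <= 4 * N)%N by apply: leq_trans dN; exact: leq_addl.
have d0 : (size ([::] : seq 'I_d) + d <= 4 * N)%N.
  by rewrite /= add0n (leq_trans (leq_addr 2 d)).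
split; last first.
  by move=> i j; have [w _] := Wu [:: j; i] p4; exists (wD [:: j; i] u).
rewrite /sobolev /= truncn1 subrr; split; last by rewrite ltxx.
move=> s s1; have s4 : (size s <= 4 * N)%N by apply: leq_trans s1 (ltnW p4).
have [w [ms _]] := Wu s s4; exists (wD s u) => //.
split; first by have [] := (weak_derivE _ _ _).1 w.
apply/(LpowP mu _ g0).
case: s s1 s4 w ms => [|i [|//]] _ _ _ ms.
  have [C0 HC0] := wsob_bounded p12 Wu d0.
  exact: (@Lpow_aebdd _ _ _ mu gamma _ C0 (ltW g0) ms HC0).
apply: (@Lpow_aebdd _ _ _ mu gamma _ C (ltW g0) ms).
move: HC; apply: filterS => x; apply: le_trans.
by have := coord_le_enorm (wgrad u x) i; rewrite mxE.
Qed.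

(** The literal [- 0] keeps this convertible with [H_growth] at [tau = 0]. *)
Definition growth_constants C1 C2 C3 C4 :=
  (forall x p M r th, E r ->
      C1^-1 * (r `^ (- 0) * enorm p `^ gamma) + C2 * g x r th - C1
      <= - H x p M r th + \sum_i DpH H i x p M r th * p 0 i
         + \sum_i \sum_j DMH H i j x p M r th * M i j) /\
  (forall m u, Mac_in E m -> sobolev 1 gamma u ->
      (forall i j, exists f, weak_deriv [:: j; i] u f) ->
      let Ig := (\int[mu]_x (coupling_at g h m x)%:E)%E in
      let Iu := (\int[mu]_x (enorm (wgrad u x) `^ gamma * m x `^ (- 0))%:E)%E in
      let IH := (\int[mu]_x (hamiltonian_at H h m (wgrad u) (whess u) x)%:E)%E in
      (- (C3%:E * Ig) + (C1^-1)%:E * Iu - C1%:E <= IH)%E /\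
      (IH <= - (C4%:E * Ig) + C1%:E * (1 + Iu))%E).

(** Sum of the pointwise growth times [m], the lower bound on [int H] and the energy inequality. The
    terms [int |Du| ^ gamma] and [int m g2] have a sign and are dropped; [int g2] is bounded through
    [int m]. *)
Lemma sol_inequality C1 C2 C3 C4 c : 0 < C1 -> 0 < C2 -> 0 < C3 ->
  growth_constants C1 C2 C3 C4 ->
  (forall m, Mac_in E m -> (\int[mu]_x (coupling_at g2 h m x)%:E
           <= c%:E * (1 + \int[mu]_x (m x)%:E))%E) ->
  C1^-1 * \int[mu]_x (m x * Gam x) + C2 * \int[mu]_x (m x * coupling_at g1 h m x) <=
  (2 + C1 + C3 * c) * \int[mu]_x m x + C3 * \int[mu]_x coupling_at g1 h m x
    + C1 + C3 * c.
Proof.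
move=> C10 C20 C30 [Ha Hb] Hc.
have [LG _] := sol_grad_power; have [LH En] := sol_energy.
have [Lg Lg1 Lg2 gE g20] := sol_coupling; have [Su Wij] := sol_sobolev.
have [Wm _] := sol_wsob; have Lm := wsob_Lpow Wm.
have im := Lpow2_intb Lm; have iG := Lpow2_intb LG; have iH := Lpow2_intb LH.
have ig := Lpow2_intb Lg; have ig1 := Lpow2_intb Lg1; have ig2 := Lpow2_intb Lg2.
have imG := Lpow2M Lm LG; have img1 := Lpow2M Lm Lg1; have img2 := Lpow2M Lm Lg2.
have LL := Lpow_legendre_term; have imL := Lpow2M Lm LL.
have G1 : \int[mu]_x coupling_at g h m x =
    \int[mu]_x coupling_at g1 h m x + \int[mu]_x coupling_at g2 h m x.
  by apply: etrans (RintD ig1 ig2); apply: eq_Rintegral => x _; exact: gE.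
have G2 : \int[mu]_x coupling_at g2 h m x <= c * (1 + \int[mu]_x m x).
  have := Hc m sol_Mac_in; rewrite (Rint_EFin ig2) (Rint_EFin im).
  by rewrite -EFinD -EFinM lee_fin.
have HbL : - (C3 * \int[mu]_x coupling_at g h m x) + C1^-1 * \int[mu]_x Gam x - C1 <=
    \int[mu]_x Hx x.
  have [+ _] := Hb m u sol_Mac_in Su Wij.
  have -> : (\int[mu]_x (enorm (wgrad u x) `^ gamma * m x `^ (- 0))%:E =
      (\int[mu]_x Gam x)%:E)%E.
    rewrite -(Rint_EFin iG); apply: eq_integral => x _.
    by rewrite oppr0 powRr0 mulr1.
  rewrite (Rint_EFin ig) (Rint_EFin iH).
  by rewrite -!EFinM -!EFinN -!EFinD lee_fin.
have G0 : 0 <= \int[mu]_x Gam x by apply: Rint_ge0 => x; exact: powR_ge0.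
have Y0 : 0 <= \int[mu]_x (m x * coupling_at g2 h m x).
  apply: (Rint_aege0 img2); move: g20; apply: filterS => x g20.
  exact: mulr_ge0 (sol_ge0 x) g20.
have key : C1^-1 * \int[mu]_x (m x * Gam x) + C2 * (\int[mu]_x (m x * coupling_at g1 h m x)
    + \int[mu]_x (m x * coupling_at g2 h m x)) - C1 * \int[mu]_x m x <=
    \int[mu]_x (m x * legendre_term x).
  have i1 := intbZ (C1^-1) imG; have i2 := intbZ C2 (intbD img1 img2).
  have i3 := intbZ C1 im.
  have -> : C1^-1 * \int[mu]_x (m x * Gam x) + C2 * (\int[mu]_x (m x * coupling_at g1 h m x)
    + \int[mu]_x (m x * coupling_at g2 h m x)) - C1 * \int[mu]_x m x =
    \int[mu]_x (C1^-1 * (m x * Gam x) + C2 * (m x * coupling_at g1 h m x +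
      m x * coupling_at g2 h m x) - C1 * m x).
    apply: esym; apply: etrans (RintB (intbD i1 i2) i3) (f_equal2 (fun s t => s - t) _ _).
      apply: etrans (RintD i1 i2) (f_equal2 +%R _ _); first exact: (RintZ (C1^-1) imG).
      apply: etrans (RintZ C2 (intbD img1 img2)) (congr1 ( *%R C2) _).
      exact: (RintD img1 img2).
    exact: (RintZ C1 im).
  apply: (Rint_le (intbB (intbD i1 i2) i3) imL) => x.
  have := Ha x (wgrad u x) (whess u x) (m x) (h m x) (sol_values x).
  rewrite oppr0 powRr0 mul1r -[X in _ <= X -> _]/(legendre_term x).
  rewrite -[g x (m x) (h m x)]/(coupling_at g h m x) gE => HH.
  have := ler_wpM2l (sol_ge0 x) HH; apply: le_trans.
  by rewrite le_eqVlt; apply/orP; left; apply/eqP; rewrite /Gam; ring.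
have CG : 0 <= C1^-1 * \int[mu]_x Gam x by rewrite mulr_ge0// invr_ge0 ltW.
have CY : 0 <= C2 * \int[mu]_x (m x * coupling_at g2 h m x) by rewrite mulr_ge0// ltW.
have CG2 := ler_wpM2l (ltW C30) G2.
rewrite G1 in HbL; move: key En HbL CG CY CG2.
set I1 := \int[mu]_x (m x * Gam x); set I2 := \int[mu]_x (m x * coupling_at g1 h m x).
set I3 := \int[mu]_x (m x * coupling_at g2 h m x).
set I4 := \int[mu]_x (m x * legendre_term x); set I5 := \int[mu]_x Gam x.
set I6 := \int[mu]_x m x; set I7 := \int[mu]_x Hx x.
set I8 := \int[mu]_x coupling_at g1 h m x; set I9 := \int[mu]_x coupling_at g2 h m x.
move: (C1^-1 * I1) (C1^-1 * I5) => J1 J5; lra.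
Qed.

Lemma sol_flux_Lp C5 K i : 0 < alpha -> 0 < C5 -> drift_growth C5 ->
  \int[mu]_x (m x * coupling_at g1 h m x) <= K -> \int[mu]_x m x <= K ->
  \int[mu]_x (m x * Gam x) <= K ->
  let q := flux_exponent gamma alpha in
  Lp q (fun x => m x * b i x) /\
  \int[mu]_x (`|m x * b i x| `^ q) <= (2 * C5) `^ q * (1 + C5 * (K + C5 * K) + K).
Proof.
move=> al C50 /DpH_growth H5 HX HM HG q.
have [_ q1 _] := flux_exponent_conj gamma_gt1 al; rewrite -/q in q1.
have qq0 : 0 < q by apply: lt_trans q1.
have [LG _] := sol_grad_power; have [Lg Lg1 Lg2 gE g20] := sol_coupling.
have [Wm Wu] := sol_wsob; have Lm := wsob_Lpow Wm; have mm := Lm.1.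
have im := Lpow2_intb Lm; have imG := Lpow2M Lm LG; have img1 := Lpow2M Lm Lg1.
have mA : measurable_fun setT (fun x => m x `^ (alpha + 1)).
  exact: (measurableT_comp (measurable_powR _) mm).
have iR := intbZ C5 (intbD img1 (intbZ C5 im)).
(* Lower growth of [g1], multiplied by [C5 * m]. *)
have Ale x : m x `^ (alpha + 1) <= C5 * (m x * coupling_at g1 h m x + C5 * m x).
  have [_ HH] := H5 x; have m0 := sol_gt0 x.
  rewrite powRD; last by rewrite (gt_eqF m0) implybT.
  rewrite powRr1 ?(ltW m0)// -ler_pdivrMl//.
  have := ler_wpM2l (ltW m0) HH; rewrite -subr_ge0 => HH2.
  rewrite -subr_ge0; apply: le_trans HH2 _.
  by rewrite le_eqVlt; apply/orP; left; apply/eqP; ring.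
have iA : intb (fun x => m x `^ (alpha + 1)).
  apply: (intb_le mA _ iR) => x; rewrite ger0_norm ?powR_ge0//; exact: Ale.
have IA : \int[mu]_x (m x `^ (alpha + 1)) <= C5 * (K + C5 * K).
  apply: (le_trans (Rint_le iA iR Ale)).
  have -> : \int[mu]_x (C5 * (m x * coupling_at g1 h m x + C5 * m x)) =
      C5 * (\int[mu]_x (m x * coupling_at g1 h m x) + C5 * \int[mu]_x m x).
    apply: etrans (RintZ C5 (intbD img1 (intbZ C5 im))) (congr1 ( *%R C5) _).
    exact: etrans (RintD img1 (intbZ C5 im)) (f_equal2 +%R erefl (RintZ C5 im)).
  by rewrite ler_wpM2l ?(ltW C50)// lerD// ler_wpM2l// ltW.
have mb : measurable_fun setT (fun x => m x * b i x).
  exact: measurable_funM mm (measurable_DpH_sol i).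
have i1 : intb (fun _ : X => 1) by exact: Lpow2_intb (Lpow_cst 1 p02).
have iS := intbZ ((2 * C5) `^ q) (intbD (intbD i1 iA) imG).
have pt x : `|m x * b i x| `^ q <=
    (2 * C5) `^ q * (1 + m x `^ (alpha + 1) + m x * Gam x).
  have [Hb _] := H5 x; have m0 := sol_gt0 x.
  apply: le_trans (flux_pointwise gamma_gt1 al m0 (enorm_ge0 (wgrad u x)) (ltW C50)).
  have le1 : `|m x * b i x| <= m x * (C5 * (1 + enorm (wgrad u x) `^ (gamma - 1))).
    by rewrite normrM gtr0_norm// ler_wpM2l ?(ltW m0).
  by rewrite ge0_ler_powR ?nnegrE ?(ltW qq0)// (le_trans _ le1).
have LF : Lpow mu q (fun x => m x * b i x).
  split => //; apply: (intb_le (measurable_powR_abs _ mb) _ iS) => x.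
  by rewrite ger0_norm ?powR_ge0//; exact: pt.
split.
  split; last exact/(LpowP mu _ qq0).
  have [pm pw pw2 ph] := sol_periodic; have [pH _] := HS.
  by move=> x k; rewrite /b /hamiltonian_at /DpH pm pw pw2 ph pH.
apply: (le_trans (Rint_le LF.2 iS pt)).
have -> : \int[mu]_x ((2 * C5) `^ q * (1 + m x `^ (alpha + 1) + m x * Gam x)) =
    (2 * C5) `^ q * (\int[mu]_x (1 : R) + \int[mu]_x (m x `^ (alpha + 1)) +
      \int[mu]_x (m x * Gam x)).
  apply: etrans (RintZ _ (intbD (intbD i1 iA) imG)) (congr1 ( *%R _) _).
  apply: etrans (RintD (intbD i1 iA) imG) (f_equal2 +%R _ erefl).
  exact: RintD i1 iA.
rewrite ler_wpM2l ?powR_ge0// Rint_cst lerD// lerD//.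
Qed.

End one_solution.
Lemma uniform_flux_bound : let q := flux_exponent gamma alpha in
  exists K, forall e1 e2 m u, 0 < e1 < 1 -> 0 < e2 < 1 -> reg_domain N m u ->
  reg_solution N beta H h e1 e2 m u -> forall i,
  let f := fun x => m x * hamiltonian_at (DpH H i) h m (wgrad u) (whess u) x in
  Lp q f /\ \int[mu]_x (`|f x| `^ q) <= K.
Proof.
move=> q.
have [_ _ _ [_ _ [C1 [C2 [C3 [C4 [[C10 C20 C30 C40] Hgr]]]]]] [al [C5 C50 H5]]] := Hdeg.
have [_ [c c0 Hc] Hdl [Rg Rg0 HR]] := Hgs.
(* [K0] is the sum of the coefficients of [int m] and [int g1] in [sol_inequality]; with
   [delta = C2 / (2 * K0)] in (g-structure), half of [C2 * int m g1] absorbs both. *)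
pose K0 := 2 + C1 + C3 * c + C3.
have cc : 0 < C3 * c by exact: mulr_gt0.
have K00 : 0 < K0 by rewrite /K0; move: cc; lra.
have dl0 : 0 < C2 / (2 * K0) by rewrite divr_gt0// mulr_gt0.
have [Cd Cd0 HCd] := Hdl _ dl0.
pose B := K0 * Cd + C1 + C3 * c.
(* Bounds for [int m g1], [int m] and [int m |Du| ^ gamma], in this order. The last one relies on
   the lower bound [- Rg], since [int m g1] may be negative. *)
pose X0 := 2 * B / C2; pose M0 := C2 / (2 * K0) * X0 + Cd; pose I0 := C1 * (B + C2 / 2 * Rg).
pose K := Num.max X0 (Num.max M0 I0).
exists ((2 * C5) `^ q * (1 + C5 * (K + C5 * K) + K)).
move=> e1 e2 m u e1b e2b Hdom Hsol i f.
have HMac := sol_Mac_in Hdom.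
have [LG _] := sol_grad_power Hdom.
have [Lg Lg1 Lg2 gE g20] := sol_coupling e1b e2b Hdom Hsol.
have [Wm Wu] := sol_wsob Hdom; have Lm := wsob_Lpow Wm.
have im := Lpow2_intb Lm; have img1 := Lpow2M Lm Lg1; have ig1 := Lpow2_intb Lg1.
have ineq := sol_inequality e1b e2b Hdom Hsol C10 C20 C30 Hgr Hc.
have Rl : - Rg <= \int[mu]_x (m x * coupling_at g1 h m x).
  by have := HR m HMac; rewrite (Rint_EFin img1) lee_fin.
have [dg dm] : \int[mu]_x coupling_at g1 h m x <=
      C2 / (2 * K0) * \int[mu]_x (m x * coupling_at g1 h m x) + Cd /\
    \int[mu]_x m x <= C2 / (2 * K0) * \int[mu]_x (m x * coupling_at g1 h m x) + Cd.
  have := HCd m HMac; rewrite (Rint_EFin img1) (Rint_EFin im) (Rint_EFin ig1).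
  by rewrite -EFinM -EFinD ge_max !lee_fin => /andP.
have I10 : 0 <= C1^-1 * \int[mu]_x (m x * enorm (wgrad u x) `^ gamma).
  rewrite mulr_ge0 ?invr_ge0 ?(ltW C10)//; apply: Rint_ge0 => x.
  by rewrite mulr_ge0 ?powR_ge0//; exact: (sol_ge0 Hdom).
suff [HX HM HI] : [/\ \int[mu]_x (m x * coupling_at g1 h m x) <= K,
    \int[mu]_x m x <= K & \int[mu]_x (m x * enorm (wgrad u x) `^ gamma) <= K].
  exact: (sol_flux_Lp e1b e2b Hdom Hsol i al C50 H5 HX HM HI).
move: ineq dg dm Rl I10.
set Y := \int[mu]_x (m x * coupling_at g1 h m x).
set M := \int[mu]_x m x; set G1 := \int[mu]_x coupling_at g1 h m x.
set I1 := \int[mu]_x (m x * enorm (wgrad u x) `^ gamma).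
move=> ineq dg dm Rl I10.
have s1 : (2 + C1 + C3 * c) * M + C3 * G1 <= K0 * (C2 / (2 * K0) * Y + Cd).
  rewrite /K0 -/K0 (mulrDl _ C3); apply: lerD; apply: ler_wpM2l => //; last exact: ltW.
  by rewrite !addr_ge0// ltW.
have s2 : K0 * (C2 / (2 * K0) * Y + Cd) = C2 / 2 * Y + K0 * Cd.
  by field; rewrite gt_eqF.
have s3 : C1^-1 * I1 + C2 / 2 * Y <= B.
  by move: ineq s1; rewrite s2 /B; move: (C1^-1 * I1) => J; lra.
have YX : Y <= X0.
  rewrite /X0 ler_pdivlMr//; move: s3 I10; move: (C1^-1 * I1) => J; lra.
have MM : M <= M0.
  by apply: (le_trans dm); rewrite lerD2r ler_wpM2l// ltW.
have II : I1 <= I0.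
  have r1 : C1^-1 * I1 <= B + C2 / 2 * Rg.
    have r2 : C2 / 2 * - Rg <= C2 / 2 * Y by rewrite ler_wpM2l// divr_ge0// ltW.
    by move: s3 r2; rewrite mulrN; lra.
  by rewrite /I0 -ler_pdivrMl.
by rewrite !le_max YX MM II !orbT.
Qed.

End regularized_solution.

(** * Passage to the limit *)

Section limits.
Context {R : realType} {d : nat}.
Local Notation X := 'rV[R]_d.
Local Notation mu := (@cube R d).
Local Notation intb f := (mu.-integrable setT (EFin \o f)).
Implicit Types (f g w phi psi m u : X -> R) (i j : 'I_d).

(** Classical Laplacian, the transpose of [wlap]: it takes all regularizing derivatives off [u],
    which converges in W^{1,gamma} only. *)
Definition lap phi x : R := \sum_i pderiv i (pderiv i phi) x.

Lemma Cinf_lap phi : Cinf phi -> Cinf (lap phi).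
Proof. by move=> Cp; apply: Cinf_sum => i; do 2 apply: Cinf_pderiv. Qed.

Lemma Cinf_iter_lap r phi : Cinf phi -> Cinf (iter r lap phi).
Proof. by move=> Cp; elim: r => [|r IH]; [exact: Cp|exact: (Cinf_lap IH)]. Qed.

Lemma wlap_test k f phi : wsob k.+2 2 f -> Cinf phi ->
  \int[mu]_x (wlap f x * phi x) = \int[mu]_x (f x * lap phi x).
Proof.
move=> H Cp; have [_ hf _] := wsob_base H.
have CD i : Cinf (pderiv i (pderiv i phi)) by do 2 apply: Cinf_pderiv.
have hD i : weak_deriv [:: i; i] f (wD [:: i; i] f) by case: (H [:: i; i] isT).
have hi i : intb (wD [:: i; i] f) by case/weak_derivE: (hD i).
transitivity (\int[mu]_x \sum_i (wD [:: i; i] f x * phi x)).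
  by apply: eq_Rintegral => x _; rewrite mulr_suml.
rewrite (Rint_sum _ (fun i => intbM_Cinf (hi i) Cp)).
transitivity (\int[mu]_x \sum_i (f x * pderiv i (pderiv i phi) x)); last first.
  by apply: eq_Rintegral => x _; rewrite mulr_sumr.
rewrite (Rint_sum _ (fun i => intbM_Cinf hf (CD i))); apply: eq_bigr => i _.
have /weak_derivE[_ _ _ _ /(_ phi Cp)] := hD i.
by rewrite /dDs /= /dD opprK /dist => ->.
Qed.

Lemma iter_wlap_test r f phi : wsob r.*2 2 f -> Cinf phi ->
  \int[mu]_x (iter r wlap f x * phi x) = \int[mu]_x (f x * iter r lap phi x).
Proof.
have p12 : (1 : R) <= 2 by rewrite ler1n.
elim: r phi => // r IH phi H Cp; rewrite iterS.
have W2 : wsob 2 2 (iter r wlap f).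
  by apply: (wsob_iter_wlap p12); apply: wsob_le H; rewrite doubleS add2n.
rewrite (wlap_test W2 Cp) iterSr; apply: IH; last exact: Cinf_lap.
by apply: wsob_le H; rewrite doubleS; do 2 apply: leqW.
Qed.

Lemma weak_cvg_L1_test (f_ : nat -> X -> R) f psi : Cinf psi ->
  weak_cvg (Lp 1) (@Lp_norm R d 1) f_ f ->
  (\int[mu]_x (f_ n x * psi x)) @[n --> \oo] --> \int[mu]_x (f x * psi x).
Proof.
move=> Cp [_ _ H]; apply: (H (fun f => \int[mu]_x (f x * psi x))).
have [B B0 HB] := Cinf_bounded Cp.
split => [c v w /Lp1P[_ hv] /Lp1P[_ hw]|].
  have iv := intbM_Cinf hv Cp; have iw := intbM_Cinf hw Cp.
  apply: etrans (etrans (RintD (intbZ c iv) iw) (f_equal2 +%R (RintZ c iv) erefl)).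
  by apply: eq_Rintegral => x _; rewrite !fctE mulrDl /GRing.scale /= mulrA.
exists B => v /Lp1P[_ hv]; have iv := intbM_Cinf hv Cp.
have Lv := (Lpow1 mu v).1 hv.
rewrite /Lp_norm (Lp_norm_pow ltr01 Lv) invr1 powRr1; last first.
  by apply: Rint_ge0 => x; exact: powR_ge0.
rewrite -(RintZ B Lv.2); apply: (le_trans (Rint_norm iv)).
apply: (Rint_le (intb_norm iv) (intbZ B Lv.2)) => x.
by rewrite powRr1// normrM mulrC ler_wpM2r.
Qed.

(** The order-zero term is one of the summands of the Sobolev norm. Hence pairing with a test
    function is a bounded functional, to which weak convergence applies. *)
Lemma Lp_norm_le_sobolev gamma u : 1 < gamma -> sobolev 1 gamma u ->
  (\int[mu]_x (`|u x| `^ gamma)) `^ gamma^-1 <= sobolev_norm 1 gamma u.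
Proof.
move=> ga Su; have g0 : 0 < gamma by apply: lt_trans ga.
have Wu : wsob 1 gamma u by exact: (@sobolev_wsob _ _ 1 gamma u g0).
have [_ hu E] := wsob_base Wu; have [_ L0] := Wu [::] isT.
have Lu := wsob_Lpow Wu.
have N0 s : 0 <= Lp_norm gamma (wD s u) by rewrite fine_ge0// Lnorm_ge0.
have -> : (\int[mu]_x (`|u x| `^ gamma)) `^ gamma^-1 = Lp_norm gamma (wD [::] u).
  rewrite /Lp_norm (Lp_norm_pow g0 L0); apply: (congr1 (fun t : R => t `^ gamma^-1)).
  apply: Rint_ae; [exact: measurable_powR_abs Lu.1|exact: measurable_powR_abs L0.1|].
  by move: E; apply: filterS => x ->.
rewrite /sobolev_norm truncn1 subrr ltxx addr0.
rewrite -[leLHS](powRr1 (N0 _)) -(mulfV (lt0r_neq0 g0)) powRrM.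
apply: ge0_ler_powR; rewrite ?invr_ge0 ?nnegrE ?powR_ge0 ?(ltW g0)//.
  by apply: sumr_ge0 => l _; apply: sumr_ge0 => s _; exact: powR_ge0.
rewrite (bigD1 ord0)//= (bigD1 [tuple])//= -addrA lerDl addr_ge0//.
  by apply: sumr_ge0 => s _; exact: powR_ge0.
by apply: sumr_ge0 => l _; apply: sumr_ge0 => s _; exact: powR_ge0.
Qed.

Lemma weak_cvg_sobolev_test gamma (f_ : nat -> X -> R) f psi : 1 < gamma -> Cinf psi ->
  weak_cvg (sobolev 1 gamma) (@sobolev_norm R d 1 gamma) f_ f ->
  (\int[mu]_x (f_ n x * psi x)) @[n --> \oo] --> \int[mu]_x (f x * psi x).
Proof.
move=> ga Cp [_ _ H]; apply: (H (fun f => \int[mu]_x (f x * psi x))).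
have g0 : 0 < gamma by apply: lt_trans ga.
have [B B0 HB] := Cinf_bounded Cp.
have Sb v : sobolev 1 gamma v -> intb v /\ Lpow mu gamma v.
  move=> Sv; have Wv : wsob 1 gamma v by exact: (@sobolev_wsob _ _ 1 gamma v g0).
  by have [_ hv _] := wsob_base Wv; split => //; exact: wsob_Lpow Wv.
split => [c v w /Sb[hv _] /Sb[hw _]|].
  have iv := intbM_Cinf hv Cp; have iw := intbM_Cinf hw Cp.
  apply: etrans (etrans (RintD (intbZ c iv) iw) (f_equal2 +%R (RintZ c iv) erefl)).
  by apply: eq_Rintegral => x _; rewrite !fctE mulrDl /GRing.scale /= mulrA.
pose p := (1 - gamma^-1)^-1.
have ig : gamma^-1 < 1 by rewrite invf_lt1.
have p0 : 0 < p by rewrite invr_gt0 subr_gt0.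
have gp : gamma^-1 + p^-1 = 1 by rewrite /p invrK addrC subrK.
have Lpsi : Lpow mu p psi by exact: Lpow_Cinf (ltW p0) Cp.
exists ((\int[mu]_x (`|psi x| `^ p)) `^ p^-1) => v Sv; have [hv Lv] := Sb v Sv.
rewrite [leRHS]mulrC; apply: (le_trans (hoelder_Rint g0 p0 gp Lv Lpsi)).
exact: (ler_wpM2r (powR_ge0 _ _) (Lp_norm_le_sobolev ga Sv)).
Qed.

End limits.

Lemma cvg_alternating_sum (R : realType) (s1 s2 s3 s4 s5 s6 : nat -> R)
    (a1 a2 a3 a4 a5 a6 : R) :
  s1 n @[n --> \oo] --> a1 -> s2 n @[n --> \oo] --> a2 -> s3 n @[n --> \oo] --> a3 ->
  s4 n @[n --> \oo] --> a4 -> s5 n @[n --> \oo] --> a5 -> s6 n @[n --> \oo] --> a6 ->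
  s1 n + s2 n + s3 n - s4 n + s5 n + s6 n @[n --> \oo] --> a1 + a2 + a3 - a4 + a5 + a6.
Proof.
move=> c1 c2 c3 c4 c5 c6; apply: cvgD c6; apply: cvgD c5; apply: cvgB c4.
exact: cvgD (cvgD c1 c2) c3.
Qed.

Theorem proposition5p4 (R : realType) (d : nat) (E : set R)
    (H : hamiltonian R d) (h : ('rV[R]_d -> R) -> 'rV[R]_d -> R)
    (g g1 g2 : coupling R d)
    (H0 : 'rV[R]_d -> 'rV[R]_d -> R -> R -> R) (a : 'rV[R]_d -> 'M[R]_d)
    (gamma alpha q0 : R) (N : nat) (beta : R -> R -> R)
    (m_ u_ : R -> R -> 'rV[R]_d -> R) (e1 e2 : nat -> R)
    (m u : 'rV[R]_d -> R) :
  (0 < d)%N ->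
  E = `]0, +oo[%classic \/ E = `[0, +oo[%classic ->
  operator_into_C h ->
  continuous_coupling E g ->
  h_regularity h ->
  g_structure E h g g1 g2 ->
  g_compactness E h g1 ->
  H_growth E H h g gamma 0 ->
  H_smooth E H ->
  monotone_operator E H h ->
  degenerate_structure E H h g g1 H0 a gamma alpha ->
  d%:R / 2 + 1 < 2 * N%:R - 4 :> R ->
  d%:R < q0 ->
  penalty_family q0 beta ->
  (forall eps1 eps2, 0 < eps1 < 1 -> 0 < eps2 < 1 ->
    reg_domain N (m_ eps1 eps2) (u_ eps1 eps2) /\
    reg_solution N beta H h eps1 eps2 (m_ eps1 eps2) (u_ eps1 eps2)) ->
  Lp 1 m ->
  sobolev 1 gamma u ->
  {ae cube d, forall x, 0 <= m x} ->
  \int[cube d]_x m x = 1 ->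
  weak_solution E H h (dist m) (dist u) ->
  (forall n, 0 < e1 n < 1 /\ 0 < e2 n < 1) ->
  e1 n @[n --> \oo] --> 0 ->
  e2 n @[n --> \oo] --> 0 ->
  weak_cvg (Lp 1) (Lp_norm 1) (fun n => m_ (e1 n) (e2 n)) m ->
  weak_cvg (sobolev 1 gamma) (sobolev_norm 1 gamma)
    (fun n => u_ (e1 n) (e2 n)) u ->
  let q := (alpha + 1) * gamma / ((alpha + 1) * gamma - alpha) in
  let flux eps1 eps2 x : 'rV[R]_d := \row_i (m_ eps1 eps2 x *
    hamiltonian_at (DpH H i) h (m_ eps1 eps2)
      (wgrad (u_ eps1 eps2)) (whess (u_ eps1 eps2)) x) in
  exists J : 'rV[R]_d -> 'rV[R]_d,
    [/\ Lp_vec q J,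
        exists2 k : nat -> nat, {homo k : i j / (i < j)%N} &
          weak_cvg (Lp_vec q) (Lp_vec_norm q)
            (fun n => flux (e1 (k n)) (e2 (k n))) J &
        eq_distr
          (dist m - \sum_i dD i (dist (fun x => J x 0 i))
           - \sum_i \sum_j dD j (dD i (dist (fun x => a x i j * m x))))
          (dist (cst 1))].

Proof.
move=> d0 HE Hh Hg Hr Hgs Hgc Hgr HS Hmon Hdeg HN Hq0 Hbeta Hsol Lm Su m0 m1 Hws Hb He1 He2
  Hwm Hwu q flux.
have ga : 1 < gamma by case: Hgr.
have al : 0 < alpha by case: Hdeg => _ _ _ _ [].
have [p1 q1 pq] := flux_exponent_conj ga al.
have [K HK] := uniform_flux_bound HE Hh Hg Hgs HS Hdeg HN Hbeta.
rewrite -[flux_exponent _ _]/q in q1 pq HK.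
have S n := Hsol _ _ (Hb n).1 (Hb n).2.
have HKn n := HK _ _ _ _ (Hb n).1 (Hb n).2 (S n).1 (S n).2.
pose F n := flux (e1 n) (e2 n).
pose f n i x := m_ (e1 n) (e2 n) x * hamiltonian_at (DpH H i) h (m_ (e1 n) (e2 n))
      (wgrad (u_ (e1 n) (e2 n))) (whess (u_ (e1 n) (e2 n))) x.
have FE n i : (fun x => F n x 0 i) = f n i by apply/funext => x; rewrite mxE.
have LF n : Lp_vec q (F n) by move=> i; rewrite FE; exact: (HKn n i).1.
have FK n i : \int[cube d]_x (`|F n x 0 i| `^ q) <= K.
  rewrite (_ : (fun x => `|F n x 0 i| `^ q) = (fun x => `|f n i x| `^ q)).
    exact: (HKn n i).2.
  by apply/funext => x; rewrite mxE.
have [k kI [J LJ HJ]] := weak_compactness_vec p1 q1 pq LF FK.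
exists J; split => //.
  exists k; first exact: kI.
  exact: (weak_cvg_vec p1 q1 pq (fun n => LF (k n)) LJ HJ).
move=> phi Cphi.
pose mk n := m_ (e1 (k n)) (e2 (k n)); pose uk n := u_ (e1 (k n)) (e2 (k n)).
(* Test functions that carry the Laplacians of the regularization: [e1] and [e2] then multiply
   convergent pairings with [u]. *)
pose psi1 x := phi x + iter (2 * N) lap phi x.
pose psi2 x := phi x - lap phi x.
have CL r : Cinf (iter r lap phi) := Cinf_iter_lap r Cphi.
have Cpsi1 : Cinf psi1 := CinfD Cphi (CL (2 * N)%N).
have Cpsi2 : Cinf psi2.
  by apply: Cinf_ext (CinfD Cphi (CinfZ (- 1) (CL 1%N))) => x; rewrite mulN1r.
(* The sign comes from [DMH H i j = - a x i j]. *)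
pose chi i j x := - a x i j * pderiv i (pderiv j phi) x.
have Cchi i j : Cinf (chi i j).
  have [_ Ca _ _ _] := Hdeg.
  apply: CinfM; last by do 2 apply: Cinf_pderiv.
  by apply: Cinf_ext (CinfZ (- 1) (Ca i j)) => x; rewrite mulN1r.
(* Exponent conjugate to [q], for which the flux was shown to converge. *)
have Lpp i : Lpow (cube d) ((alpha + 1) * gamma / alpha) (pderiv i phi).
  by apply: Lpow_Cinf (Cinf_pderiv i Cphi); exact: ltW (lt_trans ltr01 p1).
have T0 n : \int[cube d]_x (mk n x * phi x)
    + \sum_i \int[cube d]_x (F (k n) x 0 i * pderiv i phi x)
    + \sum_i \sum_j \int[cube d]_x (mk n x * chi i j x)
    - \int[cube d]_x (1 * phi x)
    + e1 (k n) * \int[cube d]_x (uk n x * psi1 x)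
    + e2 (k n) * \int[cube d]_x (uk n x * psi2 x) = 0.
  have [dom sol] := S (k n); have [_ Wu] := sol_wsob dom.
  have [_ hu _] := wsob_base Wu.
  have [_ dN] := exponent_condition HN.
  have W1 : wsob (2 * N).*2 2 (uk n).
    by apply: wsob_le Wu; rewrite -muln2 mulnAC.
  have W2 : wsob 2 2 (uk n).
    by apply: wsob_le Wu; apply: leq_trans dN; exact: leq_addl.
  have R1 : \int[cube d]_x (uk n x * psi1 x) = \int[cube d]_x (uk n x * phi x) +
      \int[cube d]_x (iter (2 * N) wlap (uk n) x * phi x).
    apply: etrans (etrans (RintD (intbM_Cinf hu Cphi) (intbM_Cinf hu (CL (2 * N)%N)))
      (f_equal2 +%R erefl (esym (iter_wlap_test W1 Cphi)))).
    by apply: eq_Rintegral => x _; rewrite mulrDr.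
  have R2 : \int[cube d]_x (uk n x * psi2 x) = \int[cube d]_x (uk n x * phi x) -
      \int[cube d]_x (wlap (uk n) x * phi x).
    apply: etrans (etrans (RintB (intbM_Cinf hu Cphi) (intbM_Cinf hu (CL 1%N)))
      (f_equal2 (fun s t => s - t) erefl (esym (wlap_test W2 Cphi)))).
    by apply: eq_Rintegral => x _; rewrite mulrBr.
  have R3 : \sum_i \int[cube d]_x (F (k n) x 0 i * pderiv i phi x) =
      \sum_i \int[cube d]_x (f (k n) i x * pderiv i phi x).
    by apply: eq_bigr => i _; apply: eq_Rintegral => x _; rewrite mxE.
  have R4 : \sum_i \sum_j \int[cube d]_x (mk n x * chi i j x) =
      \sum_i \sum_j \int[cube d]_x (mk n x * hamiltonian_at (DMH H i j) h (mk n)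
        (wgrad (uk n)) (whess (uk n)) x * pderiv i (pderiv j phi) x).
    apply: eq_bigr => i _; apply: eq_bigr => j _; apply: eq_Rintegral => x _.
    by rewrite (DMH_sol HE Hdeg dom i j x) -mulrA.
  by rewrite R1 R2 R3 R4; exact: (reg_weak_form sol Cphi).
have kn := increasing_ge kI.
have cm psi : Cinf psi -> (\int[cube d]_x (mk n x * psi x)) @[n --> \oo] -->
    \int[cube d]_x (m x * psi x).
  by move=> Cp; exact: (cvg_subseq_ge kn (weak_cvg_L1_test Cp Hwm)).
have cu psi : Cinf psi -> (\int[cube d]_x (uk n x * psi x)) @[n --> \oo] -->
    \int[cube d]_x (u x * psi x).
  by move=> Cp; exact: (cvg_subseq_ge kn (weak_cvg_sobolev_test ga Cp Hwu)).
have ce1 := cvg_subseq_ge kn He1; have ce2 := cvg_subseq_ge kn He2.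
have cF := @cvg_sumr R _ (index_enum 'I_d)
  (fun i n => \int[cube d]_x (F (k n) x 0 i * pderiv i phi x))
  (fun i => \int[cube d]_x (J x 0 i * pderiv i phi x)) (fun i => HJ i _ (Lpp i)).
have cA' i := @cvg_sumr R _ (index_enum 'I_d)
  (fun j n => \int[cube d]_x (mk n x * chi i j x))
  (fun j => \int[cube d]_x (m x * chi i j x)) (fun j => cm _ (Cchi i j)).
have cA := @cvg_sumr R _ (index_enum 'I_d)
  (fun i n => \sum_j \int[cube d]_x (mk n x * chi i j x))
  (fun i => \sum_j \int[cube d]_x (m x * chi i j x)) cA'.
(* Convergence of the pairing suffices here; no uniform control of the high derivatives of [u] is
   available. *)
have c5 : e1 (k n) * \int[cube d]_x (uk n x * psi1 x) @[n --> \oo] --> 0.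
  by rewrite -(mul0r (\int[cube d]_x (u x * psi1 x))); exact: cvgM ce1 (cu _ Cpsi1).
have c6 : e2 (k n) * \int[cube d]_x (uk n x * psi2 x) @[n --> \oo] --> 0.
  by rewrite -(mul0r (\int[cube d]_x (u x * psi2 x))); exact: cvgM ce2 (cu _ Cpsi2).
have Lim : \int[cube d]_x (m x * phi x) + \sum_i \int[cube d]_x (J x 0 i * pderiv i phi x)
    + \sum_i \sum_j \int[cube d]_x (m x * chi i j x)
    - \int[cube d]_x (1 * phi x) + 0 + 0 = 0.
  have c4 : (fun _ : nat => \int[cube d]_x (1 * phi x)) n @[n --> \oo] -->
    \int[cube d]_x (1 * phi x) by exact: cvg_cst.
  have C := cvg_alternating_sum (cm _ Cphi) cF cA c4 c5 c6.
  move: C; rewrite (_ : (fun n => _) = (fun _ : nat => 0 : R)); last first.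
    by apply/funext => n; exact: T0.
  by move=> C; exact: cvg_eq C (cvg_cst (0 : R)).
have S1 : (\sum_i dD i (dist (fun x => J x 0 i))) phi =
    - \sum_i \int[cube d]_x (J x 0 i * pderiv i phi x).
  by rewrite fct_sumE -sumrN.
have S2 : (\sum_i \sum_j dD j (dD i (dist (fun x => a x i j * m x)))) phi =
    - \sum_i \sum_j \int[cube d]_x (m x * chi i j x).
  have [_ Ca _ _ _] := Hdeg; have [_ hm] := (Lp1P m).1 Lm.
  rewrite fct_sumE -sumrN; apply: eq_bigr => i _; rewrite fct_sumE -sumrN.
  apply: eq_bigr => j _; rewrite /dD opprK /dist -(RintN (intbM_Cinf hm (Cchi i j))).
  by apply: eq_Rintegral => x _; rewrite /chi; ring.
have G : dist m phi - (\sum_i dD i (dist (fun x => J x 0 i))) phi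
    - (\sum_i \sum_j dD j (dD i (dist (fun x => a x i j * m x)))) phi = dist (cst 1) phi.
  move: Lim; rewrite S1 S2 /dist !opprK !addr0 => /eqP; rewrite subr_eq0 => /eqP.
  exact.
exact: G.
Qed.
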